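(* For every $u\in H^2(\mathbb T^3)$ with zero mean, $\int_{\mathbb T^3}u(x)\,dx=0$, the following inequality holds: $$\|u\|_{L_\infty(\mathbb T^3)}^2\le\frac1{2\pi}\|\nabla u\|_{L_2(\mathbb T^3)}\|\Delta u\|_{L_2(\mathbb T^3)}-\frac{-\beta_3}{4\pi^3}\|\nabla u\|_{L_2(\mathbb T^3)}^2 .$$
   Context: $\mathbb T^3=[-\pi,\pi]^3$ is the three-dimensional torus (periodic boundary conditions, Lebesgue measure). The constant $\beta_3$ is $$\beta_3=-1-2\pi^{3/2}+\sum_{k\in\mathbb Z^3\setminus\{0\}}\left(\frac{e^{-|k|^2}}{|k|^2}+\pi\,\frac{\operatorname{erfc}(\pi|k|)}{|k|}\right)=-8.91363291758515127\ldots,$$ where $|k|$ is the Euclidean norm and $\operatorname{erfc}(x)=\frac2{\sqrt\pi}\int_x^\infty e^{-t^2}dt$. *)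

(* Defs.v *)
From HB Require Import structures.
From mathcomp Require Import all_boot all_order all_algebra.
From mathcomp Require Import all_classical all_reals all_analysis.
From mathcomp Require Import complex.
Set Implicit Arguments.
Unset Strict Implicit.
Unset Printing Implicit Defensive.
Import Order.TTheory GRing.Theory Num.Theory.
Import numFieldNormedType.Exports.
Local Open Scope classical_set_scope.
Local Open Scope ring_scope.

Section Torus.
Context {R : realType}.

Definition cube : set (R * R * R) :=
  (`[- pi, pi]%classic `*` `[- pi, pi]%classic) `*` `[- pi, pi]%classic.

Lemma measurable_cube : measurable cube.
Proof. by do 2?apply: measurableX; exact: measurable_itv. Qed.

(* The torus is modelled by the cube. A function on the torus is represented by
   a function on [R * R * R], which need not be periodic: apart from the
   requirement that it be measurable, every notion below depends only on its
   class modulo equality almost everywhere for [torus_measure], hence not on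
   its values outside the cube. Periodicity is
   imposed on the test functions that define weak derivatives. *)
Definition torus_measure :=
  mrestr ((@lebesgue_measure R \x @lebesgue_measure R)
            \x @lebesgue_measure R)%E measurable_cube.

Definition basis3 (i : 'I_3) : R * R * R :=
  ((i == 0 :> nat)%N%:R, (i == 1 :> nat)%N%:R, (i == 2 :> nat)%N%:R).

Definition partial (i : 'I_3) (phi : R * R * R -> R) : R * R * R -> R :=
  fun x => 'D_(basis3 i) phi x.

(* For [s = [:: i1; ...; im]], [foldr partial phi s] is the iterated partial
   derivative d_i1 ... d_im phi. *)
Definition smooth (phi : R * R * R -> R) : Prop :=
  forall (s : seq 'I_3) (x : R * R * R), differentiable (foldr partial phi s) x.

Definition periodic3 (phi : R * R * R -> R) : Prop :=
  forall (i : 'I_3) (x : R * R * R), phi (x + (2 * pi) *: basis3 i) = phi x.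

Definition Cintegral (f : R * R * R -> R[i]) : R[i] :=
  ((\int[torus_measure]_x complex.Re (f x)) +i*
   (\int[torus_measure]_x complex.Im (f x)))%C.

Definition CLfun (p : \bar R) (f : R * R * R -> R[i]) : Prop :=
  (fun x => complex.Re (f x)) \in Lfun torus_measure p /\
  (fun x => complex.Im (f x)) \in Lfun torus_measure p.

(* Real test functions suffice: both sides are complex linear in [phi]. *)
Definition is_weak_partial (i : 'I_3) (u g : R * R * R -> R[i]) : Prop :=
  CLfun 1%:E g /\
  forall phi : R * R * R -> R, smooth phi -> periodic3 phi ->
    Cintegral (fun x => u x * (partial i phi x)%:C%C) =
    - Cintegral (fun x => g x * (phi x)%:C%C).

(* A chosen weak derivative (it is unique almost everywhere), and 0 when there
   is none. *)
Definition weak_partial (i : 'I_3) (u : R * R * R -> R[i]) :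
    R * R * R -> R[i] :=
  xget (fun=> 0) [set g | is_weak_partial i u g].

(* [sobolev k] is H^k(T^3). *)
Fixpoint sobolev (k : nat) (u : R * R * R -> R[i]) : Prop :=
  CLfun 2%:E u /\
  if k is k'.+1 then
    forall i : 'I_3, (exists g, is_weak_partial i u g) /\
                     sobolev k' (weak_partial i u)
  else True.

Definition cmod (z : R[i]) : R :=
  Num.sqrt (complex.Re z ^+ 2 + complex.Im z ^+ 2).

Definition grad_mod (u : R * R * R -> R[i]) : R * R * R -> R :=
  fun x => Num.sqrt (\sum_(i < 3) cmod (weak_partial i u x) ^+ 2).

Definition laplacian (u : R * R * R -> R[i]) : R * R * R -> R[i] :=
  fun x => \sum_(i < 3) weak_partial i (weak_partial i u) x.

Definition norm_Linfty (u : R * R * R -> R[i]) : \bar R :=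
  Lnorm torus_measure +oo%E (fun x => (cmod (u x))%:E).

Definition norm_L2 (u : R * R * R -> R[i]) : \bar R :=
  Lnorm torus_measure 2%:E (fun x => (cmod (u x))%:E).

Definition norm_grad_L2 (u : R * R * R -> R[i]) : \bar R :=
  Lnorm torus_measure 2%:E (fun x => (grad_mod u x)%:E).

End Torus.

Section Beta3.
Variable R : realType.

Definition erfc (x : R) : R :=
  2 / Num.sqrt pi *
  \int[@lebesgue_measure R]_(t in `[x, +oo[) expR (- t ^+ 2).

Definition lattice_mod (k : int * int * int) : R :=
  Num.sqrt (k.1.1%:~R ^+ 2 + k.1.2%:~R ^+ 2 + k.2%:~R ^+ 2).

(* The terms are nonnegative and the series converges, so that [fine] only
   turns its finite sum into a real number. *)
Definition beta3 : R :=
  - 1 - 2 * pi `^ (3 / 2) +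
  fine (\esum_(k in [set k : int * int * int | k != 0])
    (expR (- lattice_mod k ^+ 2) / lattice_mod k ^+ 2 +
     pi * (erfc (pi * lattice_mod k) / lattice_mod k))%:E).

End Beta3.

(* Main.v *)
Require Import Defs.
From HB Require Import structures.
From mathcomp Require Import all_boot all_order all_algebra.
From mathcomp Require Import all_classical all_reals all_analysis.
From mathcomp Require Import complex.
From mathcomp Require Import measurable_realfun ess_sup_inf.
From mathcomp Require Import ring lra zify.
Set Implicit Arguments.
Unset Strict Implicit.
Unset Printing Implicit Defensive.
Import Order.TTheory GRing.Theory Num.Theory.
Import numFieldNormedType.Exports.
Local Open Scope classical_set_scope.
Local Open Scope ring_scope.

(** Only the Fourier coefficients of u enter. Let A and B be the squares of the
    L^2 norms of the gradient and of the Laplacian, and V = (2 pi)^3. The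
    supremum of |u| is at most the sum of the moduli of its Fourier coefficients
    ([ae_le_of_psum]), and the coefficient at 0 vanishes. For every s > 0 the
    Cauchy-Schwarz inequality with the weight |k|^2 (|k|^2 + s^2) gives
    ([sum_coef_le])

      |u|^2 <= (B + s^2 A) / V * (sum over k <> 0 of 1 / (|k|^2 (|k|^2 + s^2))).

    The lattice sum is the value at 0 of the Green function of
    Delta^2 - s^2 Delta, and [Green_bound] bounds s^2 times it by
    2 pi^2 s + beta3 + 1 / s^2. To see this, write s^2 / (|k|^2 (|k|^2 + s^2)) as
    the integral of exp(-t |k|^2) (1 - exp(-t s^2)) over t > 0, cut it at t = 1,
    and use the theta transformation on both parts; the terms of the
    series that defines beta3 are what the cut at t = 1 leaves over. As the first
    nonzero frequency has modulus 1, A <= B ([grad2_le_laplacian]); with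
    s = sqrt (B / A) - 3/10 the bound becomes the claim, by an elementary
    inequality that needs beta3 <= -8.55 ([optimal_shift], [beta3_le]).

    Two classical facts are proved on the way. The theta transformation
    ([theta_functional]) follows Polya: the orthogonality of the characters of
    Z/l gives an identity between a sum of powers of cosines and a sum of equally
    spaced binomial coefficients, and a limit of it gives one inequality between
    theta at t and at pi^2 / t, which applied twice is an equality. The
    completeness of the characters ([approx_CL2]) is a monotone class argument:
    the sets whose indicator function is an L^2 limit of trigonometric
    polynomials form a sigma-algebra, and it contains the arcs
    {cos (x_i - c) > cos h}. *)

(** * Elementary bounds for the trigonometric functions *)

(** Reduces a derivative claim to the equation between the value claimed and the
    one that instance resolution computes. *)
Ltac derive_by_rules := eapply is_derive_eq; [exact _|].

Section Real_monotonicity.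
Context {R : realType}.
Implicit Types x y t : R.

Lemma ge0_of_derive_ge0 (f f' : R -> R) (x : R) :
  (forall y, is_derive y 1 f (f' y)) -> (forall y, 0 <= y <= x -> 0 <= f' y) ->
  0 <= f 0 -> 0 <= x -> 0 <= f x.
Proof.
move=> df f'0 f0 x0.
have cf : {within `[0, x], continuous f}.
  apply: continuous_subspaceT => z; apply: differentiable_continuous.
  by apply/derivable1_diffP; have := df z; case.
have [c cx /eqP] := MVT_segment x0 (fun y _ => df y) cf.
rewrite subr0 subr_eq => /eqP ->.
by rewrite addr_ge0// mulr_ge0// f'0//; move: cx; rewrite in_itv.
Qed.

End Real_monotonicity.

Section Cosine_bounds.
Context {R : realType}.
Implicit Types x y t : R.

(** Each of the Taylor bounds below follows from the previous one by comparing
    derivatives on [0, x]. *)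
Lemma sin_le_id x : 0 <= x -> sin x <= x.
Proof.
move=> x0; rewrite -subr_ge0.
apply: (@ge0_of_derive_ge0 _ (fun x => x - sin x) (fun x => 1 - cos x)).
- by move=> y _; rewrite subr_ge0 cos_le1.
- by rewrite sin0 subrr.
- by [].
Qed.

Lemma cos_ge_sqr x : 0 <= x -> 1 - x ^+ 2 / 2 <= cos x.
Proof.
move=> x0; rewrite -subr_ge0.
apply: (@ge0_of_derive_ge0 _ (fun x => cos x - (1 - x ^+ 2 / 2)) (fun x => x - sin x)).
- by move=> y; derive_by_rules; rewrite /GRing.scale/=; field.
- by move=> y /andP[y0 _]; rewrite subr_ge0 sin_le_id.
- by rewrite cos0 expr0n/= mul0r !subr0 subrr.
- by [].
Qed.

Lemma sin_ge_cube x : 0 <= x -> x - x ^+ 3 / 6 <= sin x.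
Proof.
move=> x0; rewrite -subr_ge0.
apply: (@ge0_of_derive_ge0 _ (fun x => sin x - (x - x ^+ 3 / 6)) (fun x => cos x - (1 - x ^+ 2 / 2))).
- by move=> y; derive_by_rules; rewrite /GRing.scale/=; field.
- by move=> y /andP[y0 _]; rewrite subr_ge0 cos_ge_sqr.
- by rewrite sin0 expr0n/= mul0r !subr0.
- by [].
Qed.

Lemma cos_le_pow4 x : 0 <= x -> cos x <= 1 - x ^+ 2 / 2 + x ^+ 4 / 24.
Proof.
move=> x0; rewrite -subr_ge0.
apply: (@ge0_of_derive_ge0 _ (fun x => 1 - x ^+ 2 / 2 + x ^+ 4 / 24 - cos x) (fun x => sin x - (x - x ^+ 3 / 6))).
- by move=> y; derive_by_rules; rewrite /GRing.scale/=; field.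
- by move=> y /andP[y0 _]; rewrite subr_ge0 sin_ge_cube.
- by rewrite cos0 !expr0n/= !mul0r subr0 addr0 subrr.
- by [].
Qed.

Lemma sin_le_pow5 x : 0 <= x -> sin x <= x - x ^+ 3 / 6 + x ^+ 5 / 120.
Proof.
move=> x0; rewrite -subr_ge0.
apply: (@ge0_of_derive_ge0 _ (fun x => x - x ^+ 3 / 6 + x ^+ 5 / 120 - sin x)
   (fun x => 1 - x ^+ 2 / 2 + x ^+ 4 / 24 - cos x)).
- by move=> y; derive_by_rules; rewrite /GRing.scale/=; field.
- by move=> y /andP[y0 _]; rewrite subr_ge0 cos_le_pow4.
- by rewrite sin0 !expr0n/= !mul0r !subr0 addr0.
- by [].
Qed.

(** If pi / 2 were at most 31/20 the cosine would be nonpositive there; Taylor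
    bounds at half that angle and the duplication formula show that it is
    positive. *)
Lemma pi_gt31 : 31 / 10 < pi :> R.
Proof.
rewrite ltNge; apply/negP => pile.
have : 0 < cos (31 / 20 : R).
  have -> : 31 / 20 = (31 / 40) *+ 2 :> R by rewrite mulr2n; lra.
  have sin0x : 0 <= sin (31 / 40 : R) by apply: le_trans (sin_ge_cube _); lra.
  have : sin (31 / 40 : R) <= 7 / 10 by apply: le_trans (sin_le_pow5 _) _; lra.
  by rewrite cos_mulr2n cos2sin2 => sinx; nra.
have h2 := @pihalf_02 R; have h0 := @pi_ge2 R.
have : cos (31 / 20 : R) <= cos (pi / 2 : R).
  rewrite leNgt ltr_cos ?in_itv/=; last 2 first.
  - by apply/andP; split; lra.
  - by apply/andP; split; lra.
  by rewrite -leNgt; lra.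
by rewrite cos_pihalf; lra.
Qed.

(** The quartic Taylor bound makes the cosine of 8/5 negative. *)
Lemma pi_lt32 : pi < 32 / 10 :> R.
Proof.
rewrite ltNge; apply/negP => pile.
have : cos (16 / 10 : R) < 0.
  apply: le_lt_trans (cos_le_pow4 _) _; lra.
have h2 := @pihalf_02 R; have h0 := @pi_ge2 R.
have : cos (pi / 2 : R) <= cos (16 / 10 : R).
  rewrite leNgt ltr_cos ?in_itv/=; last 2 first.
  - by apply/andP; split; lra.
  - by apply/andP; split; lra.
  by rewrite -leNgt; lra.
by rewrite cos_pihalf; lra.
Qed.

(** The function exp(x^2/2) cos x decreases on [0, pi/2], because
    tan x >= x. *)
Lemma cos_le_gauss x : `|x| <= pi / 2 -> cos x <= expR (- (x ^+ 2 / 2)).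
Proof.
wlog x0 : x / 0 <= x => [H|].
  have [/H//|x0 xpi] := leP 0 x.
  have {H} := H (- x); rewrite cosN sqrrN normrN; apply => //.
  by rewrite oppr_ge0 ltW.
rewrite ger0_norm// => xpi.
have tan_ge y : 0 <= y <= x -> 0 <= sin y - y * cos y.
  move=> /andP[y0 yx].
  apply: (@ge0_of_derive_ge0 _ (fun y => sin y - y * cos y) (fun y => y * sin y)).
  - by move=> z; derive_by_rules; rewrite /GRing.scale/=; ring.
  - move=> z /andP[z0 zy]; rewrite mulr_ge0// sin_ge0_pi// z0/=.
    by have := @pi_ge0 R; lra.
  - by rewrite sin0 mul0r subrr.
  - by [].
have : 0 <= 1 - expR (x ^+ 2 / 2) * cos x.
  apply: (@ge0_of_derive_ge0 _ (fun y => 1 - expR (y ^+ 2 / 2) * cos y)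
     (fun y => expR (y ^+ 2 / 2) * (sin y - y * cos y))).
  - by move=> z; derive_by_rules; rewrite /GRing.scale/=; field.
  - by move=> z zx; rewrite mulr_ge0 ?expR_ge0 ?tan_ge.
  - by rewrite expr0n/= mul0r expR0 cos0 mulr1 subrr.
  - by [].
rewrite subr_ge0 => h.
by rewrite expRN -[leRHS]mul1r ler_pdivlMr ?expR_gt0// mulrC.
Qed.

End Cosine_bounds.

(** * Polya's finite form of the theta transformation *)

Section Polya.
Context {R : realType}.
Implicit Types x y t : R.

(** The binomial formula for (e^(ix) + e^(-ix))^n, kept real. *)
Lemma cos_expansion n x :
  (2 * cos x) ^+ n = \sum_(i < n.+1) 'C(n, i)%:R * cos ((n%:R - 2 * i%:R) * x).
Proof.
elim: n => [|n IH].
  by rewrite big_ord1 expr0 bin0 mul1r /= mulr0 subrr mul0r cos0.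
rewrite exprS {}IH mulr_sumr.
under eq_bigr => i _.
  rewrite (_ : _ * _ = 'C(n, i)%:R * cos ((n.+1%:R - 2 * i%:R) * x) +
               'C(n, i)%:R * cos ((n.+1%:R - 2 * i.+1%:R) * x)); last first.
    rewrite -[n.+1%:R]natr1 -[i.+1%:R]natr1.
    rewrite (_ : (n%:R + 1 - 2 * i%:R) * x = (n%:R - 2 * i%:R) * x + x); last ring.
    rewrite (_ : (n%:R + 1 - 2 * (i%:R + 1)) * x = (n%:R - 2 * i%:R) * x - x); last ring.
    by rewrite cosB cosD; ring.
  over.
rewrite big_split/= [RHS]big_ord_recl/= bin0.
under [in RHS]eq_bigr => i _ do rewrite binS natrD mulrDl.
rewrite big_split/= addrA; congr (_ + _).
by rewrite [in RHS]big_ord_recr/= bin_small// mul0r addr0 big_ord_recl bin0.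
Qed.

(** The real form of the orthogonality of the characters of Z/l. *)
Lemma sum_cos_roots (l d : nat) : (0 < l)%N ->
  \sum_(j < l) cos (2 * pi * j%:R * d%:R / l%:R) = (l %| d)%:R * l%:R :> R.
Proof.
move=> l0; have lR : l%:R != 0 :> R by rewrite pnatr_eq0 -lt0n.
case: (boolP (l %| d)%N) => [/dvdnP[q ->]|ld].
  rewrite mul1r; transitivity (\sum_(j < l) (1 : R)); last by rewrite sumr_const card_ord.
  apply: eq_bigr => j _; rewrite natrM.
  rewrite (_ : _ / _ = 0 + pi *+ 2 *+ (j * q)); last first.
    by rewrite add0r -[_ *+ (j * q)]mulr_natr natrM -[pi *+ 2]mulr_natr; field.
  by rewrite (periodicn (@cosD2pi R)) cos0.
rewrite mul0r; pose a : R := pi * d%:R / l%:R.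
have sina : sin a != 0.
  have [q [r [dE rl r0]]] : exists q r, [/\ d = (q * l + r)%N, (r < l)%N & (0 < r)%N].
    by exists (d %/ l)%N, (d %% l)%N; rewrite -divn_eq ltn_mod l0 lt0n.
  rewrite -normr_eq0 /a dE.
  have -> : pi * (q * l + r)%:R / l%:R = pi * r%:R / l%:R + pi *+ q :> R.
    by rewrite natrD natrM -[pi *+ q]mulr_natr; field.
  rewrite (alternatingn (@sinDpi R)) normrM normrX normrN1 expr1n mul1r.
  rewrite normr_eq0 gt_eqF// sin_gt0_pi//.
  have rl' : r%:R < l%:R :> R by rewrite ltr_nat.
  rewrite divr_gt0 ?mulr_gt0 ?pi_gt0 ?ltr0n//= ltr_pdivrMr ?ltr0n//.
  by rewrite ltr_pM2l ?pi_gt0.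
apply: (mulfI sina); rewrite mulr0; apply: (@mulfI _ 2) => //; rewrite mulr0.
(* Multiplying by the sine of half the step makes the sum telescope. *)
have tel k : 2 * (sin a * \sum_(j < k) cos (2 * pi * j%:R * d%:R / l%:R)) =
    sin ((2 * k%:R - 1) * a) + sin a.
  elim: k => [|k IH].
    by rewrite big_ord0 !mulr0 sub0r mulN1r sinN addNr.
  rewrite big_ord_recr/= 2!mulrDr IH -[k.+1%:R]natr1.
  rewrite (_ : 2 * pi * k%:R * d%:R / l%:R = 2 * k%:R * a); last by rewrite /a; ring.
  rewrite (_ : (2 * k%:R - 1) * a = 2 * k%:R * a - a); last ring.
  rewrite (_ : (2 * (k%:R + 1) - 1) * a = 2 * k%:R * a + a); last ring.
  by rewrite sinB sinD; ring.
rewrite tel (_ : (2 * l%:R - 1) * a = - a + pi *+ 2 *+ d); last first.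
  by rewrite /a -[_ *+ d]mulr_natr -[pi *+ 2]mulr_natr; field.
by rewrite (periodicn (@sinD2pi R)) sinN addNr.
Qed.

Lemma sum_multiples_le (g : nat -> nat) l N : (0 < l)%N ->
  (\sum_(k < N) g (l * k.+1) <= \sum_(d < l * N) (l %| d.+1) * g d.+1)%N.
Proof.
move=> l0; elim: N => [|N IH]; first by rewrite big_ord0.
have e : (l * N.+1 = l * N + l)%N by rewrite mulnS addnC.
rewrite big_ord_recr/= e big_split_ord/= leq_add//.
case: l l0 {IH} e => // l _ e.
by rewrite big_ord_recr/= -addnS -e dvdn_mulr// mul1n leq_addl.
Qed.

(** Both sides are l times the number of walks of m.*2 steps +1 or -1 on the
    integers that end in a multiple of 2 l; the left-hand side counts them
    through the characters of a cyclic group. As l grows, with m of order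
    l^2 / t, the left-hand side tends to a theta series at pi^2 / t and, by
    the central limit behaviour of binomial coefficients, the right-hand side
    tends to one at t: this is the theta transformation. *)
Lemma Polya_identity m l : (0 < l)%N ->
  \sum_(j < l) (2 * cos (pi * j%:R / l%:R)) ^+ m.*2 =
  l%:R * ('C(m.*2, m) + 2 * \sum_(d < m) (l %| d.+1) * 'C(m.*2, m + d.+1))%:R :> R.
Proof.
move=> l0; have lR : l%:R != 0 :> R by rewrite pnatr_eq0 -lt0n.
under eq_bigr do rewrite cos_expansion.
rewrite exchange_big/=.
have E (i : nat) (d : nat) : (`|m%:R - i%:R| = d%:R :> R) ->
   \sum_(j < l) 'C(m.*2, i)%:R * cos (((m.*2)%:R - 2 * i%:R) * (pi * j%:R / l%:R))
   = l%:R * ((l %| d) * 'C(m.*2, i))%:R :> R.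
  move=> id; rewrite -mulr_sumr natrM mulrA [l%:R * _]mulrC -sum_cos_roots// mulrC.
  congr (_ * _); apply: eq_bigr => j _; rewrite -cos_norm -[RHS]cos_norm; congr cos.
  rewrite -mul2n natrM -mulrBr !normrM id.
  by rewrite [`|d%:R|]ger0_norm//; ring.
rewrite -addnn -addnS big_split_ord/= big_ord_recl/=.
under [X in X + _]eq_bigr => i _.
  rewrite addnn (E _ (m - i)%N); last first.
    by rewrite -natrB ?normr_nat//; apply: ltnW.
  over.
under [X in _ + (_ + X)]eq_bigr => i _.
  rewrite /bump/= add1n addnn (E _ i.+1); last first.
    by rewrite natrD opprD addrA subrr sub0r normrN normr_nat.
  over.
rewrite addn0 addnn (E _ 0%N) ?subrr ?normr0// dvdn0 mul1n.
rewrite (reindex_inj rev_ord_inj)/=.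
under eq_bigr => i _.
  rewrite subKn// -bin_sub; last by rewrite -addnn (leq_trans (leq_subr _ _))// leq_addr.
  rewrite -addnn subnBA// addnn (_ : m.*2 + i.+1 - m = m + i.+1)%N; last first.
    by rewrite -addnn -addnA addKn.
  over.
by rewrite -!mulr_sumr -natr_sum natrD natrM; ring.
Qed.

Definition theta_partial t N : R := 1 + 2 * \sum_(k < N) expR (- (t * k.+1%:R ^+ 2)).

Lemma theta_partial_mono t t' N : t' <= t -> theta_partial t N <= theta_partial t' N.
Proof.
move=> tt; rewrite lerD2l ler_pM2l//; apply: ler_sum => k _.
by rewrite ler_expR lerN2 ler_wpM2r// sqr_ge0.
Qed.

(** The bound cos x <= exp(-x^2/2) is lossless in the limit, since only the
    indices near 0 and near l contribute. *)
Lemma Polya_upper m l : (0 < l)%N ->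
  \sum_(j < l) cos (pi * j%:R / l%:R) ^+ m.*2 <=
  theta_partial (pi ^+ 2 * m%:R / l%:R ^+ 2) l :> R.
Proof.
case: l => // l _.
pose f (k : nat) : R := expR (- (pi ^+ 2 * m%:R / l.+1%:R ^+ 2 * k%:R ^+ 2)).
have l0 : 0 < l.+1%:R :> R by [].
have cosf (x : R) (k : nat) : `|x| = pi * k%:R / l.+1%:R -> `|x| <= pi / 2 ->
    cos x ^+ m.*2 <= f k.
  move=> xk xpi.
  have cx0 : 0 <= cos x by rewrite cos_ge0_pihalf// -ler_norml.
  apply: le_trans (_ : expR (- (x ^+ 2 / 2)) ^+ m.*2 <= _).
    by apply: lerXn2r; rewrite ?nnegrE ?expR_ge0// cos_le_gauss.
  rewrite -expRM_natl ler_expR -[x ^+ 2]real_normK ?num_real// xk -mul2n natrM.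
  by rewrite le_eqVlt; apply/orP; left; apply/eqP; field; rewrite addrC natr1 gt_eqF.
rewrite big_ord_recl/= mulr0 mul0r cos0 expr1n /theta_partial lerD2l.
(* On the circle Z/l the nearer of the two representatives k and l - k of a
   residue gives the bound, and the sum over both only adds positive terms. *)
have bnd (k : 'I_l) : cos (pi * (bump 0 k)%:R / l.+1%:R) ^+ m.*2 <= f k.+1 + f (l - k)%N.
  rewrite /bump/= add1n.
  have kl : (k <= l)%N by apply: ltnW.
  have [h|h] := leP (k.+1%:R *+ 2) (l.+1%:R : R).
    rewrite -[leLHS]addr0 lerD ?expR_ge0// cosf// ger0_norm ?divr_ge0 ?mulr_ge0 ?pi_ge0//.
    rewrite ler_pdivrMr// mulrAC -mulrA ler_pM2l ?pi_gt0//.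
    by rewrite ler_pdivlMr// mulr_natr.
  rewrite -[leLHS]add0r lerD ?expR_ge0//.
  have -> : cos (pi * k.+1%:R / l.+1%:R) ^+ m.*2 =
      cos (pi * (l - k)%:R / l.+1%:R) ^+ m.*2 :> R.
    rewrite (_ : pi * k.+1%:R / l.+1%:R = - (pi * (l - k)%:R / l.+1%:R) + pi); last first.
      by rewrite natrB// -!natr1; field; rewrite natr1 gt_eqF.
    by rewrite cosDpi cosN -mul2n !exprM sqrrN.
  rewrite cosf// ger0_norm ?divr_ge0 ?mulr_ge0 ?pi_ge0//.
  rewrite ler_pdivrMr// mulrAC -mulrA ler_pM2l ?pi_gt0//.
  rewrite ler_pdivlMr// mulr_natr natrB// mulrnBl.
  by move: h; rewrite -!natr1 mulrnDl mulr2n mulr2n; lra.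
apply: le_trans (ler_sum _ (fun k _ => bnd k)) _.
rewrite big_split/= [X in _ + X](reindex_inj rev_ord_inj)/=.
under [X in _ + X]eq_bigr => k _ do rewrite subKn//.
by rewrite -[leLHS]mulr2n -[leLHS]mulr_natl ler_pM2l// big_ord_recr/= lerDl expR_ge0.
Qed.

End Polya.

(** * Compact intervals and Wallis' inequality *)

Section Compact_interval.
Context {R : realType}.
Local Notation mu := (@lebesgue_measure R).
Implicit Types (f F : R -> R) (x : R).

Lemma is_derive_continuous f (df : R -> R) :
  (forall x : R, is_derive x 1 f (df x)) -> continuous f.
Proof.
move=> fdf x; apply: differentiable_continuous.
by apply/derivable1_diffP; case: (fdf x).
Qed.

Lemma continuous_integrable_itv f (a b : R) : continuous f ->
  mu.-integrable `[a, b] (EFin \o f).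
Proof.
move=> cf; apply: continuous_compact_integrable; first exact: segment_compact.
exact: continuous_subspaceT.
Qed.

Lemma integral_derive F f (a b : R) : a <= b ->
  (forall x : R, is_derive x 1 F (f x)) -> continuous f ->
  (\int[mu]_(x in `[a, b]) (f x)%:E = (F b - F a)%:E)%E.
Proof.
rewrite le_eqVlt => /predU1P[-> _ _|ab Ff cf].
  rewrite set_itv1 subrr integral_set1//.
rewrite (@continuous_FTC2 _ f F a b ab) ?EFinB//.
- exact: continuous_subspaceT.
- have cF := is_derive_continuous Ff; split.
  + by move=> x _; case: (Ff x).
  + exact/cvg_at_right_filter/cF.
  + exact/cvg_at_left_filter/cF.
- by move=> x _; rewrite derive1E; case: (Ff x).
Qed.

Lemma Rintegral_derive F f (a b : R) : a <= b ->
  (forall x : R, is_derive x 1 F (f x)) -> continuous f ->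
  \int[mu]_(x in `[a, b]) f x = F b - F a.
Proof. by move=> ab Ff cf; rewrite /Rintegral (integral_derive ab Ff cf). Qed.

End Compact_interval.

Section Wallis.
Context {R : realType}.
Local Notation mu := (@lebesgue_measure R).

Definition Wallis_integral n : R := \int[mu]_(x in `[0, pi / 2]) (cos x ^+ n).
Local Notation W := Wallis_integral.

Lemma is_derive_cosX n (x : R) :
  is_derive x 1 (fun y : R => cos y ^+ n) (n%:R * cos x ^+ n.-1 * - sin x).
Proof.
rewrite (_ : (fun y => _) = (cos : R -> R) ^+ n); first exact: is_deriveX.
by apply/funext => y; rewrite exprfctE.
Qed.

Lemma continuous_cosX n : continuous (fun x : R => cos x ^+ n).
Proof. exact: is_derive_continuous (is_derive_cosX n). Qed.

(** Both sides differ by the integral of the derivative of sin x cos^(n+1) x,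
    which vanishes at both ends. *)
Lemma Wallis_rec n : n.+2%:R * W n.+2 = n.+1%:R * W n.
Proof.
have i k := continuous_integrable_itv 0 (pi / 2) (@continuous_cosX k).
apply/eqP; rewrite -subr_eq0 -!RintegralZl// -RintegralB//; last 2 first.
- exact: (integrableZl _ (n.+2%:R) (i n.+2)).
- exact: (integrableZl _ (n.+1%:R) (i n)).
apply/eqP.
have D (x : R) : is_derive x 1 (fun x : R => sin x * cos x ^+ n.+1)
    (n.+2%:R * cos x ^+ n.+2 - n.+1%:R * cos x ^+ n).
  have := is_deriveM (is_derive_sin x) (is_derive_cosX n.+1 x).
  move=> /is_derive_eq; apply; rewrite /GRing.scale/= -[n.+2%:R]natr1 -[n.+1%:R]natr1.
  by have := cos2sin2 x; rewrite !exprS expr0 mulr1 => c; ring: c.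
have pi0 : 0 <= pi / 2 :> R by have := @pi_ge0 R; lra.
rewrite (Rintegral_derive pi0 D).
  by rewrite cos_pihalf sin0 expr0n/= mulr0 mul0r subrr.
move=> x; apply: (@continuousB _ _ _ (fun x => n.+2%:R * cos x ^+ n.+2)
  (fun x => n.+1%:R * cos x ^+ n)); apply: continuousM; try exact: cst_continuous;
  exact: continuous_cosX.
Qed.

Lemma Wallis_prod n : n.+1%:R * (W n * W n.+1) = pi / 2.
Proof.
elim: n => [|n IH].
  rewrite mul1r /W.
  rewrite (_ : \int[mu]_(x in `[0, pi / 2]) cos x ^+ 0 = pi / 2); last first.
    by rewrite (@Rintegral_derive _ id) ?subr0//; [have := @pi_ge0 R; lra|exact: cst_continuous].
  rewrite (_ : \int[mu]_(x in `[0, pi / 2]) cos x ^+ 1 = 1) ?mulr1//.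
  rewrite (@Rintegral_derive _ sin) ?sin_pihalf ?sin0 ?subr0//.
    by have := @pi_ge0 R; lra.
  exact: continuous_cos.
by rewrite mulrCA Wallis_rec mulrCA [W _ * _]mulrC.
Qed.

Lemma Wallis_decr n : W n.+1 <= W n.
Proof.
apply: le_Rintegral => //.
- exact: continuous_integrable_itv (@continuous_cosX n.+1).
- exact: continuous_integrable_itv (@continuous_cosX n).
move=> x /=; rewrite in_itv/= => /andP[x0 xpi].
have cx0 : 0 <= cos x by rewrite cos_ge0_pihalf// xpi andbT (le_trans _ x0)//; have := @pi_ge0 R; lra.
by rewrite exprS ler_piMl ?exprn_ge0 ?cos_le1.
Qed.

Lemma Wallis_even m : W m.*2 = pi / 2 * ('C(m.*2, m)%:R / 4 ^+ m).
Proof.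
elim: m => [|m IH].
  rewrite bin0 expr0 divr1 mulr1 /W.
  by rewrite (@Rintegral_derive _ id) ?subr0//; [have := @pi_ge0 R; lra|exact: cst_continuous].
have := Wallis_rec m.*2; rewrite doubleS IH => E.
have b : m.+1%:R * 'C(m.*2.+2, m.+1)%:R = 2 * m.*2.+1%:R * 'C(m.*2, m)%:R :> R.
  rewrite -!natrM; congr (_%:R).
  have h1 := mul_bin_diag m.*2.+2 m.
  have h2 := mul_bin_down m.*2.+1 m.
  move: h1 h2; rewrite /= (_ : m.*2.+1 - m = m.+1)%N; last first.
    by rewrite subSn -addnn ?addnK ?leq_addl.
  move=> h1 h2; rewrite -h1 (_ : m.*2.+2 = 2 * m.+1)%N; last by rewrite mul2n doubleS.
  by rewrite -mulnA -h2 mulnA.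
apply: (@mulfI _ m.*2.+2%:R); first by rewrite pnatr_eq0.
have e2 : m.*2.+2%:R = 2 * m.+1%:R :> R by rewrite -natrM mul2n doubleS.
have m0 : m.+1%:R != 0 :> R by rewrite pnatr_eq0.
have p4 : 4 ^+ m != 0 :> R by rewrite expf_neq0.
rewrite E e2 exprS.
transitivity ((pi : R) / 2 * (m.+1%:R * 'C(m.*2.+2, m.+1)%:R) / 2 / 4 ^+ m).
  by rewrite b; field.
by field.
Qed.

(** Wallis' inequality: the even integral is at least the next odd one, and
    their product is known. The constant is sharp as m grows. *)
Lemma central_binomial_ge m :
  (Num.sqrt (pi * (m%:R + 2^-1)))^-1 <= 'C(m.*2, m)%:R / 4 ^+ m :> R.
Proof.
have pi0 := @pi_gt0 R.
set w := _ / _.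
have w0 : 0 <= w by rewrite divr_ge0 ?exprn_ge0.
have h : pi / 2 <= (m.*2%:R + 1) * (pi / 2 * w) ^+ 2.
  rewrite -[pi / 2 * w]Wallis_even -[leLHS](Wallis_prod m.*2) natr1.
  have W0 : 0 <= W m.*2 by rewrite Wallis_even mulr_ge0//; lra.
  by rewrite ler_pM2l ?ltr0n// expr2 ler_wpM2l// Wallis_decr.
have mm : 0 < m%:R + 2^-1 :> R by have : 0 <= m%:R :> R by []; lra.
have pm0 : 0 < pi * (m%:R + 2^-1) :> R by rewrite mulr_gt0.
have -> : w = Num.sqrt (w ^+ 2) by rewrite sqrtr_sqr ger0_norm.
rewrite -sqrtrV ?(ltW pm0)// ler_sqrt ?sqr_ge0//.
rewrite -[leLHS]mul1r ler_pdivrMr ?mulr_gt0//.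
move: h; rewrite -mul2n natrM => h.
rewrite -(@ler_pM2l _ (pi / 2)) ?divr_gt0// mulr1; apply: le_trans h _.
by rewrite le_eqVlt; apply/orP; left; apply/eqP; field.
Qed.

End Wallis.

(** * Jacobi's theta function and lattice sums *)

Section Jacobi.
Context {R : realType}.
Implicit Types t c x : R.

(** Extended-real sums over all integers make every rearrangement free; theta is
    shown to be finite for positive arguments only afterwards. *)
Definition theta t : \bar R :=
  (\esum_(n in [set: int]) (expR (- (t * n%:~R ^+ 2)))%:E)%E.

Lemma esum_int (a : int -> \bar R) : (forall n, 0 <= a n)%E ->
  (\esum_(n in [set: int]) a n =
   \sum_(0 <= k <oo) a k%:Z + \sum_(0 <= k <oo) a (- k.+1%:Z)%R)%E.
Proof.
move=> a0; rewrite (esumID (range Posz))// !setTI.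
rewrite (_ : ~` range Posz = range Negz); last first.
  apply/seteqP; split=> [[n|n]|n [k _ <-] [j _]]//=; last by exists n.
  by case; exists n.
rewrite !nneseries_esumT//; congr (_ + _)%E.
  rewrite (reindex_esum [set: nat] _ Posz)//; split => //.
  by move=> i j _ _ [].
have bN : set_bij [set: nat] (range Negz) Negz by split => //; move=> i j _ _ [].
by rewrite (reindex_esum _ _ _ _ bN); apply: eq_esum => k _; rewrite NegzE.
Qed.

Lemma theta_series t : theta t =
  (1 + 2%:E * \sum_(0 <= k <oo) (expR (- (t * k.+1%:R ^+ 2)))%:E)%E.
Proof.
rewrite /theta esum_int; last by move=> n; rewrite lee_fin expR_ge0.
rewrite nneseries_recl; [|by move=> k _; rewrite lee_fin expR_ge0|by []].
rewrite mulr0z expr0n/= mulr0 oppr0 expR0 -addeA; congr (_ + _)%E.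
rewrite -nneseries_addn; last by move=> k; rewrite lee_fin expR_ge0.
under eq_eseriesr do rewrite addn1 -pmulrn.
under [X in (_ + X)%E]eq_eseriesr do rewrite rmorphN/= sqrrN -pmulrn.
by rewrite -[X in (X * _)%E]/(1 + 1)%:E EFinD ge0_muleDl ?mul1e.
Qed.

Lemma theta_partial_le t N : ((theta_partial t N)%:E <= theta t)%E.
Proof.
rewrite theta_series /theta_partial EFinD EFinM leeD2l// lee_pmul2l ?fin_num_fun//.
rewrite -sumEFin -(big_mkord xpredT (fun k => (expR (- (t * k.+1%:R ^+ 2)))%:E)).
by apply: nneseries_lim_ge => k _ _; rewrite lee_fin expR_ge0.
Qed.

Lemma theta_le t (x : \bar R) :
  (forall N, (theta_partial t N)%:E <= x)%E -> (theta t <= x)%E.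
Proof.
move=> h; rewrite theta_series -nneseriesZl; last by move=> k _; rewrite lee_fin expR_ge0.
have x1 : (1 <= x)%E.
  by apply: le_trans (h 0%N); rewrite /theta_partial big_ord0 mulr0 addr0.
case: x x1 h => [x x1 h|_ _|//]; last by rewrite leey.
rewrite -leeBrDl//; apply: lime_le.
  by apply: is_cvg_nneseries => n _ _; rewrite mule_ge0// lee_fin ?expR_ge0.
apply: nearW => N; rewrite leeBrDl//.
apply: le_trans (h N); rewrite /theta_partial mulr_sumr [leRHS]EFinD -sumEFin leeD2l//.
by rewrite (big_mkord xpredT) le_eqVlt; apply/orP; left; apply/eqP; apply: eq_bigr.
Qed.

Lemma theta_ge1 t : (1 <= theta t)%E.
Proof.
by apply: le_trans (theta_partial_le t 0); rewrite /theta_partial big_ord0 mulr0 addr0.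
Qed.

(** The quotient of two neighbouring coefficients is
    (m - k) / (m + k + 1), which is at least exp(-(2 k + 1) / (m - k)); the
    exponents add up to a square. *)
Lemma binomial_ge_gauss m k : (k <= m)%N ->
  'C(m.*2, m)%:R * expR (- (k%:R ^+ 2 / (m.+1 - k)%:R)) <= 'C(m.*2, m + k)%:R :> R.
Proof.
elim: k => [|k IH] km; first by rewrite expr0n/= mul0r oppr0 expR0 mulr1 addn0.
have mk : 0 < (m - k)%:R :> R by rewrite ltr0n subn_gt0.
have rec : 'C(m.*2, m + k.+1)%:R =
    'C(m.*2, m + k)%:R * ((m - k)%:R / (m + k).+1%:R) :> R.
  have n0 : (m + k).+1%:R != 0 :> R by rewrite pnatr_eq0.
  have e : (m + k).+1%:R * 'C(m.*2, m + k.+1)%:R = (m - k)%:R * 'C(m.*2, m + k)%:R :> R.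
    by rewrite -!natrM addnS mul_bin_left -addnn subnDl.
  by apply: (mulfI n0); rewrite e [RHS]mulrCA [_ * (_ / _)]mulrCA mulfV// mulr1 mulrC.
have q0 : 0 <= (m - k)%:R / (m + k).+1%:R :> R by rewrite divr_ge0.
rewrite rec; apply: le_trans (ler_wpM2r q0 (IH (ltnW km))).
rewrite -[leRHS]mulrA ler_wpM2l//.
have step : expR (- (k.*2.+1%:R / (m - k)%:R)) <= (m - k)%:R / (m + k).+1%:R :> R.
  rewrite expRN -[leRHS]invrK lef_pV2 ?posrE ?expR_gt0 ?invr_gt0 ?divr_gt0//.
  apply: le_trans (expR_ge1Dx _); rewrite invf_div ler_pdivrMr// mulrDl mul1r mulfVK ?gt_eqF//.
  by rewrite -natrD ler_nat -addnn; lia.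
apply: le_trans (ler_wpM2l (expR_ge0 _) step).
rewrite -expRD ler_expR -opprD lerN2.
rewrite subSS (_ : k.+1%:R ^+ 2 = k%:R ^+ 2 + k.*2.+1%:R :> R); last first.
  by rewrite -mul2n -!natr1 natrM; ring.
rewrite mulrDl lerD2r ler_wpM2l ?sqr_ge0//.
rewrite lef_pV2 ?posrE//; first by rewrite ler_nat leq_sub2r.
by rewrite ltr0n subn_gt0 ltnS ltnW.
Qed.

(** Half of the theta transformation, as a limit of Polya's identity: m is the
    integer part of l^2 / t plus one, and l tends to infinity. *)
Lemma Jacobi_le t N : 0 < t ->
  ((Num.sqrt (t / pi) * theta_partial t N)%:E <= theta (pi ^+ 2 / t))%E.
Proof.
move=> t0.
have [->|] := eqVneq (theta (pi ^+ 2 / t)) +oo%E; first by rewrite leey.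
rewrite -ltey => thetafin.
have /fineK <- : theta (pi ^+ 2 / t) \is a fin_num.
  by rewrite ge0_fin_numE// (le_trans _ (theta_ge1 _)).
rewrite lee_fin.
(* The bound obtained at the level l, as a continuous function of h = 1 / l;
   the denominator of the exponent is a lower bound for (m + 1 - l k) / l^2. *)
pose Phi h := (Num.sqrt (pi * (t^-1 + 3 / 2 * h ^+ 2)))^-1 *
  (1 + 2 * \sum_(k < N) expR (- (k.+1%:R ^+ 2 / (t^-1 - k.+1%:R * h)))).
have Phi0 : Phi 0 = Num.sqrt (t / pi) * theta_partial t N.
  rewrite /Phi expr0n/= mulr0 addr0 -sqrtrV; last by rewrite mulr_ge0 ?pi_ge0// invr_ge0 ltW.
  rewrite invfM invrK [_ * t]mulrC; congr (_ * (1 + 2 * _)).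
  by apply: eq_bigr => k _; rewrite mulr0 subr0 invrK mulrC.
rewrite -Phi0.
have cPhi : Phi (harmonic n) @[n --> \oo] --> Phi 0.
  have cid : (@harmonic R) n @[n --> \oo] --> (0 : R) := cvg_harmonic.
  apply: cvgM.
    apply: cvgV; first by rewrite gt_eqF// sqrtr_gt0 mulr_gt0 ?pi_gt0// expr0n/= mulr0 addr0 invr_gt0.
    apply: (@cvg_comp _ _ _ _ Num.sqrt _ _ _ _ (@sqrt_continuous R _)).
    apply: cvgMr; apply: cvgD; first exact: cvg_cst.
    apply: cvgMr; apply: (@cvg_comp _ _ _ _ (fun x : R => x ^+ 2) _ _ _ cid).
    exact: exprn_continuous.
  apply: cvgD; first exact: cvg_cst.
  apply: cvgMr; apply: (@cvg_big R 'I_N +%R 0 xpredT).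
    exact: add_continuous.
  move=> k _; apply: (@cvg_comp _ _ _ _ (@expR R) _ _ _ _ (@continuous_expR R _)).
  apply: cvgN; apply: cvgMr; apply: cvgV.
    by rewrite mulr0 subr0 gt_eqF// invr_gt0.
  by apply: cvgB; [exact: cvg_cst|apply: cvgMr].
apply: (cvgr_to_le cPhi).
near=> n.
set l := n.+1.
have l0 : (0 < l)%N by [].
have lR : 0 < l%:R :> R by rewrite ltr0n.
have hl : harmonic n = l%:R^-1 :> R by [].
pose m := (Num.truncn (l%:R ^+ 2 / t)).+1.
have mge : l%:R ^+ 2 / t < m%:R by apply: truncnS_gt.
have mle : m%:R <= l%:R ^+ 2 / t + 1.
  have q0 : 0 <= l%:R ^+ 2 / t by rewrite divr_ge0 ?sqr_ge0// ltW.
  by rewrite -natr1 lerD2r; have /andP[] := truncn_itv q0.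
have lN : N%:R < l%:R / t.
  rewrite ltr_pdivlMr// (@le_lt_trans _ _ n%:R)// ?ltr_nat//.
  by near: n; exact: nbhs_infty_ger.
set h := harmonic n.
have hk (k : nat) : (k < N)%N -> 0 < t^-1 - k.+1%:R * h.
  move=> kN; rewrite subr_gt0 /h hl ltr_pdivrMr// mulrC.
  by apply: le_lt_trans lN; rewrite ler_nat.
have lk_le (k : nat) : (k < N)%N -> l%:R ^+ 2 * (t^-1 - k.+1%:R * h) <= (m.+1 - l * k.+1)%:R /\
    (l * k.+1 <= m)%N.
  move=> kN.
  have e : l%:R ^+ 2 * (t^-1 - k.+1%:R * h) = l%:R ^+ 2 / t - (l * k.+1)%:R.
    by rewrite natrM mulrBr /h hl; congr (_ - _); field; rewrite gt_eqF.
  have lkm : (l * k.+1 <= m)%N.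
    rewrite -(ler_nat R) ltW//; apply: lt_trans mge; rewrite -subr_gt0 -e.
    by rewrite mulr_gt0 ?exprn_gt0// hk.
  split => //; rewrite e natrB; last exact: leqW.
  by rewrite lerD2r ltW// (lt_trans mge)// ltr_nat.
pose w : R := 'C(m.*2, m)%:R / 4 ^+ m.
pose S : R := \sum_(k < N) expR (- ((l * k.+1)%:R ^+ 2 / (m.+1 - l * k.+1)%:R)).
have w0 : 0 <= w by rewrite divr_ge0 ?exprn_ge0.
have p4 : 0 < 4 ^+ m :> R by rewrite exprn_gt0.
have S0 : 0 <= S by apply: sumr_ge0 => k _; exact: expR_ge0.
apply: (@le_trans _ _ (l%:R * w * (1 + 2 * S))).
  apply: ler_pM.
  - by rewrite invr_ge0 sqrtr_ge0.
  - by rewrite addr_ge0// mulr_ge0// sumr_ge0// => k _; exact: expR_ge0.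
  - apply: le_trans (ler_wpM2l (ltW lR) (central_binomial_ge m)).
    have mm : 0 < pi * (m%:R + 2^-1) :> R.
      by rewrite mulr_gt0 ?pi_gt0//; have : 0 <= m%:R :> R by []; lra.
    have -> : l%:R = (Num.sqrt (l%:R ^- 2))^-1 :> R.
      by rewrite -sqrtrV ?invr_ge0 ?sqr_ge0// invrK sqrtr_sqr gtr0_norm.
    rewrite -invfM -sqrtrM ?invr_ge0 ?sqr_ge0// lef_pV2 ?posrE ?sqrtr_gt0; last 2 first.
    + rewrite mulr_gt0 ?pi_gt0//; have : 0 < t^-1 by rewrite invr_gt0.
      by have := sqr_ge0 h; lra.
    + by rewrite mulr_gt0// invr_gt0 exprn_gt0.
    apply: ler_wsqrtr; rewrite mulrCA ler_pM2l ?pi_gt0//.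
    rewrite mulrC ler_pdivrMr ?exprn_gt0// mulrDl /h hl exprVn mulfVK ?gt_eqF ?exprn_gt0//.
    by move: mle; rewrite [t^-1 * _]mulrC; lra.
  - rewrite lerD2l ler_pM2l//; apply: ler_sum => k _; rewrite ler_expR lerN2.
    have [le1 le2] := lk_le k (ltn_ord k).
    have hk0 := hk k (ltn_ord k).
    have l2 : 0 < l%:R ^+ 2 :> R by rewrite exprn_gt0.
    rewrite natrM exprMn ler_pdivrMr; last by apply: lt_le_trans le1; rewrite mulr_gt0.
    rewrite [leRHS]mulrAC ler_pdivlMr// [_ ^+ 2 * _ ^+ 2]mulrC -mulrA.
    by rewrite ler_wpM2l ?sqr_ge0.
apply: (@le_trans _ _ (\sum_(j < l) cos (pi * j%:R / l%:R) ^+ m.*2)).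
  have -> : \sum_(j < l) cos (pi * j%:R / l%:R) ^+ m.*2 =
      (\sum_(j < l) (2 * cos (pi * j%:R / l%:R)) ^+ m.*2) / 4 ^+ m :> R.
    rewrite mulr_suml; apply: eq_bigr => j _.
    have two : 2 ^+ m.*2 = 4 ^+ m :> R by rewrite -mul2n exprM -natrX.
    by rewrite exprMn two [RHS]mulrAC mulfV ?mul1r// gt_eqF.
  rewrite Polya_identity// ler_pdivlMr// -!mulrA ler_pM2l//.
  rewrite [_ * 4 ^+ m]mulrC [4 ^- m * _]mulrA mulVf ?gt_eqF// mul1r.
  rewrite mulrDr mulr1 natrD lerD2l natrM mulrCA ler_pM2l//.
  apply: (@le_trans _ _ (\sum_(k < N) 'C(m.*2, m + l * k.+1)%:R)).
    rewrite mulr_sumr; apply: ler_sum => k _; apply: binomial_ge_gauss.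
    by have [] := lk_le k (ltn_ord k).
  rewrite -natr_sum ler_nat.
  apply: leq_trans (sum_multiples_le (fun d => 'C(m.*2, m + d)) N l0) _.
  have lNm : (l * N <= m)%N.
    rewrite -(ler_nat R) ltW//; apply: le_lt_trans mge.
    by rewrite natrM expr2 -mulrA ler_wpM2l// ltW.
  pose F d := ((l %| d.+1) * 'C(m.*2, m + d.+1))%N.
  suff : (\sum_(d < l * N) F d <= \sum_(d < m) F d)%N by [].
  by rewrite -!(big_mkord xpredT F) (big_cat_nat _ lNm)//= leq_addr.
apply: le_trans (Polya_upper m l0) _.
rewrite -lee_fin fineK; last first.
  by rewrite ge0_fin_numE// (le_trans _ (theta_ge1 _)).
apply: le_trans (theta_partial_le _ l); rewrite lee_fin.
apply: theta_partial_mono; rewrite -mulrA ler_wpM2l ?sqr_ge0//.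
rewrite ler_pdivlMr ?exprn_gt0// mulrC; exact: ltW.
Unshelve. all: by end_near. Qed.

(** The two inequalities are the same one, at t and at its dual pi^2 / t. *)
Lemma theta_functional t : 0 < t ->
  theta t = ((Num.sqrt (pi / t))%:E * theta (pi ^+ 2 / t))%E.
Proof.
have le s : 0 < s -> (theta s <= (Num.sqrt (pi / s))%:E * theta (pi ^+ 2 / s))%E.
  move=> s0; apply: theta_le => N.
  have sq : 0 < Num.sqrt (s / pi) by rewrite sqrtr_gt0 divr_gt0 ?pi_gt0.
  have -> : pi / s = (s / pi)^-1 by rewrite invf_div.
  rewrite sqrtrV; last by rewrite divr_ge0 ?pi_ge0// ltW.
  by rewrite lee_pdivlMl// -EFinM Jacobi_le.
move=> t0; apply/eqP; rewrite eq_le le//=.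
have pt : 0 < pi ^+ 2 / t by rewrite divr_gt0// exprn_gt0 ?pi_gt0.
have := le _ pt.
have pn0 : pi != 0 :> R by rewrite gt_eqF ?pi_gt0.
have tn0 : t != 0 by rewrite gt_eqF.
have -> : pi ^+ 2 / (pi ^+ 2 / t) = t by rewrite invf_div mulrC mulfVK ?expf_neq0.
have -> : pi / (pi ^+ 2 / t) = (pi / t)^-1.
  by rewrite !invf_div mulrCA expr2 invfM [pi * (_ * _)]mulrA mulfV// mul1r.
have pt' : 0 < pi / t by rewrite divr_gt0 ?pi_gt0.
rewrite sqrtrV; last exact: ltW.
by move=> h; rewrite -lee_pdivlMl ?sqrtr_gt0.
Qed.

Lemma theta_le_geometric t : 0 < t ->
  (theta t <= (1 + 2 * (expR (- t) / (1 - expR (- t))))%:E)%E.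
Proof.
move=> t0; apply: theta_le => N; rewrite lee_fin lerD2l ler_pM2l//.
have r1 : 0 < 1 - expR (- t) by rewrite subr_gt0 expR_lt1 oppr_lt0.
rewrite ler_pdivlMr//.
apply: (@le_trans _ _ ((\sum_(k < N) expR (- t) ^+ k.+1) * (1 - expR (- t)))).
  rewrite (ler_wpM2r (ltW r1))//; apply: ler_sum => k _.
  rewrite -expRM_natl ler_expR mulrN lerN2 mulrC (ler_wpM2l (ltW t0))//.
  by rewrite -natrX ler_nat leq_pmulr.
have geo : (\sum_(k < N) expR (- t) ^+ k.+1) * (1 - expR (- t)) =
    expR (- t) * (1 - expR (- t) ^+ N).
  elim: N => [|N IH]; first by rewrite big_ord0 mul0r expr0 subrr mulr0.
  by rewrite big_ord_recr/= mulrDl IH !exprS; ring.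
by rewrite geo ler_piMr ?expR_ge0// gerBl exprn_ge0 ?expR_ge0.
Qed.

Lemma fin_num_theta t : 0 < t -> theta t \is a fin_num.
Proof.
move=> t0; rewrite ge0_fin_numE; last by rewrite (le_trans _ (theta_ge1 _)).
exact: le_lt_trans (theta_le_geometric t0) (ltry _).
Qed.

End Jacobi.

Section Lattice_sums.
Context {R : realType}.

Lemma esumZl (T : choiceType) (I : set T) (a : T -> \bar R) (c : R) : 0 <= c ->
  (forall i, 0 <= a i)%E ->
  (\esum_(i in I) (c%:E * a i) = c%:E * \esum_(i in I) a i)%E.
Proof.
rewrite le_eqVlt => /predU1P[<- _|c0 a0].
  by rewrite mul0e esum1// => i _; rewrite mul0e.
have le (d : R) (b : T -> \bar R) : 0 < d -> (forall i, 0 <= b i)%E ->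
    (\esum_(i in I) (d%:E * b i) <= d%:E * \esum_(i in I) b i)%E.
  move=> d0 b0; apply: ge_ereal_sup => _ [X [finX XI] <-].
  rewrite -ge0_mule_fsumr// lee_pmul2l//.
  by apply: ereal_sup_ubound; exists X.
apply/eqP; rewrite eq_le le//= -lee_pdivlMl//.
apply: le_trans (le c^-1 (fun i => c%:E * a i)%E _ _).
- by apply: le_esum => i _; rewrite muleA -EFinM mulVf ?gt_eqF// mul1e.
- by rewrite invr_gt0.
- by move=> i; rewrite mule_ge0// lee_fin ltW.
Qed.

Lemma esum_prod (T1 T2 : choiceType) (a : T1 -> R) (b : T2 -> R) :
  (forall i, 0 <= a i) -> (forall j, 0 <= b j) ->
  (\esum_(j in [set: T2]) (b j)%:E)%E \is a fin_num ->
  (\esum_(k in [set: T1 * T2]) (a k.1 * b k.2)%:E =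
   (\esum_(i in [set: T1]) (a i)%:E) * (\esum_(j in [set: T2]) (b j)%:E))%E.
Proof.
move=> a0 b0 bfin.
transitivity (\esum_(i in [set: T1]) \esum_(j in [set: T2]) (a i * b j)%:E)%E.
  rewrite esum_esum; last by move=> i j _ _; rewrite lee_fin mulr_ge0.
  by congr esum; apply/seteqP; split.
under eq_esum => i _.
  under eq_esum => j _ do rewrite EFinM.
  rewrite esumZl// muleC; over.
have S0 : 0 <= fine (\esum_(j in [set: T2]) (b j)%:E)%E.
  by apply/fine_ge0/esum_ge0 => j _; rewrite lee_fin.
by rewrite -(fineK bfin) esumZl// muleC.
Qed.

Definition norm2 (k : int * int * int) : R :=
  k.1.1%:~R ^+ 2 + k.1.2%:~R ^+ 2 + k.2%:~R ^+ 2.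

Lemma lattice_modE k : lattice_mod R k = Num.sqrt (norm2 k). Proof. by []. Qed.

Lemma norm2_ge0 k : 0 <= norm2 k.
Proof. by rewrite !addr_ge0 ?sqr_ge0. Qed.

(** The Gaussian of the squared length is a product over the coordinates. *)
Lemma esum_theta3 t : 0 < t ->
  (\esum_(k in [set: int * int * int]) (expR (- (t * norm2 k)))%:E =
   theta t * theta t * theta t)%E.
Proof.
move=> t0.
pose g (n : int) : R := expR (- (t * n%:~R ^+ 2)).
have g0 n : 0 <= g n by exact: expR_ge0.
rewrite -[in RHS]/(\esum_(n in [set: int]) (g n)%:E)%E.
have gfin := fin_num_theta t0.
rewrite -(esum_prod g0 g0 gfin) -esum_prod//; last by move=> i; rewrite mulr_ge0.
by apply: eq_esum => k _; rewrite /g -!expRD /norm2; congr (expR _)%:E; ring.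
Qed.

End Lattice_sums.

(** * Gaussian integrals over half-lines *)

Section Improper_integrals.
Context {R : realType}.
Local Notation mu := (@lebesgue_measure R).
Implicit Types (f F : R -> R) (a x l n : R).

(** The conjunction is the form in which the fundamental theorem below takes its
    hypothesis: a derivative at positive points only. *)
Lemma derive_at_eq F x (df df' : R) : is_derive x (1 : R) F df -> df = df' ->
  derivable F x 1 /\ 'D_1 F x = df'.
Proof. by move=> Fdf <-; split; [apply: ex_derive|apply: derive_val]. Qed.

(** The fundamental theorem of calculus on a half-line, with nonnegative
    integrand and a primitive known at positive points only. *)
Lemma integral_ge_derive F f a l (v : R) : 0 < a -> v = l - F a ->
  (forall x, 0 < x -> derivable F x 1 /\ 'D_1 F x = f x) ->
  (forall x, 0 < x -> {for x, continuous f}) ->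
  (forall x, a <= x -> 0 <= f x) -> F x @[x --> +oo] --> l ->
  (\int[mu]_(x in `[a, +oo[) (f x)%:E = v%:E)%E.
Proof.
move=> a0 -> dF cf f0 Fl.
have cF x : 0 < x -> {for x, continuous F}.
  move=> x0; apply: differentiable_continuous.
  by apply/derivable1_diffP; case: (dF _ x0).
rewrite (@ge0_continuous_FTC2y _ f F a l f0) ?EFinB//.
- apply/continuous_within_itvcyP; split.
    by move=> x; rewrite in_itv/= andbT => ax; apply: cf; exact: lt_trans ax.
  exact/cvg_at_right_filter/cf.
- by move=> x ax; case: (dF _ (lt_trans a0 ax)).
- exact/cvg_at_right_filter/cF.
- move=> x; rewrite in_itv/= andbT => ax; rewrite derive1E.
  by case: (dF _ (lt_trans a0 ax)).
Qed.

Lemma derivable_at_continuous f x (df : R) :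
  is_derive x (1 : R) f df -> {for x, continuous f}.
Proof.
by move=> dfx; apply: differentiable_continuous; apply/derivable1_diffP; case: dfx.
Qed.

Lemma is_derive_inv x : 0 < x ->
  is_derive x (1 : R) (fun y : R => y^-1) (- x ^- 2).
Proof.
move=> x0; have := @is_deriveV _ id x 1 1.
by rewrite /GRing.scale/= mulr1; apply; rewrite gt_eqF.
Qed.

Lemma cvg_inv_pinfty : (x : R)^-1 @[x --> +oo] --> (0 : R).
Proof. by apply/(@gtr0_cvgV0 R R _ _ id) => //; exact: nbhs_pinfty_gt. Qed.

Definition gauss_primitive : R -> R := gauss_integral_proof.integral0_gauss.
Local Notation g := gauss_primitive.

Lemma is_derive_gauss_primitive x : 0 < x ->
  is_derive x (1 : R) g (expR (- x ^+ 2)).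
Proof.
move=> x0.
have [] : derivable g x 1 /\ derive1 g x = gauss_fun x.
  apply: (@continuous_FTC1 R gauss_fun (BLeft 0) _ (x + 1) _ _ _ _).
  - by rewrite ltrDl.
  - by apply: continuous_integrable_itv; exact: continuous_gauss_fun.
  - by rewrite /=; rewrite lte_fin.
  - by move=> ?; exact: continuous_gauss_fun.
by move=> dg gE; apply: DeriveDef => //; rewrite -derive1E gE.
Qed.

Lemma gauss_primitive_ge0 x : 0 <= g x.
Proof. exact: gauss_integral_proof.integral0_gauss_ge0. Qed.

Lemma gauss_primitive_le x : 0 <= x -> g x <= x.
Proof.
move=> x0; rewrite /g/gauss_integral_proof.integral0_gauss.
apply: (@le_trans _ _ (\int[mu]_(t in `[0, x]) (1 : R))).
  apply: le_Rintegral => //.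
  - by apply: continuous_integrable_itv; exact: continuous_gauss_fun.
  - by apply: continuous_integrable_itv; exact: cst_continuous.
  - by move=> t _; exact: gauss_fun_le1.
by rewrite (@Rintegral_derive _ id) ?subr0//; exact: cst_continuous.
Qed.

Lemma cvg_gauss_primitive : g x @[x --> +oo] --> Num.sqrt pi / 2.
Proof.
have : Num.sqrt (g x ^+ 2) @[x --> +oo] --> Num.sqrt (pi / 4).
  apply: continuous_cvg; first exact: sqrt_continuous.
  exact: gauss_integral_proof.cvg_integral0_gauss_sqr.
rewrite sqrtrM ?pi_ge0// sqrtrV// (_ : 4 = 2 ^+ 2); last by rewrite -natrX.
rewrite sqrtr_sqr ger0_norm// (_ : (fun _ => Num.sqrt _) = g)//.
by apply/funext => r; rewrite sqrtr_sqr ger0_norm// gauss_primitive_ge0.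
Qed.

(** This turns the error function into differences of a primitive, which is what
    the explicit integrals below are computed with. *)
Lemma erfcE x : 0 < x -> erfc x = 2 / Num.sqrt pi * (Num.sqrt pi / 2 - g x).
Proof.
move=> x0; rewrite /erfc; congr (_ * _); rewrite /Rintegral.
have dg y (y0 : 0 < y) := derive_at_eq (is_derive_gauss_primitive y0) erefl.
rewrite (integral_ge_derive x0 erefl dg _ _ cvg_gauss_primitive)//.
by move=> y y0; exact: continuous_gauss_fun.
Qed.

Lemma expRN_le_inv x : 0 < x -> expR (- x) <= x^-1.
Proof.
move=> x0; rewrite expRN lef_pV2 ?posrE ?expR_gt0//.
by apply: le_trans (expR_ge1Dx _); rewrite lerDr.
Qed.

Lemma cvg_gauss_pinfty a : 0 < a -> expR (- (a * x ^+ 2)) @[x --> +oo] --> (0 : R).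
Proof.
move=> a0; apply: (@squeeze_cvgr _ _ _ _ (cst 0) (fun x => a^-1 * x^-1 ^+ 2)).
- near=> x; have x0 : 0 < x by near: x; exact: nbhs_pinfty_gt.
  rewrite expR_ge0/= exprVn -invfM expRN_le_inv// mulr_gt0// exprn_gt0//.
- exact: cvg_cst.
- rewrite [X in _ --> X](_ : _ = a^-1 * 0 ^+ 2); last by rewrite expr0n mulr0.
  apply: cvgMr; apply: (@cvg_comp _ _ _ _ (fun y : R => y ^+ 2) _ _ _ cvg_inv_pinfty).
  exact: exprn_continuous.
Unshelve. all: by end_near. Qed.

Lemma cvg_comp_inv f : {for 0, continuous f} -> f x^-1 @[x --> +oo] --> f 0.
Proof. by move=> cf; apply: (@cvg_comp _ _ _ _ f _ _ _ cvg_inv_pinfty). Qed.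

End Improper_integrals.

(** Like [derive_by_rules], for the conjunction that [integral_ge_derive] takes. *)
Ltac derive_at_by_rules := eapply derive_at_eq; [exact _|].

Section Explicit_integrals.
Context {R : realType}.
Local Notation mu := (@lebesgue_measure R).
Local Notation g := (@gauss_primitive R).
Implicit Types (a x l n r s : R).

(** The integral of exp(-a t) over t >= 1, written with t = s^2. All integrals
    over the heat time t are brought to [1, +oo) in this way, by t = s^2 for
    t >= 1 and by t = 1 / r^2 for t <= 1. *)
Lemma integral_weighted_gauss a : 0 < a ->
  (\int[mu]_(s in `[1%R, +oo[) (2 * s * expR (- (a * s ^+ 2)))%:E =
   (expR (- a) / a)%:E)%E.
Proof.
move=> a0.
apply: (@integral_ge_derive _ (fun s => - (expR (- (a * s ^+ 2)) / a)) _ 1 0).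
- by [].
- by rewrite expr1n mulr1 sub0r opprK.
- move=> x x0; derive_at_by_rules; rewrite /GRing.scale/=; field.
  by rewrite gt_eqF.
- move=> x x0; eapply derivable_at_continuous; exact _.
- by move=> x x1; rewrite mulr_ge0 ?expR_ge0// mulr_ge0// (le_trans _ x1).
- rewrite [X in _ --> X](_ : _ = - (0 / a)); last by rewrite mul0r oppr0.
  by apply: cvgN; apply: cvgMl; exact: cvg_gauss_pinfty.
Qed.

(** The integral of exp(-n t) (1 - exp(-l t)) over 0 < t <= 1, with
    t = 1 / r^2. *)
Lemma integral_inverted_exp n l : 0 < n -> 0 < l ->
  (\int[mu]_(r in `[1%R, +oo[) (2 * r^-1 ^+ 3 * (1 - expR (- (l * r^-1 ^+ 2)))
      * expR (- (n * r^-1 ^+ 2)))%:E =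
   (n^-1 - (n + l)^-1 - expR (- n) / n + expR (- (n + l)) / (n + l))%:E)%E.
Proof.
move=> n0 l0; have nl0 : 0 < n + l by rewrite addr_gt0.
pose f0 y := expR (- (n * y ^+ 2)) / n - expR (- ((n + l) * y ^+ 2)) / (n + l).
apply: (@integral_ge_derive _ (fun r => expR (- (n * r^-1 ^+ 2)) / n -
  expR (- ((n + l) * r^-1 ^+ 2)) / (n + l)) _ 1 (f0 0)).
- by [].
- by rewrite /f0 invr1 expr1n expr0n/= !mulr0 !mulr1 oppr0 expR0; ring.
- move=> x x0; have := is_derive_inv x0 => iv.
  derive_at_by_rules; rewrite /GRing.scale/= (_ : expR (- ((n + l) * _)) =
    expR (- (n * x^-1 ^+ 2)) * expR (- (l * x^-1 ^+ 2))).
    by field; rewrite !gt_eqF.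
  by rewrite mulrDl opprD expRD.
- move=> x x0; have := is_derive_inv x0 => iv; eapply derivable_at_continuous; exact _.
- move=> x x1; have x0 : 0 < x by apply: lt_le_trans x1.
  rewrite mulr_ge0 ?expR_ge0// mulr_ge0 ?mulr_ge0 ?exprn_ge0 ?invr_ge0 ?(ltW x0)//.
  by rewrite subr_ge0 expR_le1 oppr_le0 mulr_ge0 ?sqr_ge0// ltW.
- apply: (@cvg_comp_inv _ f0); eapply derivable_at_continuous; exact _.
Qed.

(** The case n = 0 of the previous integral. *)
Lemma integral_inverted_const l : 0 < l ->
  (\int[mu]_(r in `[1%R, +oo[) (2 * r^-1 ^+ 3 * (1 - expR (- (l * r^-1 ^+ 2))))%:E =
   (1 + expR (- l) / l - l^-1)%:E)%E.
Proof.
move=> l0.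
pose f0 y := - y ^+ 2 - expR (- (l * y ^+ 2)) / l.
apply: (@integral_ge_derive _ (fun r => - r^-1 ^+ 2 - expR (- (l * r^-1 ^+ 2)) / l) _
  1 (f0 0)).
- by [].
- by rewrite /f0 invr1 expr1n expr0n/= !mulr0 !mulr1 !oppr0 expR0; ring.
- move=> x x0; have := is_derive_inv x0 => iv.
  derive_at_by_rules; rewrite /GRing.scale/=; field.
  by rewrite !gt_eqF.
- move=> x x0; have := is_derive_inv x0 => iv; eapply derivable_at_continuous; exact _.
- move=> x x1; have x0 : 0 < x by apply: lt_le_trans x1.
  rewrite mulr_ge0 ?mulr_ge0 ?exprn_ge0 ?invr_ge0 ?(ltW x0)//.
  by rewrite subr_ge0 expR_le1 oppr_le0 mulr_ge0 ?sqr_ge0// ltW.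
- apply: (@cvg_comp_inv _ f0); eapply derivable_at_continuous; exact _.
Qed.

Local Notation q := (Num.sqrt pi ^+ 3 : R).

(** The Gaussian that the theta transformation attaches to a dual lattice vector
    of length x integrates to the second kind of term in beta3. *)
Lemma integral_dual_gauss x : 0 < x ->
  (\int[mu]_(r in `[1%R, +oo[) (2 * q * expR (- (pi ^+ 2 * x ^+ 2 * r ^+ 2)))%:E =
   (pi * (erfc (pi * x) / x))%:E)%E.
Proof.
move=> x0; have px : 0 < pi * x :> R by rewrite mulr_gt0 ?pi_gt0.
have sp : 0 < Num.sqrt pi :> R by rewrite sqrtr_gt0 pi_gt0.
have sp2 : Num.sqrt pi ^+ 2 = pi :> R by rewrite sqr_sqrtr ?pi_ge0.
apply: (@integral_ge_derive _ (fun r => 2 * q / (pi * x) * g (pi * x * r)) _ 1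
   (2 * q / (pi * x) * (Num.sqrt pi / 2))).
- by [].
- rewrite erfcE// mulr1; move: (Num.sqrt pi) sp sp2 (g _) => p p0 p2 gg; rewrite -p2.
  by field; rewrite !gt_eqF.
- move=> r r0.
  have gd : is_derive (pi * x * r) (1 : R) g (expR (- (pi * x * r) ^+ 2)).
    by apply: is_derive_gauss_primitive; rewrite mulr_gt0.
  have hd : is_derive r (1 : R) (fun r : R => pi * x * r) (pi * x).
    by derive_by_rules; rewrite /GRing.scale/= mulr1.
  have cd := is_derive1_comp gd hd.
  have Zd := is_deriveZ (2 * q / (pi * x)) cd.
  apply: (derive_at_eq Zd); rewrite /GRing.scale/= !exprMn.
  by rewrite [expR _ * _]mulrC mulrA divfK// gt_eqF.
- by move=> r r0; eapply derivable_at_continuous; exact _.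
- by move=> r _; rewrite mulr_ge0 ?expR_ge0// mulr_ge0// exprn_ge0// ltW.
- apply: cvgMr; apply: (@cvg_comp _ _ _ (fun r => pi * x * r) g _ _ _ _ (@cvg_gauss_primitive R)).
  by apply: gt0_cvgMry.
Qed.

End Explicit_integrals.

Section Explicit_integrals_continued.
Context {R : realType}.
Local Notation mu := (@lebesgue_measure R).
Local Notation g := (@gauss_primitive R).
Local Notation q := (Num.sqrt pi ^+ 3 : R).
Implicit Types (r s x : R).

(** The contribution of the zero vector of the dual lattice to small heat
    times. *)
Lemma integral_dual_main s : 0 < s ->
  (\int[mu]_(r in `[1%R, +oo[) (2 * q * (1 - expR (- (s ^+ 2 * r^-1 ^+ 2))))%:E =
   (q * (4 * s * g s - 2 * (1 - expR (- s ^+ 2))))%:E)%E.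
Proof.
move=> s0; have q0 : 0 < q by rewrite exprn_gt0// sqrtr_gt0 pi_gt0.
apply: (@integral_ge_derive _ (fun r =>
  q * (2 * r * (1 - expR (- (s ^+ 2 * r^-1 ^+ 2))) - 4 * s * g (s * r^-1))) _ 1 0).
- by [].
- by rewrite invr1 expr1n !mulr1; ring.
- move=> x x0; have iv := is_derive_inv x0.
  have gd : is_derive (s * x^-1) (1 : R) g (expR (- (s * x^-1) ^+ 2)).
    by apply: is_derive_gauss_primitive; rewrite divr_gt0.
  have hd : is_derive x (1 : R) (fun r : R => s * r^-1) (- (s * x ^- 2)).
    by derive_by_rules; rewrite /GRing.scale/= mulrN.
  have cd := @is_derive1_comp _ g (fun r => s * r^-1) x _ _ gd hd.
  have -> : (fun r => q * (2 * r * (1 - expR (- (s ^+ 2 * r^-1 ^+ 2))) - 4 * s * g (s * r^-1))) =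
    (fun r => q * (2 * r * (1 - expR (- (s ^+ 2 * r^-1 ^+ 2))) - 4 * s * (g \o (fun r => s * r^-1)) r)) by [].
  move: (Num.sqrt pi) => p.
  derive_at_by_rules; rewrite /GRing.scale/= exprMn; field.
  by rewrite gt_eqF.
- move=> x x0; have iv := is_derive_inv x0.
  move: (Num.sqrt pi) => p; eapply derivable_at_continuous; exact _.
- move=> x x1; have x0 : 0 < x by apply: lt_le_trans x1.
  rewrite mulr_ge0// ?mulr_ge0 ?(ltW q0)//.
  by rewrite subr_ge0 expR_le1 oppr_le0 mulr_ge0 ?sqr_ge0.
- rewrite [X in _ --> X](_ : _ = q * (0 - 4 * s * 0)); last by rewrite mulr0 subr0 mulr0.
  apply: cvgMr; apply: cvgB.
    apply: (@squeeze_cvgr _ _ _ _ (cst 0) (fun r => 2 * s ^+ 2 * r^-1)).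
    + near=> x; have x0 : 0 < x by near: x; exact: nbhs_pinfty_gt.
      have x0' := ltW x0.
      rewrite mulr_ge0 ?mulr_ge0//=; last first.
        by rewrite subr_ge0 expR_le1 oppr_le0 mulr_ge0 ?sqr_ge0.
      have -> : 2 * s ^+ 2 * x^-1 = 2 * x * (s ^+ 2 * x^-1 ^+ 2) by field; rewrite gt_eqF.
      rewrite ler_wpM2l ?mulr_ge0// lerBlDr -lerBlDl.
      by have := expR_ge1Dx (- (s ^+ 2 * x^-1 ^+ 2)); lra.
    + exact: cvg_cst.
    + rewrite [X in _ --> X](_ : _ = 2 * s ^+ 2 * 0); last by rewrite mulr0.
      by apply: cvgMr; exact: cvg_inv_pinfty.
  apply: cvgMr; apply: (@squeeze_cvgr _ _ _ _ (cst 0) (fun r => s * r^-1)).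
  + near=> x; have x0 : 0 < x by near: x; exact: nbhs_pinfty_gt.
    by rewrite gauss_primitive_ge0 gauss_primitive_le// mulr_ge0 ?invr_ge0 ?(ltW s0) ?(ltW x0).
  + exact: cvg_cst.
  + rewrite [X in _ --> X](_ : _ = s * 0); last by rewrite mulr0.
    by apply: cvgMr; exact: cvg_inv_pinfty.
Unshelve. all: by end_near. Qed.

(** The contribution of large heat times when the cubed theta function is
    replaced by its leading term (pi / t)^(3/2). *)
Lemma integral_direct_main s : 0 < s ->
  (\int[mu]_(r in `[1%R, +oo[) (2 * q * r^-1 ^+ 2 * expR (- (s ^+ 2 * r ^+ 2)))%:E =
   (q * (2 * expR (- s ^+ 2) + 4 * s * g s - 2 * s * Num.sqrt pi))%:E)%E.
Proof.
move=> s0; have q0 : 0 < q by rewrite exprn_gt0// sqrtr_gt0 pi_gt0.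
have s20 : 0 < s ^+ 2 by rewrite exprn_gt0.
apply: (@integral_ge_derive _ (fun r =>
  q * (- 2 * (r^-1 * expR (- (s ^+ 2 * r ^+ 2))) - 4 * s * g (s * r))) _ 1
  (q * (- 2 * (0 * 0) - 4 * s * (Num.sqrt pi / 2)))).
- by [].
- rewrite invr1 expr1n !mulr1; move: (Num.sqrt pi) (g s) => p gg.
  by field.
- move=> x x0; have iv := is_derive_inv x0.
  have gd : is_derive (s * x) (1 : R) g (expR (- (s * x) ^+ 2)).
    by apply: is_derive_gauss_primitive; rewrite mulr_gt0.
  have hd : is_derive x (1 : R) (fun r : R => s * r) s.
    by derive_by_rules; rewrite /GRing.scale/= mulr1.
  have cd := @is_derive1_comp _ g (fun r => s * r) x _ _ gd hd.
  have -> : (fun r => q * (- 2 * (r^-1 * expR (- (s ^+ 2 * r ^+ 2))) - 4 * s * g (s * r))) =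
     (fun r => q * (- 2 * (r^-1 * expR (- (s ^+ 2 * r ^+ 2))) - 4 * s * (g \o (fun r => s * r)) r)) by [].
  move: (Num.sqrt pi) => p.
  derive_at_by_rules; rewrite /GRing.scale/= exprMn; field.
  by rewrite gt_eqF.
- move=> x x0; have iv := is_derive_inv x0.
  move: (Num.sqrt pi) => p; eapply derivable_at_continuous; exact _.
- move=> x x1; have x0 : 0 < x by apply: lt_le_trans x1.
  by rewrite mulr_ge0 ?expR_ge0// !mulr_ge0 ?exprn_ge0 ?invr_ge0 ?(ltW x0) ?(ltW q0).
- apply: cvgMr; apply: cvgB; apply: cvgMr.
    apply: cvgM; first exact: cvg_inv_pinfty.
    exact: cvg_gauss_pinfty.
  apply: (@cvg_comp _ _ _ (fun r => s * r) g _ _ _ _ (@cvg_gauss_primitive R)).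
  by apply: gt0_cvgMry.
Qed.

End Explicit_integrals_continued.

Section Tonelli.
Local Open Scope ereal_scope.

Lemma esum_nneseries (R : realType) (T : countType) (a : T -> \bar R) :
  (forall k, 0 <= a k) ->
  \esum_(k in [set: T]) a k = \sum_(0 <= n <oo) oapp a 0 (pickle_inv n).
Proof.
move=> a0; pose b n := oapp a 0 (@pickle_inv T n).
have b0 n : 0 <= b n by rewrite /b; case: pickle_inv.
rewrite nneseries_esumT//.
pose S : set nat := range (@pickle T).
rewrite (esumID S); last by move=> n _; exact: b0.
rewrite [X in _ = X + _](_ : _ = \esum_(n in S) b n); last by congr esum; exact: setTI.
rewrite [X in _ = _ + X]esum1 ?adde0.
  rewrite esum_image; last by move=> i j _ _; exact: (pcan_inj pickleK).
  by apply: eq_esum => k _; rewrite /b pickleK_inv.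
move=> n [_ nS]; have := @pickle_invK T n; case: (pickle_inv n) => //= k kn.
by exfalso; apply: nS; exists k.
Qed.

Lemma measurable_esum d (X : measurableType d) (R : realType) (D : set X)
    (T : countType) (f : T -> X -> \bar R) :
  (forall k, measurable_fun D (f k)) -> (forall k x, D x -> 0 <= f k x) ->
  measurable_fun D (fun x => \esum_(k in [set: T]) f k x).
Proof.
move=> mf f0.
apply: (@eq_measurable_fun _ _ _ _ _
    (fun x => \sum_(0 <= n <oo) oapp (f ^~ x) 0 (@pickle_inv T n))).
  by move=> x /set_mem Dx; rewrite esum_nneseries// => k; exact: f0.
apply: (@ge0_emeasurable_sum _ _ _ D (fun n x => oapp (f ^~ x) 0 (@pickle_inv T n)) xpredT).
- by move=> n x Dx _; case: pickle_inv => //= k; exact: f0.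
- by move=> n _; case: pickle_inv => //=; exact: measurable_cst.
Qed.

(** Monotone convergence for sums over a countable type, by enumeration of the
    type. *)
Lemma integral_esum d (X : measurableType d) (R : realType)
    (mu : {measure set X -> \bar R}) (D : set X) (T : countType)
    (f : T -> X -> \bar R) :
  d.-measurable D -> (forall k, measurable_fun D (f k)) ->
  (forall k x, D x -> 0 <= f k x) ->
  \int[mu]_(x in D) (\esum_(k in [set: T]) f k x) =
  \esum_(k in [set: T]) \int[mu]_(x in D) f k x.
Proof.
move=> mD mf f0.
rewrite esum_nneseries; last by move=> k; apply: integral_ge0 => x Dx; exact: f0.
transitivity (\int[mu]_(x in D)
    (\sum_(0 <= n <oo) oapp (f ^~ x) 0 (@pickle_inv T n))).
  by apply: eq_integral => x /set_mem Dx; rewrite esum_nneseries// => k; exact: f0.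
rewrite integral_nneseries//.
- apply: eq_eseriesr => n _; case: pickle_inv => //=.
  exact: integral0.
- by move=> n; case: pickle_inv => //= ; exact: measurable_cst.
- by move=> n x Dx; case: pickle_inv => //= k; exact: f0.
Qed.

End Tonelli.

(** * The lattice Green function and beta3 *)

Section Green_function.
Context {R : realType}.
Local Notation mu := (@lebesgue_measure R).
Local Notation g := (@gauss_primitive R).
Local Notation q := (Num.sqrt pi ^+ 3 : R).
Local Notation lat := (int * int * int)%type.
Local Notation N := (@norm2 R).
Implicit Types (r s x : R) (k : lat).

Definition lattice_nonzero : set lat := [set k | k != 0].
Local Notation Z3 := lattice_nonzero.

Lemma esum_lattice0 (a : lat -> \bar R) : (forall k, 0 <= a k)%E ->
  (\esum_(k in [set: lat]) a k = a 0%R + \esum_(k in Z3) a k)%E.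
Proof.
move=> a0; rewrite (esumID [set 0%R])// !setTI esum_set1//; congr (_ + esum _ _)%E.
by apply/seteqP; split => k /= /eqP.
Qed.

Lemma norm2_0 : N 0 = 0.
Proof. by rewrite /norm2/= !mulr0z expr0n/= !addr0. Qed.

(** The squared length is an integer. *)
Lemma norm2_ge1 k : Z3 k -> 1 <= N k.
Proof.
have e : N k = (k.1.1 ^+ 2 + k.1.2 ^+ 2 + k.2 ^+ 2)%:~R.
  by rewrite /norm2 !rmorphD/= !rmorphXn.
rewrite e ler1z => k0.
have : k.1.1 != 0 \/ k.1.2 != 0 \/ k.2 != 0.
  move: k k0 {e} => [[a b] c] /= /eqP k0.
  have [a0|] := eqVneq a 0; last by left.
  have [b0|] := eqVneq b 0; last by right; left.
  have [c0|] := eqVneq c 0; last by right; right.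
  by exfalso; apply: k0; rewrite a0 b0 c0.
by nia.
Qed.

Lemma measurable_pos_continuous (f : R -> R) :
  (forall x, 0 < x -> {for x, continuous f}) ->
  measurable_fun (`[1%R, +oo[%classic : set R) (fun x => (f x)%:E).
Proof.
move=> cf; have wf : {within `[1, +oo[, continuous f}.
  apply/continuous_within_itvcyP; split; last exact/cvg_at_right_filter/cf.
  by move=> x; rewrite in_itv/= andbT => x1; apply: cf; exact: lt_trans x1.
apply/measurable_EFinP; apply: subspace_continuous_measurable_fun => //.
Qed.

(** Only the zero term is kept on the dual side. *)
Lemma theta_ge (t : R) : 0 < t -> ((Num.sqrt (pi / t))%:E <= theta t)%E.
Proof.
by move=> t0; rewrite theta_functional// lee_pemulr ?lee_fin ?sqrtr_ge0 ?theta_ge1.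
Qed.

(** The integral of exp(-t (|k|^2 + s^2)) over t >= 1. *)
Definition damped k s : R := expR (- (N k + s ^+ 2)) / (N k + s ^+ 2).

(** The sum over all k is the integral of 2 r exp(-s^2 r^2) theta(r^2)^3, and
    theta(r^2) >= sqrt(pi) / r. The term of k = 0 is written apart. *)
Lemma damped_sum_ge s : 0 < s ->
  ((q * (2 * expR (- s ^+ 2) + 4 * s * g s - 2 * s * Num.sqrt pi))%:E <=
   (expR (- s ^+ 2) / s ^+ 2)%:E + \esum_(k in Z3) (damped k s)%:E)%E.
Proof.
move=> s0; have s20 : 0 < s ^+ 2 by rewrite exprn_gt0.
have Ns k : 0 < N k + s ^+ 2 by rewrite ltr_wpDl ?norm2_ge0.
have -> : (expR (- s ^+ 2) / s ^+ 2)%:E = (damped 0 s)%:E.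
  by rewrite /damped norm2_0 add0r.
rewrite -esum_lattice0; last by move=> k; rewrite lee_fin divr_ge0 ?expR_ge0// ltW.
under eq_esum => k _ do rewrite /damped -integral_weighted_gauss//.
have mf k : measurable_fun (`[1%R, +oo[%classic : set R)
    (fun r : R => (2 * r * expR (- ((N k + s ^+ 2) * r ^+ 2)))%:E).
  by apply: measurable_pos_continuous => x x0; eapply derivable_at_continuous; exact _.
rewrite -integral_esum//; last first.
  move=> k x /=; rewrite in_itv/= andbT => x1.
  by rewrite lee_fin mulr_ge0 ?expR_ge0// mulr_ge0// (le_trans _ x1).
rewrite -integral_direct_main//.
have eqf x : `[1%R, +oo[%classic x ->
  (\esum_(k in [set: lat]) (2 * x * expR (- ((N k + s ^+ 2) * x ^+ 2)))%:E =
   (2 * x * expR (- (s ^+ 2 * x ^+ 2)))%:E *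
     (theta (x ^+ 2) * theta (x ^+ 2) * theta (x ^+ 2)))%E.
  rewrite /= in_itv/= andbT => x1; have x0 : 0 < x by apply: lt_le_trans x1.
  rewrite -esum_theta3 ?exprn_gt0// -esumZl; last 2 first.
  - by rewrite mulr_ge0 ?expR_ge0// mulr_ge0 ?ltW.
  - by move=> k; rewrite lee_fin expR_ge0.
  apply: eq_esum => k _; rewrite -EFinM; congr EFin.
  by rewrite -[RHS]mulrA -expRD; congr (_ * expR _); ring.
apply: ge0_le_integral => //.
- move=> x /=; rewrite in_itv/= andbT => x1; have x0 : 0 < x by apply: lt_le_trans x1.
  by rewrite lee_fin !mulr_ge0 ?expR_ge0 ?invr_ge0 ?exprn_ge0 ?sqrtr_ge0 ?ltW.
- apply: measurable_pos_continuous => x x0; have iv := is_derive_inv x0.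
  by move: (Num.sqrt pi) => p; eapply derivable_at_continuous; exact _.
- apply: measurable_esum => // k x /=; rewrite in_itv/= andbT => x1.
  by rewrite lee_fin mulr_ge0 ?expR_ge0// mulr_ge0// (le_trans _ x1).
- move=> x /[dup] xI; rewrite /= in_itv/= andbT => x1.
  have x0 : 0 < x by apply: lt_le_trans x1.
  have px : (0 <= (Num.sqrt (pi / x ^+ 2))%:E)%E by rewrite lee_fin sqrtr_ge0.
  have th := theta_ge (exprn_gt0 2 x0).
  rewrite eqf//.
  apply: (@le_trans _ _ ((2 * x * expR (- (s ^+ 2 * x ^+ 2)))%:E *
    ((Num.sqrt (pi / x ^+ 2))%:E * (Num.sqrt (pi / x ^+ 2))%:E *
     (Num.sqrt (pi / x ^+ 2))%:E))%E).
    rewrite sqrtrM ?pi_ge0// sqrtrV ?sqr_ge0// sqrtr_sqr ger0_norm ?(ltW x0)//.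
    rewrite -!EFinM lee_fin le_eqVlt; apply/orP; left; apply/eqP.
    by move: (Num.sqrt pi) => p; field; rewrite gt_eqF.
  rewrite lee_pmul2l//; last by rewrite lte_fin mulr_gt0 ?expR_gt0// mulr_gt0.
  by apply: lee_pmul => //; apply: lee_pmul.
Qed.

(** The integral of exp(-t |k|^2) (1 - exp(-t s^2)) over 0 < t <= 1. *)
Definition mid k s : R := (N k)^-1 - (N k + s ^+ 2)^-1 - expR (- N k) / N k + damped k s.

(** With t = 1 / r^2 the theta transformation turns the sum of the integrands
    into a sum over the dual lattice. There the zero vector is integrated
    exactly, and for the other vectors the factor 1 - exp(-t s^2) is bounded
    by 1. The constant on the left is the term of k = 0. *)
Lemma mid_sum_le s : 0 < s ->
  ((1 + expR (- s ^+ 2) / s ^+ 2 - s ^- 2)%:E + \esum_(k in Z3) (mid k s)%:E <=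
   (q * (4 * s * g s - 2 * (1 - expR (- s ^+ 2))))%:E +
   \esum_(k in Z3) (pi * (erfc (pi * Num.sqrt (N k)) / Num.sqrt (N k)))%:E)%E.
Proof.
move=> s0; have s20 : 0 < s ^+ 2 by rewrite exprn_gt0.
have q0 : 0 < q by rewrite exprn_gt0// sqrtr_gt0 pi_gt0.
pose w r := 1 - expR (- (s ^+ 2 * r^-1 ^+ 2)).
have w0 r : 0 <= w r <= 1.
  rewrite /w gerBl expR_ge0 andbT subr_ge0 expR_le1 oppr_le0.
  by rewrite mulr_ge0 ?sqr_ge0.
pose f k r := 2 * r^-1 ^+ 3 * w r * expR (- (N k * r^-1 ^+ 2)).
pose h k r := 2 * q * w r * expR (- (pi ^+ 2 * N k * r ^+ 2)).
have f0 k r : (`[1%R, +oo[%classic : set R) r -> (0 <= (f k r)%:E)%E.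
  rewrite /= in_itv/= andbT => r1; have r0 : 0 < r by apply: lt_le_trans r1.
  have /andP[wr _] := w0 r.
  by rewrite lee_fin mulr_ge0 ?expR_ge0// mulr_ge0// mulr_ge0// exprn_ge0// invr_ge0 ltW.
have h0 k r : (`[1%R, +oo[%classic : set R) r -> (0 <= (h k r)%:E)%E.
  move=> _; have /andP[wr _] := w0 r.
  by rewrite lee_fin mulr_ge0 ?expR_ge0// mulr_ge0// mulr_ge0// ltW.
have mf k : measurable_fun (`[1%R, +oo[%classic : set R) (fun r => (f k r)%:E).
  apply: measurable_pos_continuous => x x0; have iv := is_derive_inv x0.
  by rewrite /f /w; eapply derivable_at_continuous; exact _.
have mh k : measurable_fun (`[1%R, +oo[%classic : set R) (fun r => (h k r)%:E).
  apply: measurable_pos_continuous => x x0; have iv := is_derive_inv x0.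
  rewrite /h /w; move: (Num.sqrt pi) (pi ^+ 2) => p p2.
  by eapply derivable_at_continuous; exact _.
have -> : ((1 + expR (- s ^+ 2) / s ^+ 2 - s ^- 2)%:E + \esum_(k in Z3) (mid k s)%:E =
    \esum_(k in [set: lat]) \int[mu]_(r in `[1%R, +oo[) (f k r)%:E)%E.
  rewrite esum_lattice0; last by move=> k; apply: integral_ge0 => r; exact: f0.
  congr (_ + _)%E.
    rewrite -integral_inverted_const//; apply: eq_integral => r _.
    by rewrite /f norm2_0 mul0r oppr0 expR0 mulr1.
  apply: eq_esum => k k0; rewrite /mid /damped -integral_inverted_exp//.
  by apply: lt_le_trans (norm2_ge1 k0).
rewrite -integral_esum//.
have -> : (\int[mu]_(r in `[1%R, +oo[) (\esum_(k in [set: lat]) (f k r)%:E) =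
    \int[mu]_(r in `[1%R, +oo[) (\esum_(k in [set: lat]) (h k r)%:E))%E.
  apply: eq_integral => r; rewrite inE/= in_itv/= andbT => r1.
  have r0 : 0 < r by apply: lt_le_trans r1.
  have /andP[wr _] := w0 r.
  transitivity ((2 * r^-1 ^+ 3 * w r)%:E *
     (theta (r^-1 ^+ 2) * theta (r^-1 ^+ 2) * theta (r^-1 ^+ 2)))%E.
    rewrite -esum_theta3 ?exprn_gt0 ?invr_gt0// -esumZl.
    - by apply: eq_esum => k _; rewrite -EFinM /f [N k * _]mulrC.
    - by rewrite !mulr_ge0 ?exprn_ge0 ?invr_ge0 ?(ltW r0).
    - by move=> k; rewrite lee_fin expR_ge0.
  have rr : 0 < r^-1 ^+ 2 by rewrite exprn_gt0// invr_gt0.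
  have rV : (r^-1 ^+ 2)^-1 = r ^+ 2 by rewrite exprVn invrK.
  rewrite theta_functional// rV.
  rewrite sqrtrM ?pi_ge0// sqrtr_sqr ger0_norm ?(ltW r0)//.
  set T := theta _.
  have Tfin : T \is a fin_num by rewrite fin_num_theta// mulr_gt0 ?exprn_gt0 ?pi_gt0.
  transitivity ((2 * q * w r)%:E * (T * T * T))%E.
    rewrite -(fineK Tfin) -!EFinM; congr EFin.
    by move: (Num.sqrt pi) => p; field; rewrite gt_eqF.
  rewrite -esum_theta3 ?mulr_gt0 ?exprn_gt0 ?pi_gt0// -esumZl.
  - apply: eq_esum => k _; rewrite -EFinM /h; congr (_ * expR _)%:E.
    by rewrite mulrAC.
  - by rewrite !mulr_ge0// ?(ltW q0).
  - by move=> k; rewrite lee_fin expR_ge0.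
rewrite integral_esum// esum_lattice0; last first.
  by move=> k; apply: integral_ge0 => r; exact: h0.
rewrite leeD//.
  rewrite -integral_dual_main// le_eqVlt; apply/orP; left; apply/eqP.
  by apply: eq_integral => r _; rewrite /h norm2_0 mulr0 mul0r oppr0 expR0 mulr1.
apply: le_esum => k k0; have Nk := lt_le_trans ltr01 (norm2_ge1 k0).
rewrite -integral_dual_gauss ?sqrtr_gt0//; apply: ge0_le_integral => //.
- by move=> r; exact: h0.
- exact: mh.
- apply: measurable_pos_continuous => x x0.
  move: (Num.sqrt pi) (pi ^+ 2) => p p2.
  by eapply derivable_at_continuous; exact _.
- move=> r _; rewrite lee_fin /h sqr_sqrtr ?norm2_ge0// ler_wpM2r ?expR_ge0//.
  by rewrite ler_piMr ?mulr_ge0 ?(ltW q0)//; have /andP[] := w0 r.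
Qed.

End Green_function.

Section Beta3_estimates.
Context {R : realType}.
Local Notation mu := (@lebesgue_measure R).
Local Notation q := (Num.sqrt pi ^+ 3 : R).
Local Notation lat := (int * int * int)%type.
Local Notation N := (@norm2 R).
Local Notation Z3 := lattice_nonzero.
Implicit Types (r s x : R) (k : lat).

Definition direct_term k : R := expR (- N k) / N k.
Definition dual_term k : R := pi * (erfc (pi * Num.sqrt (N k)) / Num.sqrt (N k)).
(** The extended-real sum in beta3, before its real part is taken; it splits into
    the sums of the two kinds of terms. *)
Definition lattice_sum : \bar R := (\esum_(k in Z3) (direct_term k + dual_term k)%:E)%E.

Lemma beta3E : beta3 R = - 1 - 2 * q + fine lattice_sum.
Proof.
rewrite /beta3 /lattice_sum (_ : pi `^ (3 / 2) = q).
  congr (_ + fine _); apply: eq_esum => k _.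
  by rewrite /direct_term /dual_term lattice_modE sqr_sqrtr ?norm2_ge0.
rewrite -powR12_sqrt ?pi_ge0// -powR_mulrn ?powR_ge0// -powRrM.
by congr (_ `^ _); rewrite mulrC.
Qed.

Lemma norm2_gt0 k : Z3 k -> 0 < N k.
Proof. by move=> k0; apply: lt_le_trans (norm2_ge1 k0). Qed.

Lemma direct_term_ge0 k : 0 <= direct_term k.
Proof. by rewrite divr_ge0 ?expR_ge0 ?norm2_ge0. Qed.

(** A Gaussian tail is compared with the integral of t exp(-t^2). *)
Lemma dual_term_bounds k : Z3 k -> 0 <= dual_term k <= expR (- (pi ^+ 2 * N k)).
Proof.
move=> k0; have Nk := norm2_gt0 k0.
have sp : 0 < Num.sqrt pi :> R by rewrite sqrtr_gt0 pi_gt0.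
have q0 : 0 < q by rewrite exprn_gt0.
have pN : 0 < pi ^+ 2 * N k by rewrite mulr_gt0// exprn_gt0// pi_gt0.
have E := @integral_dual_gauss R (Num.sqrt (N k)).
rewrite sqrtr_gt0 sqr_sqrtr ?norm2_ge0// in E; have {}E := E Nk.
rewrite -/(dual_term k) in E; apply/andP; split; rewrite -lee_fin -E.
  by apply: integral_ge0 => r _; rewrite lee_fin mulr_ge0 ?expR_ge0// mulr_ge0// ltW.
apply: (@le_trans _ _ (\int[mu]_(r in `[1%R, +oo[)
    (q%:E * (2 * r * expR (- (pi ^+ 2 * N k * r ^+ 2)))%:E))%E).
  apply: ge0_le_integral => //.
  - apply: measurable_pos_continuous => x x0.
    move: (Num.sqrt pi) (pi ^+ 2) => p p2.
    by eapply derivable_at_continuous; exact _.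
  - apply: measurable_funeM; apply: measurable_pos_continuous => x x0.
    move: (pi ^+ 2) => p2.
    by eapply derivable_at_continuous; exact _.
  - move=> r /=; rewrite in_itv/= andbT => r1.
    rewrite -EFinM lee_fin [leRHS]mulrA ler_wpM2r ?expR_ge0// [leRHS]mulrCA [leRHS]mulrA.
    by rewrite ler_peMr// mulr_ge0// (ltW q0).
rewrite ge0_integralZl//; last 2 first.
- apply: measurable_pos_continuous => x x0.
  move: (pi ^+ 2) => p2.
  by eapply derivable_at_continuous; exact _.
- move=> r /=; rewrite in_itv/= andbT => r1.
  by rewrite lee_fin mulr_ge0 ?expR_ge0// mulr_ge0// (le_trans _ r1).
rewrite integral_weighted_gauss// -EFinM lee_fin mulrCA ler_piMr ?expR_ge0//.
rewrite ler_pdivrMr// mul1r.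
apply: (@le_trans _ _ (pi ^+ 2)); last first.
  by rewrite ler_peMr ?norm2_ge1// exprn_ge0// pi_ge0.
have p1 : 1 <= Num.sqrt pi :> R.
  by rewrite -[leLHS]sqrtr1 ler_wsqrtr// (le_trans _ (pi_ge2 R))// ler1n.
rewrite -[X in _ <= X ^+ 2](sqr_sqrtr (pi_ge0 R)) -exprM.
by rewrite ler_weXn2l.
Qed.

Definition unit_vectors : seq lat :=
  [:: (1, 0, 0); (-1, 0, 0); (0, 1, 0); (0, -1, 0); (0, 0, 1); (0, 0, -1)].

Lemma norm2_ge2 k : Z3 k -> k \notin unit_vectors -> 2 <= N k.
Proof.
have e : N k = (k.1.1 ^+ 2 + k.1.2 ^+ 2 + k.2 ^+ 2)%:~R.
  by rewrite /norm2 !rmorphD/= !rmorphXn.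
rewrite e -[2]/(2%:Z%:~R) ler_int => k0.
move: k k0 {e} => [[a b] c] /= /eqP k0 ku.
have {ku} : forall v, v \in unit_vectors -> (a, b, c) <> v.
  by move=> v vu E; move: ku; rewrite E vu.
move=> ku.
have h1 := ku (1, 0, 0) isT; have h2 := ku (-1, 0, 0) isT.
have h3 := ku (0, 1, 0) isT; have h4 := ku (0, -1, 0) isT.
have h5 := ku (0, 0, 1) isT; have h6 := ku (0, 0, -1) isT.
rewrite leNgt; apply/negP => lt2.
have sq (z : int) : [\/ z = -1, z = 0 | z = 1] \/ 4 <= z ^+ 2.
  have [z1|z1] := leP z 1; last by right; rewrite expr2; nia.
  have [z2|z2] := leP (-1) z; last by right; rewrite expr2; nia.
  left; have [->|[->|->]] : z = -1 \/ z = 0 \/ z = 1 by lia.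
  - exact: Or31.
  - exact: Or32.
  - exact: Or33.
have [a2 b2 c2] : [/\ 0 <= a ^+ 2, 0 <= b ^+ 2 & 0 <= c ^+ 2] by rewrite !sqr_ge0.
have {}sq (z : int) (zlt : z ^+ 2 < 4) : [\/ z = -1, z = 0 | z = 1].
  by have [//|] := sq z; rewrite leNgt zlt.
have a3 : [\/ a = -1, a = 0 | a = 1] by apply: sq; lia.
have b3 : [\/ b = -1, b = 0 | b = 1] by apply: sq; lia.
have c3 : [\/ c = -1, c = 0 | c = 1] by apply: sq; lia.
by case: a3 lt2 h1 h2 h3 h4 h5 h6 k0 => ->; case: b3 => ->; case: c3 => ->.
Qed.

Lemma expR_ge_sqr x : 0 <= x -> 1 + x + x ^+ 2 / 2 <= expR x.
Proof.
move=> x0; rewrite -subr_ge0.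
apply: (@ge0_of_derive_ge0 _ (fun x => expR x - (1 + x + x ^+ 2 / 2))
  (fun x => expR x - (1 + x))).
- by move=> y; derive_by_rules; rewrite /GRing.scale/=; field.
- by move=> y _; rewrite subr_ge0 expR_ge1Dx.
- by rewrite expR0 expr0n/= mul0r !addr0 subrr.
- by [].
Qed.

(** The quadratic Taylor bound at 1/8, raised to the eighth power. *)
Lemma expRN1_le : expR (- 1) <= 37 / 100 :> R.
Proof.
have h : 145 / 128 <= expR 8^-1 :> R.
  by apply: le_trans (expR_ge_sqr _); lra.
have e : expR 1 = expR 8^-1 ^+ 8 :> R by rewrite -expRM_natl mulfV.
have h8 : (145 / 128) ^+ 8 <= expR 1 :> R.
  by rewrite e; apply: lerXn2r; rewrite ?nnegrE ?expR_ge0//; lra.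
by rewrite expRN -[leRHS]invrK lef_pV2 ?posrE ?expR_gt0//; lra.
Qed.

Lemma esum_nonzero_gauss t : 0 < t ->
  (1 + \esum_(k in Z3) (expR (- (t * N k)))%:E = theta t * theta t * theta t)%E.
Proof.
move=> t0; rewrite -esum_theta3// esum_lattice0; last first.
  by move=> k; rewrite lee_fin expR_ge0.
by rewrite norm2_0 mulr0 oppr0 expR0.
Qed.

(** Halving exp(-|k|^2) accounts for the division by |k|^2 as soon as
    |k|^2 >= 2; the six vectors of length one receive the missing half
    separately. The Gaussian sums that remain are cubes of theta values. *)
Lemma term_le k : Z3 k -> direct_term k + dual_term k <=
  2^-1 * expR (- (1 * N k)) +
  (\sum_(v <- unit_vectors) (if k == v then expR (- 1) / 2 else 0)) +
  expR (- (pi ^+ 2 * N k)).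
Proof.
move=> k0; have /andP[_ d1] := dual_term_bounds k0; rewrite lerD// mul1r.
have Nk := norm2_gt0 k0.
have s0 (s : seq lat) : 0 <= \sum_(v <- s) (if k == v then expR (- 1) / 2 else 0 : R).
  by apply: sumr_ge0 => v _; case: ifP => // _; rewrite divr_ge0 ?expR_ge0.
have [ku|ku] := boolP (k \in unit_vectors).
  have : expR (- 1) / 2 <= \sum_(v <- unit_vectors) (if k == v then expR (- 1) / 2 else 0 : R).
    rewrite (big_rem k ku)/= eqxx lerDl; exact: s0.
  have : N k = 1.
    move: ku; rewrite !inE => /orP[|/orP[|/orP[|/orP[|/orP[|]]]]] /eqP ->; rewrite /norm2/=;
    by rewrite ?mulr0z ?mulr1z ?mulrN1z ?sqrrN ?expr0n ?expr1n ?add0r ?addr0.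
  by rewrite /direct_term => ->; rewrite divr1; lra.
have N2 := norm2_ge2 k0 ku.
apply: (@le_trans _ _ (2^-1 * expR (- N k))); last by rewrite lerDl s0.
by rewrite /direct_term mulrC ler_wpM2r ?expR_ge0// lef_pV2 ?posrE.
Qed.

Lemma theta_pi2_le : (theta (pi ^+ 2 : R) <= (1 + 1 / 2000)%:E)%E.
Proof.
have p2 : 0 < pi ^+ 2 :> R by rewrite exprn_gt0// pi_gt0.
apply: le_trans (theta_le_geometric p2) _; rewrite lee_fin lerD2l.
have r9 : expR (- pi ^+ 2) <= (37 / 100) ^+ 9 :> R.
  apply: (@le_trans _ _ (expR (- 1) ^+ 9)).
    rewrite -expRM_natl ler_expR mulrN1 lerN2.
    by have := @pi_gt31 R; nra.
  by apply: lerXn2r; rewrite ?nnegrE ?expR_ge0//; exact: expRN1_le.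
have r0 := expR_ge0 (- pi ^+ 2 : R).
have r9' : expR (- pi ^+ 2) <= 2 / 10000 :> R by apply: le_trans r9 _; lra.
rewrite -ler_pdivlMl// ler_pdivrMr; lra.
Qed.

(** The theta transformation gives theta(1) = sqrt(pi) theta(pi^2), and
    theta(pi^2) is almost 1. *)
Lemma lattice_sum_le : (lattice_sum <= (1 / 2 * q + 618 / 1000)%:E)%E.
Proof.
have p2 : 0 < pi ^+ 2 :> R by rewrite exprn_gt0// pi_gt0.
have sp : 0 < Num.sqrt pi :> R by rewrite sqrtr_gt0 pi_gt0.
have Tfin := fin_num_theta p2.
have T := theta_pi2_le.
have T1 := theta_ge1 (pi ^+ 2 : R).
have e1 := esum_nonzero_gauss (@ltr01 R).
have e2 := esum_nonzero_gauss p2.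
move: e1; rewrite theta_functional// !divr1.
move: T T1 e2; rewrite -(fineK Tfin); set y := fine _; rewrite !lee_fin => T T1 e2 e1.
set J1 := (\esum_(k in Z3) (expR (- (1 * N k)))%:E)%E in e1.
set J2 := (\esum_(k in Z3) (expR (- (pi ^+ 2 * N k)))%:E)%E in e2.
have J1E : J1 = ((Num.sqrt pi * y) ^+ 3 - 1)%:E.
  have f1 : J1 \is a fin_num.
    have : (1 + J1)%E \is a fin_num by rewrite e1 -!EFinM.
    by rewrite fin_numD => /andP[].
  move: e1; rewrite -(fineK f1) -!EFinM -EFinD => -[] e1; congr EFin.
  by rewrite -[LHS](addKr 1) e1; ring.
have J2E : J2 = (y ^+ 3 - 1)%:E.
  have f1 : J2 \is a fin_num.
    have : (1 + J2)%E \is a fin_num by rewrite e2 -!EFinM.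
    by rewrite fin_numD => /andP[].
  move: e2; rewrite -(fineK f1) -!EFinM -EFinD => -[] e2; congr EFin.
  by rewrite -[LHS](addKr 1) e2; ring.
have v0 k v : 0 <= (if k == v then expR (- 1) / 2 else 0 : R).
  by case: ifP => // _; rewrite divr_ge0 ?expR_ge0.
have sumE : (\esum_(k in Z3) (\sum_(v <- unit_vectors)
    (if k == v then expR (- 1) / 2 else 0 : R)%:E) <= (3 * expR (- 1))%:E)%E.
  rewrite esum_sum; last by move=> k v _ _; rewrite lee_fin.
  apply: (@le_trans _ _ (\sum_(v <- unit_vectors) (expR (- 1) / 2)%:E)%E).
    apply: lee_sum => v _.
    apply: (@le_trans _ _ (\esum_(k in [set: lat]) (if k \in [set v] then (expR (- 1) / 2)%:E else 0))%E).
      rewrite [leLHS]esum_mkcond; apply: le_esum => k _.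
      have -> : (k \in [set v]) = (k == v) by apply/idP/eqP => [/set_mem//|->]; exact: mem_set.
      by case: ifP => _; case: eqP => //; rewrite lee_fin divr_ge0 ?expR_ge0.
    rewrite -esum_mkcond esum_set1// lee_fin divr_ge0 ?expR_ge0//.
  rewrite /unit_vectors !big_cons big_nil -!EFinD lee_fin; lra.
apply: (@le_trans _ _ ((2^-1)%:E * J1 + (3 * expR (- 1))%:E + J2)%E).
  apply: (@le_trans _ _ (\esum_(k in Z3) ((2^-1)%:E * (expR (- (1 * N k)))%:E +
     (\sum_(v <- unit_vectors) (if k == v then expR (- 1) / 2 else 0 : R)%:E) +
     (expR (- (pi ^+ 2 * N k)))%:E))%E).
    apply: le_esum => k k0; rewrite sumEFin -EFinM -!EFinD lee_fin; exact: term_le.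
  have x0 k : (0 <= (expR (- (1 * N k)))%:E)%E by rewrite lee_fin expR_ge0.
  have x1 k : (0 <= \sum_(v <- unit_vectors) (if k == v then expR (- 1) / 2 else 0 : R)%:E)%E.
    by apply: sume_ge0 => v _; rewrite lee_fin.
  rewrite esumD; last 2 first.
  - by move=> k _; rewrite adde_ge0// mule_ge0// lee_fin.
  - by move=> k _; rewrite lee_fin expR_ge0.
  rewrite esumD; last 2 first.
  - by move=> k _; rewrite mule_ge0// lee_fin.
  - by move=> k _; exact: x1.
  by rewrite esumZl// leeD// leeD.
rewrite J1E J2E -EFinM -!EFinD lee_fin.
clear e1 e2 J1E J2E J1 J2; clearbody y.
have p3 : q <= 59 / 10.
  have := @pi_lt32 R; have : Num.sqrt pi ^+ 2 = pi :> R by rewrite sqr_sqrtr ?pi_ge0.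
  move: (Num.sqrt pi) sp => p p0 <- c2.
  have pl : p <= 9 / 5.
    by rewrite -(@ler_pXn2r _ 2)// ?nnegrE ?(ltW p0)//; lra.
  have : p ^+ 3 <= (9 / 5) ^+ 3 by apply: lerXn2r; rewrite ?nnegrE ?(ltW p0)//; lra.
  lra.
have y3 : y ^+ 3 <= 1 + 2 / 1000.
  have y2 : y <= 11 / 10 by lra.
  have yy : y * y <= 11 / 10 * (11 / 10) by apply: ler_pM => //; lra.
  have -> : y ^+ 3 = 1 + (y - 1) * (y * y + y + 1) by ring.
  have d0 : 0 <= y - 1 by lra.
  have : (y - 1) * (y * y + y + 1) <= (y - 1) * 4 by apply: ler_wpM2l => //; lra.
  lra.
have e3 := expRN1_le.
rewrite exprMn; have q0 : 0 <= q by rewrite exprn_ge0// ltW.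
have : q * y ^+ 3 <= q * (1 + 2 / 1000) by rewrite ler_wpM2l.
lra.
Qed.

Lemma fin_num_lattice_sum : lattice_sum \is a fin_num.
Proof.
rewrite ge0_fin_numE; first exact: le_lt_trans lattice_sum_le (ltry _).
apply: esum_ge0 => k k0; have /andP[d0 _] := dual_term_bounds k0.
by rewrite lee_fin addr_ge0// direct_term_ge0.
Qed.

(** The true value is -8.913...; a margin of about 1/3 is left for the crude
    bound of the lattice sum. *)
Lemma beta3_le : beta3 R <= - (171 / 20).
Proof.
have sp : 0 < Num.sqrt pi :> R by rewrite sqrtr_gt0 pi_gt0.
have p3 : 109 / 20 <= q.
  have := @pi_gt31 R; have : Num.sqrt pi ^+ 2 = pi :> R by rewrite sqr_sqrtr ?pi_ge0.
  move: (Num.sqrt pi) sp => p p0 <- c2.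
  have pl : 44 / 25 <= p.
    by rewrite -(@ler_pXn2r _ 2)// ?nnegrE ?(ltW p0)//; lra.
  have : 44 / 25 * (31 / 10) <= p * p ^+ 2 by apply: ler_pM => //; lra.
  by rewrite -exprS; lra.
have : fine lattice_sum <= 1 / 2 * q + 618 / 1000.
  by rewrite -lee_fin fineK ?fin_num_lattice_sum// lattice_sum_le.
rewrite beta3E; lra.
Qed.

(** The term is the integral of exp(-t |k|^2) (1 - exp(-t s^2)) over all t > 0.
    For t <= 1 this is [mid]. For t >= 1 it is the term exp(-|k|^2) / |k|^2 of
    beta3 minus [damped]. The two sum bounds then leave the main term
    2 pi^2 s, the constants of beta3 and the correction 1 / s^2. *)
Lemma Green_bound s : 0 < s ->
  (\esum_(k in Z3) (s ^+ 2 / (N k * (N k + s ^+ 2)))%:E <=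
   (2 * pi ^+ 2 * s + beta3 R + s ^- 2)%:E)%E.
Proof.
move=> s0; have s20 : 0 < s ^+ 2 by rewrite exprn_gt0.
have Ns k : Z3 k -> 0 < N k + s ^+ 2 by move=> k0; rewrite addr_gt0// norm2_gt0.
have damp0 k : Z3 k -> 0 <= damped k s by move=> k0; rewrite divr_ge0 ?expR_ge0// ltW// Ns.
have mid0 k : Z3 k -> 0 <= mid k s.
  move=> k0; rewrite /mid /damped -lee_fin -integral_inverted_exp ?norm2_gt0//.
  apply: integral_ge0 => r /=; rewrite in_itv/= andbT => r1.
  have r0 : 0 < r by apply: lt_le_trans r1.
  rewrite lee_fin mulr_ge0 ?expR_ge0// mulr_ge0//.
    by rewrite mulr_ge0// exprn_ge0// invr_ge0 ltW.
  by rewrite subr_ge0 expR_le1 oppr_le0 mulr_ge0 ?sqr_ge0.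
have dt0 k : Z3 k -> 0 <= dual_term k by move=> k0; have /andP[] := dual_term_bounds k0.
have damp_le k : Z3 k -> damped k s <= direct_term k.
  move=> k0; apply: ler_pM.
  - exact: expR_ge0.
  - by rewrite invr_ge0 ltW// Ns.
  - by rewrite ler_expR lerN2 lerDl ltW.
  - by rewrite lef_pV2 ?posrE ?Ns ?norm2_gt0// lerDl ltW.
set T := esum _ _.
pose A := (\esum_(k in Z3) (mid k s)%:E)%E.
pose B := (\esum_(k in Z3) (direct_term k)%:E)%E.
pose C := (\esum_(k in Z3) (damped k s)%:E)%E.
pose S2 := (\esum_(k in Z3) (dual_term k)%:E)%E.
have A0 : (0 <= A)%E by apply: esum_ge0 => k k0; rewrite lee_fin mid0.
have B0 : (0 <= B)%E by apply: esum_ge0 => k k0; rewrite lee_fin direct_term_ge0.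
have C0 : (0 <= C)%E by apply: esum_ge0 => k k0; rewrite lee_fin damp0.
have S20 : (0 <= S2)%E by apply: esum_ge0 => k k0; rewrite lee_fin dt0.
have BS : lattice_sum = (B + S2)%E.
  by rewrite -esumD// => k k0; rewrite lee_fin ?direct_term_ge0 ?dt0.
have Sfin := fin_num_lattice_sum.
have /andP[Bfin S2fin] : (B \is a fin_num) && (S2 \is a fin_num).
  by rewrite -fin_numD -BS.
have Cfin : C \is a fin_num.
  rewrite ge0_fin_numE//; apply: le_lt_trans (_ : B < +oo)%E; last by rewrite -ge0_fin_numE.
  by apply: le_esum => k k0; rewrite lee_fin damp_le.
have TC : (T + C = A + B)%E.
  pose tt k : R := s ^+ 2 / (N k * (N k + s ^+ 2)).
  have t0 k : Z3 k -> (0 <= (tt k)%:E)%E.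
    by move=> k0; rewrite lee_fin divr_ge0 ?(ltW s20)// mulr_ge0 ?norm2_ge0// ltW// Ns.
  have c0 k : Z3 k -> (0 <= (damped k s)%:E)%E by move=> k0; rewrite lee_fin damp0.
  have a0 k : Z3 k -> (0 <= (mid k s)%:E)%E by move=> k0; rewrite lee_fin mid0.
  have b0 k : Z3 k -> (0 <= (direct_term k)%:E)%E.
    by move=> k0; rewrite lee_fin direct_term_ge0.
  have -> : (T + C = \esum_(k in Z3) ((tt k)%:E + (damped k s)%:E))%E := esym (esumD t0 c0).
  have -> : (A + B = \esum_(k in Z3) ((mid k s)%:E + (direct_term k)%:E))%E := esym (esumD a0 b0).
  apply: eq_esum => k k0; rewrite -!EFinD; congr EFin.
  have Nk := norm2_gt0 k0; have Nsk := Ns _ k0.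
  rewrite /tt /mid /direct_term; move: (damped k s) (expR _) => d e.
  by field; rewrite (gt_eqF Nk) (gt_eqF Nsk).
have hA := mid_sum_le s0; rewrite -/A -/S2 in hA.
have hC := damped_sum_ge s0; rewrite -/C in hC.
have Afin : A \is a fin_num.
  rewrite ge0_fin_numE//.
  have : ((1 + expR (- s ^+ 2) / s ^+ 2 - s ^- 2)%:E + A < +oo)%E.
    by apply: le_lt_trans hA _; rewrite -(fineK S2fin) -EFinD ltry.
  have [->|An _] := eqVneq A +oo%E; last by rewrite ltey.
  by rewrite addey// ltxx.
have -> : T = (fine A + fine B - fine C)%:E.
  have Tfin : T \is a fin_num.
    have : (T + C)%E \is a fin_num by rewrite TC fin_numD Afin.
    by rewrite fin_numD => /andP[].
  move: TC; rewrite -(fineK Tfin) -(fineK Cfin) -(fineK Afin) -(fineK Bfin) -!EFinD.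
  by move=> -[] <-; congr EFin; rewrite addrK.
rewrite beta3E BS; move: hA hC.
rewrite -(fineK Afin) -(fineK Bfin) -(fineK Cfin) -(fineK S2fin) -!EFinD !lee_fin /=.
have -> : pi ^+ 2 = q * Num.sqrt pi by rewrite -exprSr (exprM _ 2 2) sqr_sqrtr ?pi_ge0.
by move: q (Num.sqrt pi) => p3 p; lra.
Qed.

End Beta3_estimates.

(** * Square-integrable complex functions on the torus *)

Section Complex_L2.
Context {R : realType}.
Local Notation tm := (@torus_measure R).
Local Notation X := (R * R * R)%type.
Local Notation Re := (@complex.Re R).
Local Notation Im := (@complex.Im R).
Implicit Types (a b : X -> R) (f g h : X -> R[i]) (c z : R[i]).

Lemma lebesgue_measure_period :
  @lebesgue_measure R `[- pi, pi]%classic = (2 * pi)%:E.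
Proof.
rewrite lebesgue_measure_itv/= ifT; last first.
  by rewrite lte_fin (lt_trans _ (pi_gt0 R))// oppr_lt0 pi_gt0.
by rewrite -EFinD opprK mulr_natl mulr2n.
Qed.

Lemma torus_measureT : tm setT = ((2 * pi) ^+ 3)%:E.
Proof.
rewrite /torus_measure /mrestr/= setTI /cube.
rewrite product_measure1E//=; last by apply: measurableX.
rewrite product_measure1E//=.
have E := lebesgue_measure_period; rewrite [X in (X * _ * _)%E]E [X in (_ * X * _)%E]E [X in (_ * X)%E]E.
by rewrite -!EFinM !exprS expr0 mulr1 mulrA.
Qed.

Lemma torus_measure_fin : (tm setT < +oo)%E.
Proof. by rewrite torus_measureT ltry. Qed.

Lemma Lfun2E a : measurable_fun setT a ->
  tm.-integrable setT (EFin \o (fun x => a x ^+ 2)) -> a \in Lfun tm 2%:E.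
Proof.
move=> ma /integrableP[_ ia].
rewrite inE; apply/andP; split; rewrite inE//=.
rewrite /finite_norm unlock /Lnorm poweR_lty//; apply: le_lt_trans ia.
rewrite le_eqVlt; apply/orP; left; apply/eqP; apply: eq_integral => x _ /=.
by rewrite powR_mulrn// -normrX.
Qed.

Lemma Lfun2_measurable a : a \in Lfun tm 2%:E -> measurable_fun setT a.
Proof. by rewrite inE => /andP[]; rewrite inE. Qed.

Lemma Lfun2D a b : a \in Lfun tm 2%:E -> b \in Lfun tm 2%:E ->
  (fun x => a x + b x) \in Lfun tm 2%:E.
Proof.
have l12 : (1 <= 2%:E :> \bar R)%E by rewrite lee_fin ler1n.
by move=> La Lb; have := (@Lfun_addr_closed _ _ _ tm _ l12).2 _ _ La Lb.
Qed.

Lemma Lfun2Z (r : R) a : a \in Lfun tm 2%:E -> (fun x => r * a x) \in Lfun tm 2%:E.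
Proof.
move=> La; have -> : (fun x => r * a x) = r \o* a by apply/funext => x /=; rewrite mulrC.
by apply: Lfun_scale => //; rewrite ler1n.
Qed.

Lemma integrable_mulr2 a b : a \in Lfun tm 2%:E -> b \in Lfun tm 2%:E ->
  tm.-integrable setT (EFin \o (fun x => a x * b x)).
Proof. by move=> La Lb; apply/Lfun1_integrable; exact: Lfun2_mul_Lfun1. Qed.

Lemma Lfun2_bounded a (C : R) : measurable_fun setT a -> (forall x, `|a x| <= C) ->
  a \in Lfun tm 2%:E.
Proof.
move=> ma aC; apply: Lfun2E => //; apply: measurable_bounded_integrable => //.
- exact: torus_measure_fin.
- exact: measurable_funX.
- exists (C ^+ 2); split; first exact: num_real.
  move=> y Cy x _ /=; rewrite normrX (le_trans _ (ltW Cy))//.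
  by rewrite lerXn2r ?nnegrE ?(le_trans _ (aC x)).
Qed.

Definition CL2 f := CLfun 2%:E f.

(** The squared modulus avoids square roots in all L^2 computations. *)
Definition mod2 z : R := Re z ^+ 2 + Im z ^+ 2.

Lemma mod2_ge0 z : 0 <= mod2 z. Proof. by rewrite addr_ge0 ?sqr_ge0. Qed.

Lemma mod2M z c : mod2 (z * c) = mod2 z * mod2 c.
Proof. by case: z c => [p q] [r s]; rewrite /mod2/=; ring. Qed.

(** By the parallelogram law; it replaces the triangle inequality where only
    limits matter. *)
Lemma mod2D_le z c : mod2 (z + c) <= 2 * mod2 z + 2 * mod2 c.
Proof.
case: z c => [p q] [r s]; rewrite /mod2/= -subr_ge0.
rewrite (_ : _ - _ = (p - r) ^+ 2 + (q - s) ^+ 2); last ring.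
by rewrite addr_ge0 ?sqr_ge0.
Qed.

Lemma CL2D f g : CL2 f -> CL2 g -> CL2 (fun x => f x + g x).
Proof.
move=> [f1 f2] [g1 g2]; split.
- rewrite (_ : (fun x => _) = (fun x => Re (f x) + Re (g x))); first exact: Lfun2D.
  by apply/funext => x; case: (f x) (g x) => [? ?] [].
- rewrite (_ : (fun x => _) = (fun x => Im (f x) + Im (g x))); first exact: Lfun2D.
  by apply/funext => x; case: (f x) (g x) => [? ?] [].
Qed.

Lemma CL2Z c f : CL2 f -> CL2 (fun x => c * f x).
Proof.
move=> [f1 f2]; split.
- rewrite (_ : (fun x => _) = (fun x => Re c * Re (f x) + (- Im c) * Im (f x))).
    by apply: Lfun2D; exact: Lfun2Z.
  by apply/funext => x; case: c (f x) => [? ?] [? ?] /=; rewrite mulNr.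
- rewrite (_ : (fun x => _) = (fun x => Re c * Im (f x) + Im c * Re (f x))).
    by apply: Lfun2D; exact: Lfun2Z.
  by apply/funext => x; case: c (f x) => [? ?] [? ?].
Qed.

Lemma CL2B f g : CL2 f -> CL2 g -> CL2 (fun x => f x - g x).
Proof.
move=> Lf Lg; rewrite (_ : (fun x => _) = (fun x => f x + (- 1) * g x)).
  by apply: CL2D => //; exact: CL2Z.
by apply/funext => x; rewrite mulN1r.
Qed.

Lemma CL2_bounded f (C : R) :
  measurable_fun setT (Re \o f) -> measurable_fun setT (Im \o f) ->
  (forall x, mod2 (f x) <= C) -> CL2 f.
Proof.
move=> m1 m2 fC; have C0 : 0 <= C by apply: le_trans (fC point); exact: mod2_ge0.
split; apply: (@Lfun2_bounded _ (Num.sqrt C)) => // x.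
- rewrite -sqrtr_sqr ler_wsqrtr// (le_trans _ (fC x))//.
  by rewrite /mod2 lerDl sqr_ge0.
- rewrite -sqrtr_sqr ler_wsqrtr// (le_trans _ (fC x))//.
  by rewrite /mod2 lerDr sqr_ge0.
Qed.

Lemma CL2_cst c : CL2 (fun=> c).
Proof. by apply: (@CL2_bounded _ (mod2 c)) => //; exact: measurable_cst. Qed.

Lemma CL2_sum (I : Type) (s : seq I) (F : I -> X -> R[i]) :
  (forall i, CL2 (F i)) -> CL2 (fun x => \sum_(i <- s) F i x).
Proof.
move=> LF; elim: s => [|i s IH].
  rewrite (_ : (fun x => _) = (fun=> 0)); first exact: CL2_cst.
  by apply/funext => x; rewrite big_nil.
rewrite (_ : (fun x => _) = (fun x => F i x + \sum_(j <- s) F j x)); first exact: CL2D.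
by apply/funext => x; rewrite big_cons.
Qed.

Lemma CL2_bounded_mul h f (C : R) : CL2 f ->
  measurable_fun setT (Re \o h) -> measurable_fun setT (Im \o h) ->
  (forall x, mod2 (h x) <= C) -> CL2 (fun x => h x * f x).
Proof.
move=> [f1 f2] m1 m2 hC.
have mf1 := Lfun2_measurable f1; have mf2 := Lfun2_measurable f2.
have i1 := Lfun2_integrable_sqr f1; have i2 := Lfun2_integrable_sqr f2.
have iC : tm.-integrable setT (fun x => (C * mod2 (f x))%:E).
  have := integrableZl measurableT C (integrableD measurableT i1 i2).
  by apply: eq_integrable => // x _; rewrite /= -EFinD -EFinM.
have mR : measurable_fun setT (Re \o (fun x => h x * f x)).
  rewrite (_ : _ \o _ = (fun x => Re (h x) * Re (f x) - Im (h x) * Im (f x))).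
    by apply: measurable_funB; apply: measurable_funM.
  by apply/funext => x /=; case: (h x) (f x) => [? ?] [].
have mI : measurable_fun setT (Im \o (fun x => h x * f x)).
  rewrite (_ : _ \o _ = (fun x => Re (h x) * Im (f x) + Im (h x) * Re (f x))).
    by apply: measurable_funD; apply: measurable_funM.
  by apply/funext => x /=; case: (h x) (f x) => [? ?] [].
split; apply: Lfun2E => //.
- apply: le_integrable iC => //.
    by apply/measurable_EFinP; exact: measurable_funX.
  move=> x _ /=; rewrite lee_fin ger0_norm ?sqr_ge0// (le_trans _ (ler_norm _))//.
  apply: (@le_trans _ _ (mod2 (h x * f x))); first by rewrite lerDl sqr_ge0.
  by rewrite mod2M ler_wpM2r ?mod2_ge0.
- apply: le_integrable iC => //.
    by apply/measurable_EFinP; exact: measurable_funX.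
  move=> x _ /=; rewrite lee_fin ger0_norm ?sqr_ge0// (le_trans _ (ler_norm _))//.
  apply: (@le_trans _ _ (mod2 (h x * f x))); first by rewrite lerDr sqr_ge0.
  by rewrite mod2M ler_wpM2r ?mod2_ge0.
Qed.

Definition nrm2 f : R := \int[tm]_x mod2 (f x).

Lemma nrm2_ge0 f : 0 <= nrm2 f.
Proof. by apply: Rintegral_ge0 => x _; exact: mod2_ge0. Qed.

Lemma integrable_mod2 f : CL2 f -> tm.-integrable setT (EFin \o (mod2 \o f)).
Proof.
move=> [/Lfun2_integrable_sqr i1 /Lfun2_integrable_sqr i2].
have := integrableD measurableT i1 i2.
by apply: eq_integrable => // x _; rewrite /= -EFinD.
Qed.

Lemma nrm2D_le f g : CL2 f -> CL2 g ->
  nrm2 (fun x => f x + g x) <= 2 * nrm2 f + 2 * nrm2 g.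
Proof.
move=> Lf Lg; have [i1 i2] := (integrable_mod2 Lf, integrable_mod2 Lg).
have j1 := integrableZl measurableT 2 i1; have j2 := integrableZl measurableT 2 i2.
rewrite /nrm2 -!RintegralZl// -RintegralD//.
apply: le_Rintegral => //; first exact: integrable_mod2 (CL2D Lf Lg).
- by have := integrableD measurableT j1 j2; apply: eq_integrable.
- by move=> x _; exact: mod2D_le.
Qed.

Lemma nrm2_mul_le h f (C : R) : CL2 f ->
  measurable_fun setT (Re \o h) -> measurable_fun setT (Im \o h) ->
  (forall x, mod2 (h x) <= C) -> nrm2 (fun x => h x * f x) <= C * nrm2 f.
Proof.
move=> Lf m1 m2 hC; have i := integrable_mod2 Lf.
rewrite /nrm2 -RintegralZl//; apply: le_Rintegral => //.
- exact: integrable_mod2 (CL2_bounded_mul Lf m1 m2 hC).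
- exact: (integrableZl measurableT C i).
- by move=> x _; rewrite mod2M ler_wpM2r ?mod2_ge0.
Qed.

(** Linear in the first argument. *)
Definition ip f g : R[i] := Cintegral (fun x => f x * (g x)^*%C).

Lemma ipE f g : CL2 f -> CL2 g ->
  ip f g = ((\int[tm]_x (Re (f x) * Re (g x)) + \int[tm]_x (Im (f x) * Im (g x))) +i*
            (\int[tm]_x (Im (f x) * Re (g x)) - \int[tm]_x (Re (f x) * Im (g x))))%C.
Proof.
move=> [f1 f2] [g1 g2].
rewrite /ip /Cintegral -RintegralD ?integrable_mulr2// -RintegralB ?integrable_mulr2//.
congr (_ +i* _)%C; apply: eq_Rintegral => x _.
- by case: (f x) (g x) => [? ?] [? ?] /=; ring.
- by case: (f x) (g x) => [? ?] [? ?] /=; ring.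
Qed.

Lemma ip_conj f g : CL2 f -> CL2 g -> ip g f = (ip f g)^*%C.
Proof.
move=> Lf Lg; rewrite !ipE//=; congr (_ +i* _)%C.
- by congr (_ + _); apply: eq_Rintegral => x _; rewrite mulrC.
- by rewrite opprB; congr (_ - _); apply: eq_Rintegral => x _; rewrite mulrC.
Qed.

Lemma ip_nrm2 f : ip f f = (nrm2 f)%:C%C.
Proof.
rewrite /ip /Cintegral /nrm2; congr (_ +i* _)%C.
- by apply: eq_Rintegral => x _; case: (f x) => p q /=; rewrite /mod2/=; ring.
- rewrite (_ : (fun x => _) = cst 0); first by rewrite Rintegral_cst// mul0r.
  by apply/funext => x; case: (f x) => p q /=; ring.
Qed.

Lemma ipD f g h : CL2 f -> CL2 g -> CL2 h ->
  ip (fun x => f x + g x) h = ip f h + ip g h.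
Proof.
move=> Lf Lg Lh; rewrite !ipE//; last exact: CL2D.
have [f1 f2] := Lf; have [g1 g2] := Lg; have [h1 h2] := Lh.
have E (p q r : X -> R) : p \in Lfun tm 2%:E -> q \in Lfun tm 2%:E -> r \in Lfun tm 2%:E ->
  \int[tm]_x ((p x + q x) * r x) = \int[tm]_x (p x * r x) + \int[tm]_x (q x * r x).
  move=> Lp Lq Lr; rewrite -RintegralD ?integrable_mulr2//.
  by apply: eq_Rintegral => x _; rewrite mulrDl.
have R1 x : Re (f x + g x) = Re (f x) + Re (g x) by case: (f x) (g x) => [? ?] [].
have I1 x : Im (f x + g x) = Im (f x) + Im (g x) by case: (f x) (g x) => [? ?] [].
have E1 (u : X -> R) : u \in Lfun tm 2%:E -> \int[tm]_x (Re (f x + g x) * u x) =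
    \int[tm]_x (Re (f x) * u x) + \int[tm]_x (Re (g x) * u x).
  by move=> Lu; rewrite -E//; apply: eq_Rintegral => x _; rewrite R1.
have E2 (u : X -> R) : u \in Lfun tm 2%:E -> \int[tm]_x (Im (f x + g x) * u x) =
    \int[tm]_x (Im (f x) * u x) + \int[tm]_x (Im (g x) * u x).
  by move=> Lu; rewrite -E//; apply: eq_Rintegral => x _; rewrite I1.
rewrite !E1// !E2//; apply/eqP; rewrite eq_complex/=; apply/andP; split; apply/eqP; ring.
Qed.

Lemma ipZ c f h : CL2 f -> CL2 h -> ip (fun x => c * f x) h = c * ip f h.
Proof.
move=> Lf Lh; rewrite !ipE//; last exact: CL2Z.
have [f1 f2] := Lf; have [h1 h2] := Lh.
have E (s t : R) (p q r : X -> R) : p \in Lfun tm 2%:E -> q \in Lfun tm 2%:E ->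
    r \in Lfun tm 2%:E ->
  \int[tm]_x ((s * p x + t * q x) * r x) =
  s * \int[tm]_x (p x * r x) + t * \int[tm]_x (q x * r x).
  move=> Lp Lq Lr; rewrite -!RintegralZl ?integrable_mulr2// -RintegralD//.
  - by apply: eq_Rintegral => x _; rewrite mulrDl !mulrA.
  - exact: (integrableZl measurableT s (integrable_mulr2 Lp Lr)).
  - exact: (integrableZl measurableT t (integrable_mulr2 Lq Lr)).
have E1 (u : X -> R) : u \in Lfun tm 2%:E -> \int[tm]_x (Re (c * f x) * u x) =
    Re c * \int[tm]_x (Re (f x) * u x) + (- Im c) * \int[tm]_x (Im (f x) * u x).
  move=> Lu; rewrite -E//; apply: eq_Rintegral => x _; congr (_ * _).
  by case: (c) (f x) => [? ?] [? ?] /=; ring.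
have E2 (u : X -> R) : u \in Lfun tm 2%:E -> \int[tm]_x (Im (c * f x) * u x) =
    Re c * \int[tm]_x (Im (f x) * u x) + Im c * \int[tm]_x (Re (f x) * u x).
  move=> Lu; rewrite -E//; apply: eq_Rintegral => x _; congr (_ * _).
  by case: (c) (f x) => [? ?] [? ?] /=; ring.
rewrite !E1// !E2//; clear E1 E2; case: c => p q /=.
by apply/eqP; rewrite eq_complex/=; apply/andP; split; apply/eqP; ring.
Qed.

Lemma ip_sum (I : Type) (s : seq I) (F : I -> X -> R[i]) h :
  (forall i, CL2 (F i)) -> CL2 h ->
  ip (fun x => \sum_(i <- s) F i x) h = \sum_(i <- s) ip (F i) h.
Proof.
move=> LF Lh; elim: s => [|i s IH].
  rewrite big_nil (_ : (fun x => _) = (fun x => 0 * h x)); last first.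
    by apply/funext => x; rewrite big_nil mul0r.
  by rewrite ipZ// mul0r.
rewrite big_cons -IH -ipD//; last exact: CL2_sum.
by congr ip; apply/funext => x; rewrite big_cons.
Qed.

End Complex_L2.

(** * Characters of the torus *)

Section Fubini_rectangle.
Local Open Scope ereal_scope.
Context d1 d2 (T1 : measurableType d1) (T2 : measurableType d2) (R : realType).
Context (m1 : {sigma_finite_measure set T1 -> \bar R})
  (m2 : {sigma_finite_measure set T2 -> \bar R}).

(** Products of the terms of the two exhausting sequences exhaust the product. *)
Lemma sigma_finite_prod : sigma_finite setT (m1 \x m2).
Proof.
have /sigma_finiteP[F [TF ndF Foo]] := sigma_finiteT m1.
have /sigma_finiteP[G [TG ndG Goo]] := sigma_finiteT m2.
exists (fun n => F n `*` G n).
  apply/esym; rewrite -subTset => -[x y] _.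
  have [[n _ Fx] [p _ Gy]] : (\bigcup_i F i) x /\ (\bigcup_i G i) y by rewrite -TF -TG.
  exists (maxn n p) => //; split => /=.
    by move: x Fx; exact/subsetPset/ndF/leq_maxl.
  by move: y Gy; exact/subsetPset/ndG/leq_maxr.
move=> n; have [mF Fn] := Foo n; have [mG Gn] := Goo n; split; first exact: measurableX.
by rewrite product_measure1E// lte_mul_pinfty// ge0_fin_numE.
Qed.

Lemma integral_setX (D1 : set T1) (D2 : set T2) (f : T1 * T2 -> \bar R) :
  measurable D1 -> measurable D2 -> (m1 \x m2).-integrable (D1 `*` D2) f ->
  \int[m1 \x m2]_(z in D1 `*` D2) f z =
  \int[m1]_(x in D1) \int[m2]_(y in D2) f (x, y).
Proof.
move=> mD1 mD2 If; have mD : measurable (D1 `*` D2) by exact: measurableX.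
have If' := (integrable_mkcond f mD).1 If.
rewrite integral_mkcond -integral12_prod_meas1//.
rewrite [RHS]integral_mkcond; apply: eq_integral => x _; rewrite /fubini_F /patch.
case: ifPn => xD1.
  rewrite [RHS]integral_mkcond; apply: eq_integral => y _; rewrite /patch.
  by rewrite in_setX xD1.
by rewrite integral0_eq// => y _; rewrite in_setX (negbTE xD1).
Qed.

End Fubini_rectangle.

Section Characters.
Context {R : realType}.
Local Notation tm := (@torus_measure R).
Local Notation X := (R * R * R)%type.
Local Notation Re := (@complex.Re R).
Local Notation Im := (@complex.Im R).
Local Notation lat := (int * int * int)%type.
Local Notation mu := (@lebesgue_measure R).
Local Notation period := (`[- pi, pi]%classic : set R).
Implicit Types (k l : lat) (x : X).

Definition phase k x : R :=
  k.1.1%:~R * x.1.1 + k.1.2%:~R * x.1.2 + k.2%:~R * x.2.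

Definition char k x : R[i] := (cos (phase k x) +i* sin (phase k x))%C.

Lemma phaseD k l x : phase (k + l) x = phase k x + phase l x.
Proof. by rewrite /phase/= !intrD; ring. Qed.

Lemma phaseN k x : phase (- k) x = - phase k x.
Proof. by rewrite /phase/= !mulrNz; ring. Qed.

Lemma phase0 x : phase 0 x = 0.
Proof. by rewrite /phase/= !mulr0z !mul0r !addr0. Qed.

Lemma charD k l x : char (k + l) x = char k x * char l x.
Proof.
by apply/eqP; rewrite /char phaseD cosD sinD eq_complex/=; apply/andP; split; apply/eqP; ring.
Qed.

Lemma char_conj k x : (char k x)^*%C = char (- k) x.
Proof. by rewrite /char phaseN cosN sinN. Qed.

Lemma char0 x : char 0 x = 1.
Proof. by rewrite /char phase0 cos0 sin0. Qed.

Lemma mod2_char k x : mod2 (char k x) = 1.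
Proof. by rewrite /mod2/= cos2Dsin2. Qed.

Lemma measurable_phase k : measurable_fun setT (phase k).
Proof.
have m11 : measurable_fun setT (fun x : X => x.1.1) by apply: measurableT_comp.
have m12 : measurable_fun setT (fun x : X => x.1.2) by apply: measurableT_comp.
have m2 : measurable_fun setT (fun x : X => x.2) by apply: measurable_snd.
by apply: measurable_funD; [apply: measurable_funD|]; apply: measurable_funM.
Qed.

Lemma measurable_cos_comp (h : X -> R) : measurable_fun setT h ->
  measurable_fun setT (fun x => cos (h x)).
Proof.
move=> mh; apply: (measurableT_comp _ mh).
by apply: continuous_measurable_fun; exact: continuous_cos.
Qed.

Lemma measurable_sin_comp (h : X -> R) : measurable_fun setT h ->
  measurable_fun setT (fun x => sin (h x)).
Proof.
move=> mh; apply: (measurableT_comp _ mh).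
by apply: continuous_measurable_fun; exact: continuous_sin.
Qed.

Lemma measurable_char k :
  measurable_fun setT (fun x => Re (char k x)) /\ measurable_fun setT (fun x => Im (char k x)).
Proof.
by split; [apply: measurable_cos_comp|apply: measurable_sin_comp]; exact: measurable_phase.
Qed.

Lemma CL2_char k : CL2 (char k).
Proof.
have [m1 m2] := measurable_char k.
by apply: (@CL2_bounded _ _ 1) => // x; rewrite mod2_char.
Qed.

Lemma sin_period_int (y : R) (n : int) : sin (y + n%:~R * (pi *+ 2)) = sin y.
Proof.
have E (z : R) (m : nat) : sin (z + m%:R * (pi *+ 2)) = sin z.
  by rewrite [m%:R * _]mulr_natl (periodicn (@sinD2pi R)).
case: n => n; first by rewrite -pmulrn E.
by rewrite NegzE mulrNz -pmulrn -[RHS](E _ n.+1) mulNr -[LHS](E _ n.+1) subrK E.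
Qed.

Lemma integral_cos_period (c : R) (n : int) :
  (\int[mu]_(z in period) (cos (c + n%:~R * z))%:E =
   ((n == 0)%:R * (2 * pi) * cos c)%:E)%E.
Proof.
have pi0 : - pi <= pi :> R by rewrite (le_trans _ (pi_ge0 R))// oppr_le0 pi_ge0.
have [->|n0] := eqVneq n 0.
  under eq_integral do rewrite mulr0z mul0r addr0.
  rewrite integral_cst//= lebesgue_measure_period -EFinM.
  by congr EFin; rewrite mul1r mulrC.
have nR : n%:~R != 0 :> R by rewrite intr_eq0.
have D (z : R) : is_derive z (1 : R) (fun z : R => n%:~R^-1 * sin (c + n%:~R * z))
    (cos (c + n%:~R * z)).
  derive_by_rules; rewrite /GRing.scale/= mulr1 add0r; field.
  by rewrite nR.
rewrite (integral_derive pi0 D).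
  rewrite !mul0r; congr EFin; rewrite -mulrBr; apply/eqP; rewrite mulf_eq0; apply/orP; right.
  have -> : c + n%:~R * pi = c + n%:~R * - pi + n%:~R * (pi *+ 2) by ring.
  by rewrite sin_period_int subrr.
by apply: (@is_derive_continuous _ _ (fun z => - (n%:~R * sin (c + n%:~R * z)))) => z;
  derive_by_rules; rewrite /GRing.scale/=; ring.
Qed.

Lemma measurable_period : measurable period.
Proof. exact: measurable_itv. Qed.

(** Iterated integrals over one period each, in the shape to which
    one-dimensional computations apply. *)
Lemma integral_torusE (f : X -> R) (C : R) : measurable_fun setT f ->
  (forall x, `|f x| <= C) ->
  (\int[tm]_x (f x)%:E = \int[mu \x mu]_(p in (period `*` period)%classic) \int[mu]_(z in period)
     (f (p, z))%:E)%E.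
Proof.
move=> mf fC.
have bf (A : set X) : [bounded f x | x in A].
  by exists C; split; [exact: num_real|move=> M CM x _ /=; exact: le_trans (fC x) (ltW CM)].
have itm : tm.-integrable setT (EFin \o f).
  exact: measurable_bounded_integrable measurableT torus_measure_fin mf (bf _).
have mC : @measurable _ (measurableTypeR R * measurableTypeR R * measurableTypeR R)%type
  (@cube R) by exact: measurable_cube.
have mNC : @measurable _ (measurableTypeR R * measurableTypeR R * measurableTypeR R)%type
  (~` (@cube R)) by exact: measurableC.
transitivity (\int[tm]_(x in @cube R) (f x)%:E)%E.
  rewrite (negligible_integral mNC measurableT itm); last by rewrite /torus_measure/= /mrestr setICl measure0.
  by rewrite setTD setCK.
transitivity (\int[(mu \x mu) \x mu]_(x in @cube R) (f x)%:E)%E.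
  apply: eq_measure_integral => A mA AC.
  by rewrite /torus_measure/= /mrestr setIidl.
have Ic : ((mu \x mu) \x mu)%E.-integrable (@cube R) (EFin \o f).
  apply: measurable_bounded_integrable => //.
    by apply: le_lt_trans (@torus_measure_fin R); rewrite /torus_measure /mrestr/= setTI.
  exact: measurable_funTS.
have mP : measurable (period : set (measurableTypeR R)) by exact: measurable_period.
have mPP : measurable ((period `*` period)%classic : set (measurableTypeR R * measurableTypeR R)%type).
  exact: measurableX.
pose m2 : {sigma_finite_measure set _ -> \bar R} := HB.pack (mu \x mu)%E
  (Measure_isSigmaFinite.Build _ _ _ (mu \x mu)%E (sigma_finite_prod mu mu)).
exact: (@integral_setX _ _ _ _ R m2 mu _ _ (EFin \o f) mPP mP Ic).
Qed.

(** The shift c lets one computation treat sine and cosine together: each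
    coordinate is absorbed into the shift while another one is integrated. *)
Lemma integral_cos_phase (c : R) k :
  (\int[tm]_x (cos (c + phase k x))%:E = ((k == 0)%:R * (2 * pi) ^+ 3 * cos c)%:E)%E.
Proof.
have mc : measurable_fun setT (fun x => cos (c + phase k x)).
  by apply: measurable_cos_comp; apply: measurable_funD => //; exact: measurable_phase.
rewrite (integral_torusE mc (fun x => cos_max _)).
case: k {mc} => [[a b] n].
under eq_integral => p _.
  under eq_integral => z _.
    have -> : c + phase (a, b, n) (p, z) = (c + (a%:~R * p.1 + b%:~R * p.2)) + n%:~R * z.
      by rewrite /phase/=; ring.
    over.
  rewrite integral_cos_period; over.
have mc : measurable_fun setT (fun p : R * R => cos (c + (a%:~R * p.1 + b%:~R * p.2))).
  apply: (measurableT_comp (continuous_measurable_fun (@continuous_cos R))).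
  apply: measurable_funD => //.
  by apply: measurable_funD; apply: measurable_funM.
have ic : (mu \x mu)%E.-integrable (period `*` period)%classic
    (fun p : R * R => (cos (c + (a%:~R * p.1 + b%:~R * p.2)))%:E).
  have mP : measurable (period : set (measurableTypeR R)) by exact: measurable_period.
  have mPP : measurable ((period `*` period)%classic : set (measurableTypeR R * measurableTypeR R)%type).
    exact: measurableX.
  apply: measurable_bounded_integrable => //.
  - have E2 : (mu \x mu)%E (period `*` period)%classic = (mu period * mu period)%E.
      exact: product_measure1E.
    have E := lebesgue_measure_period; rewrite E -EFinM in E2.
    by rewrite [X in (X < _)%E]E2 ltry.
  - exact: measurable_funTS.
  - by exists 1; split => // M M1 x _ /=; exact: le_trans (cos_max _) (ltW M1).
under eq_integral => p _ do rewrite EFinM.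
rewrite integralZl//; last by apply: measurableX; exact: measurable_period.
rewrite integral_setX//; try exact: measurable_period.
under eq_integral => x _.
  under eq_integral => y _.
    have -> : c + (a%:~R * (x, y).1 + b%:~R * (x, y).2) = (c + a%:~R * x) + b%:~R * y.
      by rewrite /=; ring.
    over.
  rewrite integral_cos_period EFinM; over.
rewrite integralZl; last 2 first.
- exact: measurable_period.
- apply: continuous_integrable_itv.
  apply: (@is_derive_continuous _ _ (fun z => - (a%:~R * sin (c + a%:~R * z)))) => z;
  derive_by_rules; rewrite /GRing.scale/=; ring.
rewrite integral_cos_period -!EFinM; congr EFin.
rewrite !xpair_eqE; case: (a == 0); case: (b == 0); case: (n == 0); rewrite /= ?mul0r ?mulr0 ?mul1r//.
by rewrite !exprS expr0; ring.
Qed.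

Lemma Cintegral_char k : Cintegral (char k) = ((k == 0)%:R * (2 * pi) ^+ 3)%:C%C.
Proof.
have EC : (\int[tm]_x (cos (phase k x))%:E = ((k == 0)%:R * (2 * pi) ^+ 3)%:E)%E.
  have := integral_cos_phase 0 k; rewrite cos0 mulr1 => <-.
  by apply: eq_integral => x _; rewrite add0r.
have ES : (\int[tm]_x (sin (phase k x))%:E = 0)%E.
  have := integral_cos_phase (- (pi / 2)) k; rewrite cosN cos_pihalf mulr0 => E0.
  by rewrite -[RHS]E0; apply: eq_integral => x _; rewrite addrC cosBpihalf.
by rewrite /Cintegral /Rintegral; apply/eqP; rewrite eq_complex/= EC ES !eqxx.
Qed.

Lemma ip_char k l : ip (char k) (char l) = ((k == l)%:R * (2 * pi) ^+ 3)%:C%C.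
Proof.
rewrite /ip -subr_eq0 -Cintegral_char; congr Cintegral.
by apply/funext => x; rewrite charD char_conj.
Qed.

End Characters.

(** * Density of the trigonometric polynomials *)

Section Trigonometric_closure.
Context {R : realType}.
Local Notation tm := (@torus_measure R).
Local Notation X := (R * R * R)%type.
Local Notation Re := (@complex.Re R).
Local Notation Im := (@complex.Im R).
Local Notation lat := (int * int * int)%type.
Implicit Types (f g h : X -> R[i]) (a b : X -> R) (c : R[i]) (s t : seq (lat * R[i])).

(** A list of pairs (frequency, coefficient), possibly with repetitions, so that
    sums and products are list operations. *)
Definition trigpoly s x : R[i] := \sum_(t <- s) t.2 * char t.1 x.

Lemma CL2_trigpoly s : CL2 (trigpoly s).
Proof. by apply: CL2_sum => t; apply: CL2Z; exact: CL2_char. Qed.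

Lemma CL2_measurable f : CL2 f ->
  measurable_fun setT (Re \o f) /\ measurable_fun setT (Im \o f).
Proof. by move=> [/Lfun2_measurable m1 /Lfun2_measurable m2]. Qed.

Lemma trigpoly_bounded s : exists C, forall x, mod2 (trigpoly s x) <= C.
Proof.
elim: s => [|t s [C IH]].
  by exists 0 => x; rewrite /trigpoly big_nil /mod2/= expr0n addr0.
exists (2 * mod2 t.2 + 2 * C) => x; rewrite /trigpoly big_cons.
apply: le_trans (mod2D_le _ _) _.
by rewrite mod2M mod2_char mulr1 lerD2l ler_wpM2l//; exact: IH.
Qed.

Lemma trigpoly_cat s t x : trigpoly (s ++ t) x = trigpoly s x + trigpoly t x.
Proof. by rewrite /trigpoly big_cat. Qed.

Lemma trigpolyM s t x :
  trigpoly [seq (p.1 + q.1, p.2 * q.2) | p <- s, q <- t] x = trigpoly s x * trigpoly t x.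
Proof.
rewrite /trigpoly big_allpairs_dep/= mulr_suml; apply: eq_bigr => p _.
by rewrite mulr_sumr; apply: eq_bigr => q _; rewrite charD; ring.
Qed.

(** The L^2 closure of the trigonometric polynomials. It is shown below to be all
    of L^2, by a monotone class argument. *)
Definition approx f :=
  CL2 f /\ forall e, 0 < e -> exists s, nrm2 (fun x => f x - trigpoly s x) <= e.

Lemma approx_trigpoly s : approx (trigpoly s).
Proof.
split=> [|e e0]; first exact: CL2_trigpoly.
exists s; rewrite (_ : (fun x => _) = (fun x => 0 * trigpoly s x)); last first.
  by apply/funext => x; rewrite subrr mul0r.
apply: le_trans (ltW e0); rewrite /nrm2 (_ : (fun x => _) = cst 0).
  by rewrite Rintegral_cst// mul0r.
by apply/funext => x; rewrite mul0r /mod2/= expr0n addr0.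
Qed.

Lemma approx_closure f : CL2 f ->
  (forall e, 0 < e -> exists2 g, approx g & nrm2 (fun x => f x - g x) <= e) ->
  approx f.
Proof.
move=> Lf H; split=> // e e0; have e4 : 0 < e / 4 by rewrite divr_gt0.
have [g [Lg /(_ _ e4)[s gs]] fg] := H _ e4; exists s.
rewrite (_ : (fun x => _) = (fun x => (f x - g x) + (g x - trigpoly s x))); last first.
  by apply/funext => x; rewrite addrA subrK.
apply: le_trans (nrm2D_le (CL2B Lf Lg) (CL2B Lg (CL2_trigpoly s))) _; lra.
Qed.

Lemma approxD f g : approx f -> approx g -> approx (fun x => f x + g x).
Proof.
move=> [Lf Hf] [Lg Hg]; split=> [|e e0]; first exact: CL2D.
have e4 : 0 < e / 4 by rewrite divr_gt0.
have [[s fs] [t gt]] := (Hf _ e4, Hg _ e4); exists (s ++ t).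
rewrite (_ : (fun x => _) =
  (fun x => (f x - trigpoly s x) + (g x - trigpoly t x))); last first.
  by apply/funext => x; rewrite trigpoly_cat; ring.
apply: le_trans (nrm2D_le (CL2B Lf (CL2_trigpoly s)) (CL2B Lg (CL2_trigpoly t))) _; lra.
Qed.

(** The bounded factor is approximated against a trigonometric polynomial, which
    is itself bounded; approximating both factors at once would need a uniform
    bound on the approximants. *)
Lemma approxM h f C : approx h -> approx f -> (forall x, mod2 (h x) <= C) ->
  approx (fun x => h x * f x).
Proof.
move=> [Lh Hh] [Lf Hf] hC.
have [m1 m2] := CL2_measurable Lh.
have C0 : 0 <= C by apply: le_trans (hC point); exact: mod2_ge0.
apply: approx_closure; first exact: CL2_bounded_mul Lf m1 m2 hC.
move=> e e0; have [|s fs] := Hf (e / (C + 1)); first by rewrite divr_gt0// ltr_wpDl.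
exists (fun x => h x * trigpoly s x).
  have [D sD] := trigpoly_bounded s.
  have D0 : 0 <= D by apply: le_trans (sD point); exact: mod2_ge0.
  have [n1 n2] := CL2_measurable (CL2_trigpoly s).
  apply: approx_closure; first exact: CL2_bounded_mul (CL2_trigpoly s) m1 m2 hC.
  move=> d d0; have [|t ht] := Hh (d / (D + 1)); first by rewrite divr_gt0// ltr_wpDl.
  exists (trigpoly [seq (p.1 + q.1, p.2 * q.2) | p <- s, q <- t]).
    exact: approx_trigpoly.
  rewrite (_ : (fun x => _) = (fun x => trigpoly s x * (h x - trigpoly t x))); last first.
    by apply/funext => x; rewrite trigpolyM; ring.
  apply: le_trans (nrm2_mul_le (CL2B Lh (CL2_trigpoly t)) n1 n2 sD) _.
  apply: le_trans (ler_wpM2l D0 ht) _; rewrite mulrCA ler_piMr ?(ltW d0)//.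
  by rewrite ler_pdivrMr ?ltr_wpDl// mul1r lerDl.
rewrite (_ : (fun x => _) = (fun x => h x * (f x - trigpoly s x))); last first.
  by apply/funext => x; rewrite mulrBr.
apply: le_trans (nrm2_mul_le (CL2B Lf (CL2_trigpoly s)) m1 m2 hC) _.
apply: le_trans (ler_wpM2l C0 fs) _; rewrite mulrCA ler_piMr ?(ltW e0)//.
by rewrite ler_pdivrMr ?ltr_wpDl// mul1r lerDl.
Qed.

Lemma approx_cst c : approx (fun=> c).
Proof.
rewrite (_ : (fun=> c) = trigpoly [:: (0, c)]); first exact: approx_trigpoly.
by apply/funext => x; rewrite /trigpoly big_seq1/= char0 mulr1.
Qed.

Lemma approxZ c f : approx f -> approx (fun x => c * f x).
Proof. by move=> Hf; apply: (approxM (C := mod2 c) (approx_cst c) Hf). Qed.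

(** Dominated convergence, applied to the squared distances. *)
Lemma approx_dominated (F : nat -> X -> R[i]) f (h : X -> R) : CL2 f ->
  (forall n, approx (F n)) -> tm.-integrable setT (EFin \o h) ->
  (forall n x, mod2 (f x - F n x) <= h x) ->
  (forall x, (fun n => mod2 (f x - F n x)) @ \oo --> (0 : R)) -> approx f.
Proof.
move=> Lf aF ih Fh Fcv; apply: approx_closure => // e e0.
have i2 n := integrable_mod2 (CL2B Lf (aF n).1).
have [_ _ cv] : [/\ tm.-integrable setT (cst 0%E : X -> \bar R),
  (fun n => \int[tm]_x `|(mod2 (f x - F n x))%:E - 0|)%E @ \oo --> 0%E &
  (fun n => \int[tm]_x (mod2 (f x - F n x))%:E)%E @ \oo --> (\int[tm]_x 0)%E].
  apply: (@dominated_convergence _ _ _ tm _ measurableT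
    (fun n x => (mod2 (f x - F n x))%:E) (cst 0%E) (EFin \o h)) => //.
  - by move=> n; have /integrableP[] := i2 n.
  - by apply: aeW => x _; apply/fine_cvgP; split; [near=> n|exact: Fcv].
  - apply: aeW => x n _ /=; rewrite lee_fin ger0_norm ?mod2_ge0//.
rewrite integral0 in cv.
have cv' : (fun n => nrm2 (fun x => f x - F n x)) @ \oo --> (0 : R).
  by have /fine_cvgP[] := cv.
have /cvgrPdist_le/(_ _ e0)[n _ /(_ n (leqnn n))] := cv'.
rewrite sub0r normrN ger0_norm ?nrm2_ge0// => fe.
by exists (F n).
Unshelve. all: by end_near. Qed.

End Trigonometric_closure.

Section Density.
Context {R : realType}.
Local Notation tm := (@torus_measure R).
Local Notation X := (R * R * R)%type.
Local Notation Re := (@complex.Re R).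
Local Notation Im := (@complex.Im R).
Implicit Types (f g h : X -> R[i]) (a b : X -> R) (E A B : set X).

Lemma Bernoulli_ge (z : R) N : 0 <= z <= 1 -> 1 - N%:R * z <= (1 - z) ^+ N.
Proof.
move=> /andP[z0 z1]; elim: N => [|N IH]; first by rewrite mul0r subr0 expr0.
rewrite exprS; apply: le_trans (ler_wpM2l _ IH); last by rewrite subr_ge0.
rewrite -subr_ge0 -natr1 (_ : _ - _ = N%:R * z ^+ 2); last ring.
by rewrite mulr_ge0 ?sqr_ge0.
Qed.

(** From (1 - z)(1 + z) <= 1 and the Bernoulli inequality for 1 + z. *)
Lemma Bernoulli_le (z : R) N : 0 <= z <= 1 -> (1 - z) ^+ N <= (1 + N%:R * z)^-1.
Proof.
move=> /andP[z0 z1]; have Nz : 0 < 1 + N%:R * z by rewrite ltr_wpDr// mulr_ge0.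
rewrite -[leRHS]mul1r ler_pdivlMr//.
have H : 1 + N%:R * z <= (1 + z) ^+ N.
  elim: N {Nz} => [|N IH]; first by rewrite mul0r addr0 expr0.
  rewrite exprS; apply: le_trans (ler_wpM2l _ IH); last by rewrite addr_ge0.
  rewrite -subr_ge0 -natr1 (_ : _ - _ = N%:R * z ^+ 2); last ring.
  by rewrite mulr_ge0 ?sqr_ge0.
apply: le_trans (ler_wpM2l _ H) _; first by rewrite exprn_ge0// subr_ge0.
by rewrite -exprMn exprn_ile1//; nra.
Qed.

(** With w = sqrt z, the Bernoulli inequality bounds n w^n by 1 / (1 - w), so
    that n z^n is at most a multiple of w^n. *)
Lemma cvg_natmul_geometric (z : R) : 0 <= z < 1 ->
  (fun n => n%:R * z ^+ n) @ \oo --> (0 : R).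
Proof.
move=> /andP[z0 z1]; have [->|zn0] := eqVneq z 0.
  by apply: cvg_near_cst; exists 1%N => // -[|n]// _; rewrite expr0n mulr0.
have zp : 0 < z by rewrite lt0r zn0.
pose w := Num.sqrt z.
have w0 : 0 < w by rewrite sqrtr_gt0.
have w2 : w ^+ 2 = z by rewrite sqr_sqrtr.
have w1 : w < 1 by rewrite -(ltr_pXn2r (n := 2)) ?nnegrE ?ltW// w2 expr1n.
pose d := 1 - w; have d0 : 0 < d by rewrite subr_gt0.
apply: (@squeeze_cvgr _ _ _ _ (cst 0) (fun n => d^-1 * w ^+ n)); first last.
- rewrite -[X in _ --> X](mulr0 d^-1); apply: cvgM; first exact: cvg_cst.
  apply: cvg_expr.
  by rewrite ger0_norm ?ltW.
- exact: cvg_cst.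
apply: nearW => n; rewrite mulr_ge0 ?exprn_ge0//=.
have -> : z ^+ n = w ^+ n * w ^+ n by rewrite -w2 -exprM mul2n -addnn exprD.
rewrite mulrA ler_wpM2r ?exprn_ge0 ?(ltW w0)//.
have nd : 0 <= n%:R * d by rewrite mulr_ge0// ltW.
have Nd : 0 < 1 + n%:R * d by rewrite ltr_pwDl.
have H : w ^+ n <= (1 + n%:R * d)^-1.
  rewrite (_ : w = 1 - d); last by rewrite /d; ring.
  by apply: Bernoulli_le; rewrite (ltW d0) /d lerBlDr lerDl ltW.
rewrite -[d^-1]mul1r ler_pdivlMr// mulrAC; apply: le_trans (ler_wpM2l nd H) _.
by rewrite ler_pdivrMr// mul1r lerDr.
Qed.

Definition ind E x : R[i] := (\1_E x : R)%:C%C.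

Lemma indE E x : ind E x = (x \in E)%:R%:C%C.
Proof. by rewrite /ind indicE. Qed.

Lemma mod2_real (r : R) : mod2 (r%:C)%C = r ^+ 2.
Proof. by rewrite /mod2/= expr0n addr0. Qed.

Lemma CL2_real_bounded a (C : R) : measurable_fun setT a -> (forall x, `|a x| <= C) ->
  CL2 (fun x => (a x)%:C%C).
Proof.
move=> ma aC; apply: (@CL2_bounded _ _ (C ^+ 2)) => [||x].
- exact: ma.
- exact: (@measurable_cst _ _ _ _ _ (0 : R)).
- rewrite mod2_real -real_normK ?num_real// lerXn2r ?nnegrE//.
  exact: le_trans (aC x).
Qed.

Lemma CL2_ind E : measurable E -> CL2 (ind E).
Proof.
move=> mE; apply: (@CL2_real_bounded _ 1); first exact: measurable_indic.
by move=> x; rewrite indicE; case: (_ \in _); rewrite ?normr0 ?normr1.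
Qed.

(** The indicator functions in the closure; these sets form a sigma-algebra
    because the bounded functions of the closure form an algebra that is closed
    under dominated limits. *)
Definition approx_set E := measurable E /\ approx (ind E).

Lemma approx_setC E : approx_set E -> approx_set (~` E).
Proof.
move=> [mE aE]; split; first exact: measurableC.
rewrite (_ : ind _ = (fun x => 1 + (-1) * ind E x)).
  by apply: approxD; [exact: approx_cst|exact: approxZ].
by apply/funext => x; rewrite !indE in_setC mulN1r; case: (_ \in _); rewrite /= ?subrr ?subr0.
Qed.

Lemma approx_setI E A : approx_set E -> approx_set A -> approx_set (E `&` A).
Proof.
move=> [mE aE] [mA aA]; split; first exact: measurableI.
rewrite (_ : ind _ = (fun x => ind E x * ind A x)).
  apply: (approxM (C := 1)) => // x; rewrite mod2_real indicE.
  by case: (_ \in _); rewrite ?expr0n ?expr1n.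
apply/funext => x; rewrite !indE in_setI.
by case: (_ \in _); case: (_ \in _); rewrite /= ?mul1r ?mul0r.
Qed.

Lemma approx_setU E A : approx_set E -> approx_set A -> approx_set (E `|` A).
Proof.
move=> aE aA; rewrite -[_ `|` _]setCK setCU.
by apply: approx_setC; apply: approx_setI; exact: approx_setC.
Qed.

Lemma sigma_algebra_approx : sigma_algebra setT approx_set.
Proof.
have a0 : approx_set set0.
  split=> //; rewrite (_ : ind _ = fun=> 0); first exact: approx_cst.
  by apply/funext => x; rewrite indE in_set0.
split=> [//|A aA|A aA]; first by rewrite setTD; exact: approx_setC.
have mA n : measurable (A n) by have [] := aA n.
have aU n : approx_set (\big[setU/set0]_(i < n) A i).
  elim: n => [|n IH]; first by rewrite big_ord0.
  by rewrite big_ord_recr; exact: approx_setU.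
split; first exact: bigcupT_measurable.
apply: (@approx_dominated _ (fun n => ind (\big[setU/set0]_(i < n) A i)) _ (cst 1)).
- by apply: CL2_ind; exact: bigcupT_measurable.
- by move=> n; have [] := aU n.
- apply: measurable_bounded_integrable => //; first exact: torus_measure_fin.
  by exists 1; split => // M M1 x _ /=; rewrite normr1 ltW.
- move=> n x; rewrite !indE -rmorphB mod2_real.
  by case: (_ \in _); case: (_ \in _); rewrite /= ?subrr ?subr0 ?sub0r ?sqrrN ?expr0n ?expr1n.
- move=> x; apply: cvg_near_cst.
  have [[n _ Ax]|nA] := pselect ((\bigcup_k A k) x).
    exists n.+1 => // p /= np; rewrite !indE -rmorphB mod2_real.
    rewrite !mem_set ?subrr ?expr0n//; last by exists n.
    by rewrite -bigcup_mkord; exists n.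
  apply: nearW => p; rewrite !indE -rmorphB mod2_real.
  rewrite !memNset ?subrr ?expr0n//.
  by rewrite -bigcup_mkord => -[i _ Ai]; apply: nA; exists i.
Qed.

Lemma approxX a n : approx (fun x => (a x)%:C%C) -> (forall x, `|a x| <= 1) ->
  approx (fun x => (a x ^+ n)%:C%C).
Proof.
move=> aa a1; elim: n => [|n IH]; first exact: (@approx_cst _ 1).
rewrite (_ : (fun x => _) = (fun x => (a x)%:C%C * (a x ^+ n)%:C%C)).
  apply: (approxM (C := 1)) => // x; rewrite mod2_real.
  by rewrite -real_normK ?num_real// expr_le1.
by apply/funext => x; rewrite -rmorphM exprS.
Qed.

(** The polynomials (1 - y^n)^(n 2^n) converge to 1 where y < 1/2 and to 0
    elsewhere, by the two Bernoulli bounds: n 2^n y^n = n (2 y)^n tends to 0 in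
    the first case and to infinity in the second, the boundary included. *)
Lemma approx_threshold (y : X -> R) : approx (fun x => (y x)%:C%C) ->
  (forall x, 0 <= y x <= 1) -> approx_set [set x | y x < 2^-1].
Proof.
move=> ay y01; have my : measurable_fun setT y by have [] := CL2_measurable ay.1.
have mE : measurable [set x | y x < 2^-1].
  have := my measurableT _ (@measurable_itv R `]-oo, 2^-1[); rewrite setTI.
  by rewrite (_ : _ @^-1` _ = [set x | y x < 2^-1])//; apply/seteqP; split=> x; rewrite /= in_itv.
have yn n x : 0 <= y x ^+ n <= 1.
  by have /andP[y0 y1] := y01 x; rewrite exprn_ge0// exprn_ile1.
have yN n x : 0 <= 1 - y x ^+ n <= 1 by have := yn n x; lra.
pose F n x := (1 - y x ^+ n) ^+ (n * 2 ^ n).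
have F01 n x : 0 <= F n x <= 1.
  by have /andP[? ?] := yN n x; rewrite exprn_ge0// exprn_ile1.
split=> //; apply: (@approx_dominated _ (fun n x => (F n x)%:C%C) _ (cst 1)).
- exact: CL2_ind.
- move=> n; apply: approxX; last by move=> x; have /andP[? ?] := yN n x; rewrite ger0_norm.
  rewrite (_ : (fun x => _) = (fun x => 1 + (-1) * (y x ^+ n)%:C%C)).
    apply: approxD; first exact: approx_cst.
    apply: approxZ; apply: approxX => // x.
    by have /andP[? ?] := y01 x; rewrite ger0_norm.
  by apply/funext => x; rewrite mulN1r rmorphB.
- apply: measurable_bounded_integrable => //; first exact: torus_measure_fin.
  by exists 1; split => // M M1 x _ /=; rewrite normr1 ltW.
- move=> n x; rewrite indE -rmorphB mod2_real /=; have := F01 n x.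
  by case: (_ \in _) => /=; nra.
- move=> x; have [yx|yx] := ltP (y x) 2^-1.
    apply: (@squeeze_cvgr _ _ _ _ (cst 0) (fun n => n%:R * (2 * y x) ^+ n)); first last.
    + by apply: cvg_natmul_geometric; have := y01 x; lra.
    + exact: cvg_cst.
    apply: nearW => n /=; rewrite mod2_ge0/= indE -rmorphB mod2_real mem_set//=.
    have := Bernoulli_ge (n * 2 ^ n) (yn n x); rewrite -/(F n x) natrM natrX -mulrA -exprMn.
    have := F01 n x; nra.
  apply: (@squeeze_cvgr _ _ _ _ (cst 0) (fun n => n.+1%:R^-1)); first last.
  + exact: cvg_harmonic.
  + exact: cvg_cst.
  apply: nearW => n /=; rewrite mod2_ge0/= indE -rmorphB mod2_real memNset//=; last first.
    by apply/negP; rewrite -leNgt.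
  have H := Bernoulli_le (n * 2 ^ n) (yn n x); rewrite -/(F n x) natrM natrX -mulrA -exprMn in H.
  have {}H : F n x <= n.+1%:R^-1.
    apply: le_trans H _; rewrite lef_pV2 ?posrE//; last first.
      by rewrite ltr_wpDr// mulr_ge0// exprn_ge0//; have := y01 x; lra.
    rewrite -natr1 addrC lerD2l ler_peMr// exprn_ege1//; lra.
  by rewrite ?sub0r ?add0r sqrrN; apply: le_trans H; have := F01 n x; nra.
Qed.

Lemma approx_ae f g (N : set X) : approx f -> CL2 g -> measurable N -> tm N = 0%E ->
  (forall x, ~ N x -> f x = g x) -> approx g.
Proof.
move=> af Lg mN N0 fg; apply: approx_closure => // e e0; exists f => //.
suff -> : nrm2 (fun x => g x - f x) = 0 by exact: ltW.
rewrite /nrm2 /Rintegral (@ae_eq_integral _ _ _ tm setT (cst 0%E)) ?integral0//.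
  by have /integrableP[] := integrable_mod2 (CL2B Lg af.1).
exists N; split=> // x /=; apply: contra_notP => nN _.
by rewrite fg// subrr mod2_real expr0n.
Qed.

End Density.

Import HBSimple HBNNSimple.

Section Density_of_trigonometric_polynomials.
Context {R : realType}.
Local Notation tm := (@torus_measure R).
Local Notation X := (R * R * R)%type.
Local Notation Y := (measurableTypeR R * measurableTypeR R * measurableTypeR R)%type.
Local Notation Re := (@complex.Re R).
Local Notation Im := (@complex.Im R).
Local Notation lat := (int * int * int)%type.
Local Notation mu := (@lebesgue_measure R).
Implicit Types (f g h : X -> R[i]) (a b : X -> R) (E A B : set X).

(** On the circle of length 2 pi cut at pi, the arc beyond r is the
    set of points closer than h to its midpoint c. *)
Lemma cos_arc (t r : R) : - pi <= t < pi -> - pi <= r < pi ->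
  (r < t) = (cos ((pi - r) / 2) < cos (t - (r + pi) / 2)).
Proof.
move=> /andP[t1 t2] /andP[r1 r2].
set h := (pi - r) / 2; set c := (r + pi) / 2; have p0 := pi_gt0 R.
have h0 : 0 <= h <= pi by rewrite /h; lra.
have [rt|tr] := ltP r t.
  have -> : cos (t - c) = cos `|t - c|.
    by case: (ltP 0 (t - c)) => H; [rewrite gtr0_norm|rewrite ler0_norm// cosN].
  apply/esym; rewrite ltr_cos ?in_itv/= ?h0 ?normr_ge0//=.
  - by rewrite ltr_norml /h /c; lra.
  - by rewrite ler_norml /c; lra.
apply/esym/negbTE; rewrite -leNgt.
have [s1|s1] := leP (c - t) pi.
  rewrite -cosN opprB leNgt ltr_cos ?in_itv/= ?h0// -?leNgt.
    by rewrite /h /c; lra.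
  by rewrite s1 andbT /c; lra.
have -> : cos (t - c) = cos (t - c + pi *+ 2) by rewrite cosD2pi.
rewrite leNgt ltr_cos ?in_itv/= ?h0// -?leNgt; first by rewrite /h /c; lra.
by rewrite /c in s1 *; lra.
Qed.

(** A ray is not invariant under translation by a period, but on the torus it
    agrees almost everywhere with an arc, that is a set on which a shifted
    cosine exceeds a constant. Outside of [-pi, pi) it is full or null. *)
Lemma approx_ray (p : X -> R) (k : lat) (r : R) : measurable_fun setT p ->
  phase k =1 p -> tm [set x | ~~ (- pi <= p x < pi)] = 0%E ->
  approx_set [set x | r < p x].
Proof.
move=> mp kp N0.
have mN : measurable [set x | ~~ (- pi <= p x < pi)].
  rewrite (_ : [set x | _] = ~` (p @^-1` `[- pi, pi[%classic)).
    by apply: measurableC; rewrite -[_ @^-1` _]setTI; apply: mp.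
  by apply/seteqP; split=> x; rewrite /= in_itv => /negP.
have mE : measurable [set x | r < p x].
  rewrite (_ : [set x | _] = p @^-1` `]r, +oo[%classic).
    by rewrite -[_ @^-1` _]setTI; apply: mp.
  by apply/seteqP; split=> x; rewrite /= in_itv/= andbT.
split=> //; have [r1|r1] := ltP r (- pi).
  apply: (approx_ae (approx_cst 1) (CL2_ind mE) mN N0) => x /negP.
  by rewrite negbK => /andP[p1 _]; rewrite indE mem_set//=; exact: lt_le_trans p1.
have [r2|r2] := leP pi r.
  apply: (approx_ae (approx_cst 0) (CL2_ind mE) mN N0) => x /negP.
  rewrite negbK => /andP[_ p2]; rewrite indE memNset//=; apply/negP.
  by rewrite -leNgt ltW// (lt_le_trans p2).
set c := (r + pi) / 2; set h := (pi - r) / 2.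
(* The affine image of the cosine in [0, 1] for which the arc is {y < 1/2}. *)
pose y x := 2^-1 + (cos h - cos (p x - c)) / 4.
have y01 x : 0 <= y x <= 1.
  rewrite /y; have := cos_le1 h; have := cos_geN1 h.
  by have := cos_le1 (p x - c); have := cos_geN1 (p x - c); lra.
have ay : approx (fun x => (y x)%:C%C).
  (* Half of the factor 1/4: the cosine is the half sum of two characters. *)
  pose w : R := 8^-1.
  rewrite (_ : (fun x => _) = trigpoly
    [:: (0, (2^-1 + cos h / 4)%:C%C); (k, (- (w * cos c) +i* (w * sin c))%C);
        (- k, (- (w * cos c) +i* - (w * sin c))%C)]); first exact: approx_trigpoly.
  apply/funext => x; rewrite /trigpoly !big_cons big_nil/= char0 mulr1 -char_conj addr0.
  rewrite /char kp /y cosB /w; apply/eqP; rewrite eq_complex/=; apply/andP; split; apply/eqP.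
    by field.
  by ring.
have [_ aE] := approx_threshold ay y01.
apply: (approx_ae aE (CL2_ind mE) mN N0) => x /negP; rewrite negbK => px.
rewrite !indE; congr ((nat_of_bool _)%:R%:C%C); apply/idP/idP; rewrite !inE /=.
  by rewrite (cos_arc px) ?r1// -/h -/c /y; lra.
by rewrite (cos_arc px) ?r1// -/h -/c /y; lra.
Qed.

Lemma torus_null (N M : set X) : measurable (N : set Y) -> measurable (M : set Y) ->
  (forall x, cube x -> N x -> M x) -> ((mu \x mu) \x mu)%E M = 0%E -> tm N = 0%E.
Proof.
move=> mN mM NM M0; apply/eqP; rewrite eq_le measure_ge0 andbT -M0.
rewrite /torus_measure /mrestr/=; apply: le_measure; rewrite ?inE//.
- by apply: measurableI => //; exact: measurable_cube.
- by move=> x [Nx cx]; exact: NM.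
Qed.

Lemma coordinate_null (p : X -> R) : measurable_fun setT p ->
  (forall x, cube x -> - pi <= p x <= pi) ->
  ((mu \x mu) \x mu)%E [set x | p x = pi] = 0%E ->
  tm [set x | ~~ (- pi <= p x < pi)] = 0%E.
Proof.
move=> mp cp; apply: torus_null => [||x cx].
- rewrite (_ : [set x | _] = ~` (p @^-1` `[- pi, pi[%classic)).
    by apply: measurableC; rewrite -[_ @^-1` _]setTI; apply: mp.
  by apply/seteqP; split=> x; rewrite /= in_itv => /negP.
- by rewrite -[X in measurable X]setTI; apply: (mp measurableT [set pi]).
- by have := cp x cx; rewrite /= => /andP[-> p2]; rewrite -leNgt /= => p3; apply/eqP; rewrite eq_le p2.
Qed.

Lemma measurable_coordinates :
  [/\ measurable_fun setT (fun x : X => x.1.1), measurable_fun setT (fun x : X => x.1.2) &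
      measurable_fun setT (fun x : X => x.2)].
Proof.
by split; [apply: measurableT_comp|apply: measurableT_comp|exact: measurable_snd].
Qed.

Lemma face_null (A B C : set (measurableTypeR R)) :
  measurable A -> measurable B -> measurable C ->
  mu A = 0%E \/ mu B = 0%E \/ mu C = 0%E ->
  ((mu \x mu) \x mu)%E ((A `*` B) `*` C) = 0%E.
Proof.
move=> mA mB mC H; rewrite product_measure1E//=; last exact: measurableX.
rewrite product_measure1E//=.
by case: H => [->|[->|->]]; rewrite ?(mul0e, mule0).
Qed.

Lemma approx_coordinate (i : 'I_3) (r : R) :
  approx_set [set x : X | r < nth 0 [:: x.1.1; x.1.2; x.2] i].
Proof.
have [m1 m2 m3] := measurable_coordinates.
have mpi : measurable ([set pi] : set (measurableTypeR R)) by exact: measurable_set1.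
have z : mu [set pi] = 0%E by exact: lebesgue_measure_set1.
case: i => [[|[|[|//]]] /= _].
- apply: (approx_ray (k := (1, 0, 0))) => // [x|].
    by rewrite /phase/= mul1r !mul0r !addr0.
  apply: coordinate_null => // [x [[]]/=|]; first by rewrite in_itv.
  rewrite (_ : [set x | _] = ([set pi] `*` setT) `*` setT).
    by apply: face_null => //; left.
  by apply/seteqP; split=> -[[u v] w] /=; tauto.
- apply: (approx_ray (k := (0, 1, 0))) => // [x|].
    by rewrite /phase/= mul1r !mul0r add0r addr0.
  apply: coordinate_null => // [x [[]]/=|]; first by rewrite !in_itv.
  rewrite (_ : [set x | _] = (setT `*` [set pi]) `*` setT).
    by apply: face_null => //; right; left.
  by apply/seteqP; split=> -[[u v] w] /=; tauto.
- apply: (approx_ray (k := (0, 0, 1))) => // [x|].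
    by rewrite /phase/= mul1r !mul0r !add0r.
  apply: coordinate_null => // [x [[]]/=|]; first by rewrite !in_itv.
  rewrite (_ : [set x | _] = (setT `*` setT) `*` [set pi]).
    by apply: face_null => //; right; right.
  by apply/seteqP; split=> -[[u v] w] /=; tauto.
Qed.

(** The rays generate the Borel sets of each coordinate, and the boxes generate
    the product sigma-algebras. *)
Lemma approx_measurable E : measurable (E : set Y) -> approx_set E.
Proof.
have SG := @sigma_algebra_approx R.
have coord (i : 'I_3) (B : set R) : measurable (B : set (measurableTypeR R)) ->
    approx_set [set x : X | B (nth 0 [:: x.1.1; x.1.2; x.2] i)].
  pose S := image_set_system setT (fun x : X => nth 0 [:: x.1.1; x.1.2; x.2] i) approx_set.
  have SS : sigma_algebra setT S by exact: sigma_algebra_image.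
  have sub : RGenOInfty.G (R := R) `<=` S.
    move=> _ [r ->]; rewrite /S /image_set_system /= setTI.
    rewrite (_ : _ @^-1` _ = [set x : X | r < nth 0 [:: x.1.1; x.1.2; x.2] i]).
      exact: approx_coordinate.
    by apply/seteqP; split=> x; rewrite /= in_itv/= andbT.
  move=> mB; have mB' : (RGenOInfty.G (R := R)).-sigma.-measurable B.
    by rewrite -RGenOInfty.measurableE.
  have := smallest_sub SS sub mB'.
  by rewrite /S /image_set_system/= setTI.
have base (B : set (measurableTypeR R * measurableTypeR R)%type) : measurable B ->
    approx_set [set x : X | B x.1].
  pose S := image_set_system setT (fun x : X => x.1) approx_set.
  have SS : sigma_algebra setT S by exact: sigma_algebra_image.
  rewrite measurable_prod_measurableType => mB.
  suff sub : [set A `*` B | A in measurable & B in measurable] `<=` S.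
    have := smallest_sub SS sub mB.
    by rewrite /S /image_set_system/= setTI.
  move=> _ [A mA [D mD <-]]; rewrite /S /image_set_system/= setTI.
  have := approx_setI (@coord ord0 A mA) (@coord (lift ord0 ord0) D mD).
  by [].
rewrite measurable_prod_measurableType => mE.
apply: (smallest_sub SG _ mE).
move=> _ [A mA [D mD <-]].
exact: (approx_setI (@base A mA) (@coord ord_max D mD)).
Qed.

Lemma CL2_real a : a \in Lfun tm 2%:E -> CL2 (fun x => (a x)%:C%C).
Proof. by move=> La; split=> //=; have [] := @CL2_cst R 0. Qed.

(** Simple functions increase to a, and a^2 dominates the squared errors. *)
Lemma approx_nonneg a : a \in Lfun tm 2%:E -> (forall x, 0 <= a x) ->
  approx (fun x => (a x)%:C%C).
Proof.
move=> La a0; have ma := Lfun2_measurable La.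
have mEa : measurable_fun (setT : set Y) (EFin \o a) by exact/measurable_EFinP.
pose s n := nnsfun_approx (@measurableT _ Y) mEa n.
have scv x : (fun n => s n x) @ \oo --> a x.
  have H0 (y : Y) : setT y -> (0 <= (EFin \o a) y)%E by move=> _; rewrite lee_fin.
  by have /fine_cvgP[] := @cvg_nnsfun_approx _ _ _ _ (@measurableT _ Y) _ mEa H0 x I.
have sle n x : s n x <= a x.
  have := @nd_nnsfun_approx _ _ _ _ (@measurableT _ Y) _ mEa => nd.
  rewrite -(cvg_lim (@Rhausdorff R) (scv x)); apply: nondecreasing_cvgn_le.
    by move=> i j ij; have /lefP := nd _ _ ij; exact.
  by apply/cvg_ex; exists (a x).
apply: (@approx_dominated _ (fun n x => (s n x)%:C%C) _ (fun x => a x ^+ 2)).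
- exact: CL2_real.
- move=> n.
  rewrite (_ : (fun x => _) = (fun x => (\sum_(y \in range (s n)) y * \1_(s n @^-1` [set y]) x)%:C%C)).
    rewrite (_ : (fun x => _) = (fun x => \sum_(y <- finmap.enum_fset (fset_set (range (s n))))
       y%:C%C * ind (s n @^-1` [set y]) x)).
      elim: (finmap.enum_fset _) => [|y l IH].
        rewrite (_ : (fun x => _) = fun=> 0); first exact: approx_cst.
        by apply/funext => x; rewrite big_nil.
      rewrite (_ : (fun x => _) = (fun x => y%:C%C * ind (s n @^-1` [set y]) x +
        \sum_(j <- l) j%:C%C * ind (s n @^-1` [set j]) x)).
        apply: approxD => //; apply: approxZ.
        by apply: (approx_measurable _).2; exact: measurable_sfunP.
      by apply/funext => x; rewrite big_cons.
    apply/funext => x; rewrite fsbig_finite//= rmorph_sum; apply: eq_bigr => y _.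
    by rewrite rmorphM.
  by apply/funext => x; rewrite fimfunE.
- exact: Lfun2_integrable_sqr La.
- move=> n x; rewrite -rmorphB mod2_real lerXn2r ?nnegrE ?subr_ge0//.
  by rewrite gerBl.
- move=> x; rewrite (_ : (fun n => mod2 _) = (fun n => (a x - s n x) * (a x - s n x))).
    rewrite (_ : 0 = (a x - a x) * (a x - a x)); last by rewrite subrr mulr0.
    by apply: cvgM; (apply: cvgB; [exact: cvg_cst|exact: scv]).
  by apply/funext => n; rewrite -rmorphB mod2_real expr2.
Qed.

Lemma approx_CL2 f : CL2 f -> approx f.
Proof.
move=> [f1 f2].
have R1 a : a \in Lfun tm 2%:E -> approx (fun x => (a x)%:C%C).
  move=> La; have La' : (fun x => `|a x|) \in Lfun tm 2%:E.
    apply: Lfun2E; first by apply: measurableT_comp => //; exact: Lfun2_measurable.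
    have := Lfun2_integrable_sqr La; apply: eq_integrable => // x _ /=.
    by rewrite real_normK ?num_real.
  rewrite (_ : (fun x => _) = (fun x => ((a x + `|a x|))%:C%C + (-1) * (`|a x|)%:C%C)).
    apply: approxD; last by apply: approxZ; apply: approx_nonneg.
    apply: approx_nonneg; first exact: Lfun2D.
    by move=> x; have := lerNnormlW (lexx `|a x|); lra.
  by apply/funext => x; rewrite mulN1r -rmorphB addrK.
rewrite (_ : f = (fun x => (Re (f x))%:C%C + 'i%C * (Im (f x))%:C%C)).
  by apply: approxD; [exact: R1|apply: approxZ; exact: R1].
apply/funext => x; case: (f x) => p q; apply/eqP; rewrite eq_complex/=.
by apply/andP; split; apply/eqP; ring.
Qed.

End Density_of_trigonometric_polynomials.

(** * Fourier coefficients *)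

Section Fourier_coefficients.
Context {R : realType}.
Local Notation tm := (@torus_measure R).
Local Notation X := (R * R * R)%type.
Local Notation Re := (@complex.Re R).
Local Notation Im := (@complex.Im R).
Local Notation lat := (int * int * int)%type.
Implicit Types (f g h : X -> R[i]) (c d : lat -> R[i]) (F : seq lat) (k l : lat).

Definition vol : R := (2 * pi) ^+ 3.

Lemma vol_gt0 : 0 < vol.
Proof. by rewrite exprn_gt0// mulr_gt0// pi_gt0. Qed.

(** Not normalised: the Fourier coefficient is obtained on division by [vol]. *)
Definition coef f k : R[i] := ip f (char k).
(* Simplification would otherwise unfold the integrals inside. *)
Arguments coef : simpl never.

Lemma ipDr f g h : CL2 f -> CL2 g -> CL2 h ->
  ip h (fun x => f x + g x) = ip h f + ip h g.
Proof.
move=> Lf Lg Lh; rewrite (ip_conj (CL2D Lf Lg) Lh) ipD//.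
by rewrite (ip_conj Lf Lh) (ip_conj Lg Lh) rmorphD.
Qed.

Lemma ipZr z f h : CL2 f -> CL2 h ->
  ip h (fun x => z * f x) = (z^*)%C * ip h f.
Proof.
move=> Lf Lh; rewrite (ip_conj (CL2Z z Lf) Lh) ipZ//.
by rewrite (ip_conj Lf Lh) rmorphM.
Qed.

Definition fsum c F := trigpoly [seq (k, c k) | k <- F].

Lemma CL2_fsum c F : CL2 (fsum c F). Proof. exact: CL2_trigpoly. Qed.

Lemma fsumE c F x : fsum c F x = \sum_(k <- F) c k * char k x.
Proof. by rewrite /fsum /trigpoly big_map. Qed.

Lemma ip_fsum f c F : CL2 f -> ip (fsum c F) f = \sum_(k <- F) c k * (coef f k)^*%C.
Proof.
move=> Lf; rewrite (_ : fsum c F = (fun x => \sum_(k <- F) c k * char k x)).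
  rewrite ip_sum//; last by move=> k; apply: CL2Z; exact: CL2_char.
  apply: eq_bigr => k _; rewrite ipZ//; last exact: CL2_char.
  by rewrite (ip_conj Lf (CL2_char _)).
by apply/funext => x; exact: fsumE.
Qed.

Lemma coef_fsum c F k : uniq F -> k \in F -> coef (fsum c F) k = c k * vol%:C%C.
Proof.
move=> uF kF; rewrite /coef ip_fsum; last exact: CL2_char.
rewrite (bigD1_seq k kF uF) big1; [apply: (etrans (addr0 _))|].
  by rewrite /coef ip_char eqxx mul1r; congr (_ * _); exact: conjc_real.
by move=> l /negbTE lk; rewrite /coef ip_char eq_sym lk mul0r conjc_real mulr0.
Qed.

Lemma Re_sum (I : Type) (s : seq I) (G : I -> R[i]) :
  Re (\sum_(i <- s) G i) = \sum_(i <- s) Re (G i).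
Proof. by elim: s => [|i s IH]; rewrite ?big_nil// !big_cons -IH; case: (G i) (\sum_(j <- s) G j) => [? ?] []. Qed.

Lemma nrm2B f g : CL2 f -> CL2 g ->
  nrm2 (fun x => f x - g x) = nrm2 f - 2 * Re (ip g f) + nrm2 g.
Proof.
move=> Lf Lg; have H : ip (fun x => f x + (-1) * g x) (fun x => f x + (-1) * g x) =
    ip f f - ip g f - ip f g + ip g g.
  have Lg' : CL2 (fun x => (-1) * g x) by exact: CL2Z.
  rewrite ipD// ?ipDr// ?ipZ// ?ipZr//; try by [exact: CL2D|exact: CL2Z].
  by rewrite rmorphN rmorph1; ring.
rewrite (ip_conj Lg Lf) in H; move: H; rewrite !ip_nrm2.
rewrite (_ : nrm2 (fun x => f x - g x) = nrm2 (fun x => f x + (-1) * g x)); last first.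
  by congr nrm2; apply/funext => x; rewrite mulN1r.
by case: (ip g f) => p q [-> _] /=; ring.
Qed.

Lemma nrm2_fsum c F : uniq F -> nrm2 (fsum c F) = vol * \sum_(k <- F) mod2 (c k).
Proof.
move=> uF; rewrite -[LHS]/(Re (nrm2 (fsum c F))%:C%C) -ip_nrm2 ip_fsum; last exact: CL2_fsum.
rewrite Re_sum.
rewrite mulr_sumr big_seq [RHS]big_seq; apply: eq_bigr => k kF.
by rewrite coef_fsum//; case: (c k) => p q; rewrite /mod2/=; ring.
Qed.

Definition psum f F := fsum (fun k => coef f k / vol%:C%C) F.

(** Completion of the square. It shows that among the sums over F the partial
    Fourier sum is the closest to f. *)
Lemma nrm2B_fsum f c F : CL2 f -> uniq F -> nrm2 (fun x => f x - fsum c F x) =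
  nrm2 f - (\sum_(k <- F) mod2 (coef f k)) / vol
  + vol * \sum_(k <- F) mod2 (c k - coef f k / vol%:C%C).
Proof.
move=> Lf uF; rewrite nrm2B//; last exact: CL2_fsum.
rewrite ip_fsum// nrm2_fsum// Re_sum; move: (coef f) => w; rewrite -!addrA; congr (_ + _).
rewrite mulr_suml !mulr_sumr -!sumrN -!big_split/=; apply: eq_bigr => k _.
have v0 : vol != 0 by rewrite gt_eqF// vol_gt0.
rewrite -(fmorphV (real_complex R)).
case: (c k) (w k) => p q [r s]; rewrite /mod2/=; move: vol v0 => v v0; field.
by [].
Qed.

Lemma nrm2B_psum f F : CL2 f -> uniq F ->
  nrm2 (fun x => f x - psum f F x) = nrm2 f - (\sum_(k <- F) mod2 (coef f k)) / vol.
Proof.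
move=> Lf uF; rewrite nrm2B_fsum// [X in _ + _ * X]big1 ?mulr0 ?addr0// => k _.
by rewrite subrr /mod2/= expr0n addr0.
Qed.

Lemma Bessel f F : CL2 f -> uniq F -> \sum_(k <- F) mod2 (coef f k) <= vol * nrm2 f.
Proof.
move=> Lf uF; have := nrm2_ge0 (fun x => f x - psum f F x).
by rewrite nrm2B_psum// subr_ge0 ler_pdivrMr ?vol_gt0// mulrC.
Qed.

Lemma trigpoly_collect (s : seq (lat * R[i])) :
  trigpoly s = fsum (fun k => \sum_(t <- s | t.1 == k) t.2) (undup (map fst s)).
Proof.
apply/funext => x; rewrite fsumE /trigpoly.
rewrite (eq_bigr (fun k => \sum_(t <- s | t.1 == k) t.2 * char t.1 x)); last first.
  by move=> k _; rewrite mulr_suml; apply: eq_bigr => t /eqP ->.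
rewrite (exchange_big_dep xpredT)//= [LHS]big_seq [RHS]big_seq; apply: eq_bigr => t ts.
rewrite -big_filter (eq_filter (a2 := pred1 t.1)); last by move=> k /=; rewrite eq_sym.
by rewrite filter_pred1_uniq ?undup_uniq ?mem_undup ?map_f// big_seq1.
Qed.

(** A trigonometric polynomial close to f exists by density, and the partial
    Fourier sum on its frequencies is at least as close. *)
Lemma Parseval f e : CL2 f -> 0 < e ->
  exists2 F, uniq F & nrm2 (fun x => f x - psum f F x) <= e.
Proof.
move=> Lf e0; have [_ /(_ _ e0)[s fs]] := approx_CL2 Lf.
exists (undup (map fst s)); first exact: undup_uniq.
apply: le_trans fs; rewrite trigpoly_collect nrm2B_psum ?undup_uniq//.
rewrite nrm2B_fsum ?undup_uniq// lerDl mulr_ge0 ?(ltW vol_gt0)//.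
by apply: sumr_ge0 => k _; exact: mod2_ge0.
Qed.

Lemma cmodE (z : R[i]) : `|z| = (cmod z)%:C%C.
Proof. by rewrite normc_def. Qed.

Lemma cmod_ge0 (z : R[i]) : 0 <= cmod z. Proof. exact: sqrtr_ge0. Qed.

Lemma cmodD (z w : R[i]) : cmod (z + w) <= cmod z + cmod w.
Proof. by have := ler_normD z w; rewrite !cmodE -rmorphD/= lecR. Qed.

Lemma cmodM (z w : R[i]) : cmod (z * w) = cmod z * cmod w.
Proof. by rewrite /cmod -sqrtrM ?mod2_ge0//; congr Num.sqrt; exact: mod2M. Qed.

Lemma cmod2 (z : R[i]) : cmod z ^+ 2 = mod2 z.
Proof. by rewrite sqr_sqrtr// mod2_ge0. Qed.

Lemma cmod_char k (x : X) : cmod (char k x) = 1 :> R.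
Proof. by rewrite /cmod -/(mod2 _) mod2_char sqrtr1. Qed.

Lemma cmod_fsum_le c F x : cmod (fsum c F x) <= \sum_(k <- F) cmod (c k).
Proof.
rewrite fsumE; elim: F => [|k F IH].
  by rewrite !big_nil /cmod/= expr0n addr0 sqrtr0.
rewrite !big_cons; apply: le_trans (cmodD _ _) _.
by rewrite cmodM cmod_char mulr1 lerD2l.
Qed.

Lemma measurable_cmod f : CL2 f -> measurable_fun setT (fun x => cmod (f x)).
Proof.
move=> /CL2_measurable[m1 m2]; apply: measurableT_comp.
  by apply: continuous_measurable_fun; exact: sqrt_continuous.
by apply: measurable_funD; apply: measurable_funX.
Qed.

(** The partial Fourier sums have modulus at most M everywhere, so the L^2 norm
    of the excess of |f| over M is at most the distance from f to each of them,
    hence zero. *)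
Lemma ae_le_of_psum f M : CL2 f ->
  (forall F, uniq F -> \sum_(k <- F) cmod (coef f k / vol%:C%C) <= M) ->
  {ae tm, forall x, cmod (f x) <= M}.
Proof.
move=> Lf FM; have M0 : 0 <= M by have := FM [::] isT; rewrite big_nil.
pose w x := Num.max (cmod (f x) - M) 0.
have w0 x : 0 <= w x by rewrite le_max lexx orbT.
have mw : measurable_fun setT w.
  apply: measurable_maxr => //.
  by apply: measurable_funB => //; exact: measurable_cmod.
have mw2 : measurable_fun setT (fun x => w x ^+ 2) by exact: measurable_funX.
have wle F x : uniq F -> w x ^+ 2 <= mod2 (f x - psum f F x).
  move=> uF; rewrite -cmod2 lerXn2r ?nnegrE ?cmod_ge0//.
  rewrite ge_max cmod_ge0 andbT lerBlDr.
  rewrite -[X in cmod X](subrK (psum f F x)); apply: le_trans (cmodD _ _) _.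
  by rewrite lerD2l; apply: le_trans (cmod_fsum_le _ _ _) (FM _ uF).
have iw : (\int[tm]_x (w x ^+ 2)%:E = 0)%E.
  apply/eqP; rewrite eq_le integral_ge0 ?andbT; last by move=> x _; rewrite lee_fin sqr_ge0.
  apply/lee_addgt0Pr => e e0; rewrite add0e.
  have [F uF fF] := Parseval Lf e0.
  apply: (@le_trans _ _ (nrm2 (fun x => f x - psum f F x))%:E); last by rewrite lee_fin.
  have i := integrable_mod2 (CL2B Lf (CL2_fsum _ _ : CL2 (psum f F))).
  rewrite /nrm2 /Rintegral fineK; last exact: integrable_fin_num i.
  apply: ge0_le_integral => //.
  - by move=> x _; rewrite lee_fin sqr_ge0.
  - exact/measurable_EFinP.
  - by have /integrableP[] := i.
  - by move=> x _; rewrite lee_fin wle.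
have mE : measurable_fun setT (fun x => (w x ^+ 2)%:E) by exact/measurable_EFinP.
have [+ _] := @ae_eq_integral_abs _ _ _ tm setT measurableT _ mE.
rewrite (@eq_integral _ _ _ tm setT (fun x => (w x ^+ 2)%:E)); last first.
  by move=> x _; rewrite abse_EFin ger0_norm ?sqr_ge0.
move=> /(_ iw); apply: filterS => x /(_ I) /= [] /eqP.
rewrite expf_eq0/= => /eqP wx; rewrite -subr_le0 -wx.
by rewrite /w le_max lexx.
Qed.

End Fourier_coefficients.

(** * Weak derivatives *)

Section Weak_derivatives.
Context {R : realType}.
Local Notation X := (R * R * R)%type.
Local Notation Re := (@complex.Re R).
Local Notation Im := (@complex.Im R).
Local Notation lat := (int * int * int)%type.
Implicit Types (u g : X -> R[i]) (k : lat) (i : 'I_3) (x : X).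

(** Real test functions for the frequency k; this space is stable under partial
    derivatives, which gives smoothness at once. *)
Definition wave k (p q : R) x : R := p * cos (phase k x) + q * sin (phase k x).

Definition freq k i : R := phase k (basis3 i).

(** The phase is linear: both periodicity and directional derivatives of waves
    are read off from its values on the basis vectors. *)
Lemma phase_shift k x (t : R) (v : X) : phase k (x + t *: v) = phase k x + t * phase k v.
Proof. by rewrite /phase/= /GRing.scale/=; ring. Qed.

Lemma differentiable_phase k x : differentiable (phase k) x.
Proof.
have d1 (y : R * R) : differentiable (fst : R * R -> R) y.
  by apply: linear_differentiable => z; exact: cvg_fst.
have d2 (y : R * R) : differentiable (snd : R * R -> R) y.
  by apply: linear_differentiable => z; exact: cvg_snd.
have D1 : differentiable (fst : X -> R * R) x.
  by apply: linear_differentiable => z; exact: cvg_fst.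
have D2 : differentiable (snd : X -> R) x.
  by apply: linear_differentiable => z; exact: cvg_snd.
have E1 : differentiable (fun y : X => y.1.1) x by exact: (differentiable_comp D1 (d1 _)).
have E2 : differentiable (fun y : X => y.1.2) x by exact: (differentiable_comp D1 (d2 _)).
have Z (r : R) (f : X -> R) : differentiable f x -> differentiable (fun y => r * f y) x.
  by move=> df; exact: (differentiableZ r df).
exact: (differentiableD (differentiableD (Z k.1.1%:~R _ E1) (Z k.1.2%:~R _ E2)) (Z k.2%:~R _ D2)).
Qed.

Lemma differentiable_wave k p q x : differentiable (wave k p q) x.
Proof.
have dc (t : R) : differentiable (cos : R -> R) t by apply/derivable1_diffP.
have ds (t : R) : differentiable (sin : R -> R) t by apply/derivable1_diffP.
have C := differentiable_comp (differentiable_phase k x) (dc _).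
have S := differentiable_comp (differentiable_phase k x) (ds _).
exact: (differentiableD (differentiableZ p C) (differentiableZ q S)).
Qed.

Lemma partial_wave i k p q :
  partial i (wave k p q) = wave k (freq k i * q) (- (freq k i * p)).
Proof.
apply/funext => x; rewrite /partial.
transitivity ('D_1 (fun t : R => wave k p q (x + t *: basis3 i)) 0).
  rewrite /derive; set F := (X in lim (X @ _)); set G := (X in _ = lim (X @ _)).
  suff -> : F = G by [].
  apply/funext => h; rewrite /F /G /= [h *: 1]mulr1 addr0 scale0r addr0.
  by rewrite [_ + x]addrC.
under eq_fun do rewrite /wave phase_shift.
set a := phase k x; set w := phase k _.
have D : is_derive (0 : R) (1 : R) (fun t : R => p * cos (a + t * w) + q * sin (a + t * w))
    (p * (- (w * sin a)) + q * (w * cos a)).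
  by derive_by_rules; rewrite /GRing.scale/= ?mul0r ?addr0; ring.
rewrite (@derive_val _ _ _ _ _ _ _ D) /wave -/a /freq -/w; ring.
Qed.

Lemma smooth_wave k p q : smooth (wave k p q).
Proof.
move=> s x; suff [p' [q' ->]] : exists p' q', foldr (@partial R) (wave k p q) s = wave k p' q'.
  exact: differentiable_wave.
elim: s => [|i s [p' [q' IH]]]; first by exists p, q.
by eexists; eexists; rewrite /= IH partial_wave.
Qed.

Lemma freqE k i : exists n : int, freq k i = n%:~R.
Proof.
rewrite /freq /phase /basis3/=; case: k => [[a b] c] /=.
case: i => [[|[|[|//]]] ?] /=; rewrite ?mulr1 ?mulr0 ?addr0 ?add0r.
- by exists a.
- by exists b.
- by exists c.
Qed.

Lemma norm2_freq k : norm2 k = \sum_(i < 3) freq k i ^+ 2.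
Proof.
rewrite !big_ord_recr big_ord0/= /norm2 /freq /phase/= ?mulr1 ?mulr0 ?addr0 ?add0r; ring.
Qed.

Lemma periodic_wave k p q : periodic3 (wave k p q).
Proof.
move=> i x; rewrite /wave phase_shift; have [n E] := freqE k i.
rewrite -/(freq k i) E.
have -> : phase k x + 2 * pi * n%:~R = phase k x + n%:~R * (pi *+ 2) by ring.
have -> : cos (phase k x + n%:~R * (pi *+ 2)) = cos (phase k x).
  by rewrite -!sinDpihalf addrAC sin_period_int.
by rewrite sin_period_int.
Qed.

Lemma wave_bounded k p q x : `|wave k p q x| <= `|p| + `|q|.
Proof.
apply: le_trans (ler_normD _ _) _; rewrite !normrM lerD// ler_piMr//.
- exact: cos_max.
- exact: sin_max.
Qed.

Lemma CL2_wave k p q : CL2 (fun x => (wave k p q x)%:C%C).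
Proof.
apply: (CL2_real_bounded (C := `|p| + `|q|)); last exact: wave_bounded.
by apply: measurable_funD; apply: measurable_funM => //;
  [apply: measurable_cos_comp|apply: measurable_sin_comp]; exact: measurable_phase.
Qed.

(** The definition of weak derivatives, tested with the real and imaginary parts
    of the character. *)
Lemma coef_weak_partial i u g k : CL2 u -> CL2 g -> is_weak_partial i u g ->
  coef g k = 'i%C * (freq k i)%:C%C * coef u k.
Proof.
move=> Lu Lg [_ H].
have E p q : ip u (fun x => (wave k (freq k i * q) (- (freq k i * p)) x)%:C%C) =
    - ip g (fun x => (wave k p q x)%:C%C).
  have := H _ (smooth_wave k p q) (periodic_wave k p q).
  rewrite partial_wave /ip => E1.
  rewrite (_ : (fun x => g x * _) = (fun x => g x * (wave k p q x)%:C%C)); last first.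
    by apply/funext => x; rewrite conjc_real.
  rewrite -E1; congr Cintegral; apply/funext => x.
  by rewrite conjc_real.
have charE (v : X -> R[i]) : CL2 v -> coef v k = ip v (fun x => (wave k 1 0 x)%:C%C) -
    'i%C * ip v (fun x => (wave k 0 1 x)%:C%C).
  move=> Lv; have L1 := CL2_wave k 1 0; have L2 := CL2_wave k 0 1.
  rewrite /coef (_ : char k = (fun x => (wave k 1 0 x)%:C%C + 'i%C * (wave k 0 1 x)%:C%C)).
    have ci : ('i%C)^*%C = - 'i%C :> R[i] by apply/eqP; rewrite eq_complex/= oppr0 !eqxx.
    by rewrite ipDr// ?ipZr//; [rewrite ci mulNr|exact: CL2Z].
  apply/funext => x; rewrite /char /wave; apply/eqP; rewrite eq_complex/=.
  by apply/andP; split; apply/eqP; ring.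
have waveZ (v : X -> R[i]) (r p q : R) : CL2 v ->
    ip v (fun x => (wave k (r * p) (r * q) x)%:C%C) = r%:C%C * ip v (fun x => (wave k p q x)%:C%C).
  move=> Lv; rewrite -[X in _ = X * _](conjc_real r) -ipZr//; last exact: CL2_wave.
  by congr ip; apply/funext => x; rewrite -rmorphM; congr (_%:C)%C; rewrite /wave; ring.
rewrite !charE//.
have E1 := E 1 0; have E2 := E 0 1.
rewrite mulr0 mulr1 (_ : - freq k i = (- freq k i) * 1) ?mulr1// in E1.
rewrite (_ : wave k 0 (- freq k i) = wave k ((- freq k i) * 0) ((- freq k i) * 1)) in E1; last by rewrite mulr0 mulr1.
rewrite (_ : wave k (freq k i * 1) _ = wave k (freq k i * 1) (freq k i * 0)) in E2; last by rewrite !mulr0 oppr0.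
rewrite waveZ// in E1; rewrite waveZ// in E2.
have -> : ip g (fun x => (wave k 1 0 x)%:C%C) = (freq k i)%:C%C * ip u (fun x => (wave k 0 1 x)%:C%C).
  by rewrite -[LHS]opprK -E1 rmorphN mulNr opprK.
have -> : ip g (fun x => (wave k 0 1 x)%:C%C) = - ((freq k i)%:C%C * ip u (fun x => (wave k 1 0 x)%:C%C)).
  by rewrite -[LHS]opprK -E2.
have ii : 'i%C * 'i%C = -1 :> R[i] by rewrite -expr2 sqr_i.
rewrite mulrBr mulrACA ii; ring.
Qed.

End Weak_derivatives.

(** * The inequality on the side of the coefficients *)

Section Coefficients_of_the_gradient.
Context {R : realType}.
Local Notation X := (R * R * R)%type.
Local Notation Re := (@complex.Re R).
Local Notation Im := (@complex.Im R).
Local Notation lat := (int * int * int)%type.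
Implicit Types (u g : X -> R[i]) (F : seq lat) (k : lat) (i : 'I_3) (x : X).

Lemma weak_partialP i u : (exists g, is_weak_partial i u g) ->
  is_weak_partial i u (weak_partial i u).
Proof. exact: xgetPex. Qed.

(** Everything that is used of the hypothesis on u: square integrability and the
    Fourier coefficients of the derivatives. *)
Lemma sobolev_coef u : sobolev 2 u ->
  [/\ CL2 u, forall i, CL2 (weak_partial i u),
      forall i k, coef (weak_partial i u) k = 'i%C * (freq k i)%:C%C * coef u k,
      CL2 (laplacian u) &
      forall k, coef (laplacian u) k = - (norm2 k)%:C%C * coef u k].
Proof.
move=> [Lu H].
have wD i := weak_partialP (H i).1.
have LD i : CL2 (weak_partial i u) by have [_ []] := H i.
have cD i k : coef (weak_partial i u) k = 'i%C * (freq k i)%:C%C * coef u k.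
  exact: coef_weak_partial.
have H2 i : (exists g, is_weak_partial i (weak_partial i u) g) /\
    CL2 (weak_partial i (weak_partial i u)).
  by have [_ [_ /(_ i)[? []]]] := H i.
have LDD i := (H2 i).2.
split=> //; first exact: CL2_sum.
move=> k; rewrite /coef /laplacian ip_sum//; last exact: CL2_char.
have ii : 'i%C * 'i%C = -1 :> R[i] by rewrite -expr2 sqr_i.
rewrite (eq_bigr (fun i => - (freq k i ^+ 2)%:C%C * coef u k)).
  by rewrite -mulr_suml sumrN -rmorph_sum norm2_freq.
move=> i _; rewrite -/(coef _ k) (coef_weak_partial k (LD i) (LDD i) (weak_partialP (H2 i).1)) cD.
transitivity ('i%C * 'i%C * ((freq k i)%:C%C * (freq k i)%:C%C) * coef u k); first by ring.
by rewrite ii expr2 rmorphM mulN1r.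
Qed.

Lemma coef_mean0 u : Cintegral u = 0 -> coef u 0 = 0.
Proof.
move=> <-; rewrite /coef /ip; congr Cintegral; apply/funext => x.
by rewrite char_conj oppr0 char0 mulr1.
Qed.

Lemma sum_freq_coef (I : seq lat) u : sobolev 2 u ->
  \sum_(i < 3) \sum_(k <- I) mod2 (coef (weak_partial i u) k) =
  \sum_(k <- I) norm2 k * mod2 (coef u k).
Proof.
move=> /sobolev_coef[_ _ cD _ _]; rewrite exchange_big; apply: eq_bigr => k _.
rewrite norm2_freq mulr_suml; apply: eq_bigr => i _.
by rewrite cD !mod2M mod2_real /mod2/= expr0n add0r expr1n mul1r.
Qed.

Lemma norm2_le_sqr k : norm2 k <= norm2 k ^+ 2 :> R.
Proof.
have [->|k0] := eqVneq k 0; first by rewrite norm2_0 expr0n.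
by rewrite expr2 ler_peMl ?norm2_ge0// norm2_ge1.
Qed.

(** The square of the norm of the gradient. *)
Definition grad2 u : R := \sum_(i < 3) nrm2 (weak_partial i u).

Lemma grad2_ge0 u : 0 <= grad2 u.
Proof. by apply: sumr_ge0 => i _; exact: nrm2_ge0. Qed.

Lemma Bessel_grad u F : sobolev 2 u -> uniq F ->
  \sum_(k <- F) norm2 k * mod2 (coef u k) <= vol * grad2 u.
Proof.
move=> Hu uF; have [_ LD _ _ _] := sobolev_coef Hu.
rewrite -sum_freq_coef// /grad2 mulr_sumr; apply: ler_sum => i _; exact: Bessel.
Qed.

Lemma Bessel_laplacian u F : sobolev 2 u -> uniq F ->
  \sum_(k <- F) norm2 k ^+ 2 * mod2 (coef u k) <= vol * nrm2 (laplacian u).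
Proof.
move=> Hu uF; have [_ _ _ LL cL] := sobolev_coef Hu.
apply: le_trans (Bessel LL uF); rewrite le_eqVlt; apply/orP; left; apply/eqP.
by apply: eq_bigr => k _; rewrite cL mod2M -rmorphN mod2_real sqrrN.
Qed.

(** The Poincare inequality for the gradient: nonzero frequencies have modulus
    at least 1, and the zero one does not contribute to the gradient. *)
Lemma grad2_le_laplacian u : sobolev 2 u -> grad2 u <= nrm2 (laplacian u).
Proof.
move=> Hu; have [_ LD _ _ _] := sobolev_coef Hu; have v0 := @vol_gt0 R.
apply/ler_addgt0Pr => e e0; have e3 : 0 < e / 3 by rewrite divr_gt0.
have /choice[F FP] : forall i, exists F, uniq F /\
    nrm2 (fun x => weak_partial i u x - psum (weak_partial i u) F x) <= e / 3.
  by move=> i; have [F uF FP] := Parseval (LD i) e3; exists F.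
(* One finite set of frequencies that serves the three derivatives at once. *)
pose G := undup (flatten [seq F i | i <- index_enum 'I_3]).
have uG : uniq G by exact: undup_uniq.
have nG i : nrm2 (weak_partial i u) <= (\sum_(k <- G) mod2 (coef (weak_partial i u) k)) / vol + e / 3.
  have [uF] := FP i; rewrite nrm2B_psum// lerBlDr => /le_trans; apply.
  rewrite [leLHS]addrC lerD2r ler_pM2r ?invr_gt0//.
  apply: (@le_trans _ _ (\sum_(k <- G | k \in F i) mod2 (coef (weak_partial i u) k))).
    rewrite -[leRHS]big_filter le_eqVlt; apply/orP; left; apply/eqP; apply: perm_big.
    apply: uniq_perm => //; first exact: filter_uniq.
    move=> k; rewrite mem_filter; case: (boolP (k \in F i)) => //= kF.
    rewrite mem_undup; apply/esym/flattenP; exists (F i) => //.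
    by apply: map_f; exact: mem_index_enum.
  rewrite [leRHS](bigID (fun k => k \in F i))/= lerDl.
  by apply: sumr_ge0 => k _; exact: mod2_ge0.
apply: (@le_trans _ _ ((\sum_(k <- G) norm2 k * mod2 (coef u k)) / vol + e)).
  rewrite /grad2 -sum_freq_coef// mulr_suml.
  apply: (le_trans (ler_sum _ (fun i _ => nG i))).
  rewrite big_split/= lerD2l sumr_const card_ord -[_ *+ 3]mulr_natr divfK//.
rewrite lerD2r ler_pdivrMr// [leRHS]mulrC; apply: le_trans (Bessel_laplacian Hu uG).
by apply: ler_sum => k _; rewrite ler_wpM2r ?mod2_ge0// norm2_le_sqr.
Qed.

Lemma Cauchy_Schwarz_seq (I : eqType) (s : seq I) (a b : I -> R) :
  (\sum_(k <- s) a k * b k) ^+ 2 <= (\sum_(k <- s) a k ^+ 2) * (\sum_(k <- s) b k ^+ 2).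
Proof.
elim: s => [|k s]; first by rewrite !big_nil mul0r expr0n.
rewrite !big_cons.
set S := \sum_(j <- s) (a j * b j).
have P0 : 0 <= \sum_(j <- s) a j ^+ 2 by apply: sumr_ge0 => j _; exact: sqr_ge0.
have Q0 : 0 <= \sum_(j <- s) b j ^+ 2 by apply: sumr_ge0 => j _; exact: sqr_ge0.
move: (\sum_(j <- s) a j ^+ 2) (\sum_(j <- s) b j ^+ 2) P0 Q0 => P Q P0 Q0 IH.
move: (a k) (b k) => p q.
have H : 2 * (S * (p * q)) <= P * q ^+ 2 + Q * p ^+ 2.
  have r0 : 0 <= P * q ^+ 2 + Q * p ^+ 2 by rewrite addr_ge0// mulr_ge0// sqr_ge0.
  apply: le_trans (ler_norm _) _; rewrite -(ler_pXn2r (n := 2)) ?nnegrE//.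
  rewrite real_normK ?num_real//.
  apply: (@le_trans _ _ (4 * (P * Q) * (p * q) ^+ 2)).
    rewrite (_ : (2 * _) ^+ 2 = 4 * S ^+ 2 * (p * q) ^+ 2); last ring.
    by rewrite ler_wpM2r ?sqr_ge0// ler_pM2l.
  rewrite -subr_ge0 (_ : _ - _ = (P * q ^+ 2 - Q * p ^+ 2) ^+ 2); last ring.
  exact: sqr_ge0.
rewrite -subr_ge0 (_ : _ - _ = (P * Q - S ^+ 2) +
  (P * q ^+ 2 + Q * p ^+ 2 - 2 * (S * (p * q)))); last ring.
by rewrite addr_ge0// subr_ge0.
Qed.

Lemma Green_partial s F : 0 < s -> uniq F -> (forall k, k \in F -> k != 0) ->
  \sum_(k <- F) (norm2 k * (norm2 k + s ^+ 2))^-1 <=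
  (2 * pi ^+ 2 * s + beta3 R + s ^- 2) / s ^+ 2.
Proof.
move=> s0 uF F0; have s20 : 0 < s ^+ 2 by rewrite exprn_gt0.
rewrite ler_pdivlMr// mulr_suml -lee_fin; apply: le_trans (Green_bound s0).
apply: esum_ge; exists [set` F].
  by split; [exact: finite_seq|move=> k /= /F0].
rewrite -fsbig_seq// sumEFin lee_fin; apply: ler_sum => k _.
by rewrite mulrC.
Qed.

(** Cauchy-Schwarz with the weight |k|^2 (|k|^2 + s^2), the symbol of the
    operator Delta^2 - s^2 Delta, whose Green function at 0 is controlled by
    beta3. The parameter s is free. *)
Lemma sum_coef_le s u F : 0 < s -> sobolev 2 u -> Cintegral u = 0 -> uniq F ->
  (\sum_(k <- F) cmod (coef u k / vol%:C%C)) ^+ 2 <=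
  (2 * pi ^+ 2 * s + beta3 R + s ^- 2) / s ^+ 2 *
  (nrm2 (laplacian u) + s ^+ 2 * grad2 u) / vol.
Proof.
move=> s0 Hu u0 uF; have v0 := @vol_gt0 R; have s20 : 0 < s ^+ 2 by rewrite exprn_gt0.
pose G := [seq k <- F | k != 0]; have uG : uniq G by exact: filter_uniq.
have G0 k : k \in G -> k != 0 by rewrite mem_filter => /andP[].
have -> : \sum_(k <- F) cmod (coef u k / vol%:C%C) = (\sum_(k <- G) cmod (coef u k)) / vol.
  rewrite (bigID (fun k => k == 0))/= big1 ?add0r; last first.
    by move=> k /eqP ->; rewrite coef_mean0// mul0r /cmod/= expr0n addr0 sqrtr0.
  rewrite -big_filter -/G mulr_suml; apply: eq_bigr => k _.
  rewrite cmodM; congr (_ * _); rewrite -(fmorphV (real_complex R)).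
  by rewrite /cmod/= expr0n addr0 sqrtr_sqr ger0_norm// invr_ge0 ltW.
pose w k : R := norm2 k * (norm2 k + s ^+ 2).
have w0 k : k \in G -> 0 < w k.
  by move=> /G0 k0; rewrite mulr_gt0// ?norm2_gt0// addr_gt0// norm2_gt0.
have -> : \sum_(k <- G) cmod (coef u k) =
    \sum_(k <- G) (Num.sqrt (w k))^-1 * (Num.sqrt (w k) * cmod (coef u k)).
  rewrite big_seq [RHS]big_seq; apply: eq_bigr => k kG.
  by rewrite mulKf// gt_eqF// sqrtr_gt0 w0.
have CS := Cauchy_Schwarz_seq G (fun k => (Num.sqrt (w k))^-1)
  (fun k => Num.sqrt (w k) * cmod (coef u k)).
rewrite [leLHS]exprMn exprVn [vol ^+ 2]expr2 invfM mulrA.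
rewrite ler_pM2r ?invr_gt0// ler_pdivrMr// -[leRHS]mulrA.
apply: (le_trans CS); apply: ler_pM.
- by apply: sumr_ge0 => k _; exact: sqr_ge0.
- by apply: sumr_ge0 => k _; exact: sqr_ge0.
- apply: le_trans (Green_partial s0 uG G0); rewrite big_seq [leRHS]big_seq.
  by apply: ler_sum => k kG; rewrite exprVn sqr_sqrtr// ltW// w0.
- apply: (@le_trans _ _ (\sum_(k <- G) norm2 k ^+ 2 * mod2 (coef u k) +
      s ^+ 2 * \sum_(k <- G) norm2 k * mod2 (coef u k))).
    rewrite mulr_sumr -big_split/= big_seq [leRHS]big_seq; apply: ler_sum => k kG.
    rewrite exprMn sqr_sqrtr ?(ltW (w0 _ kG))// cmod2 /w.
    by rewrite le_eqVlt; apply/orP; left; apply/eqP; ring.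
  rewrite mulrDl; apply: lerD; first by rewrite mulrC Bessel_laplacian.
  by rewrite -[leRHS]mulrA ler_pM2l// [leRHS]mulrC Bessel_grad.
Qed.

(** With x = s + 3/10 standing for the quotient of the norms of the Laplacian
    and of the gradient, this is the passage from the bound with the parameter
    s to the bound of the theorem. A shift d of the parameter makes the
    difference of the two sides, times s^4, a cubic with leading coefficient
    2 d b - 2 d^2 pi^2. The choice d = 3/10 keeps the cubic nonnegative for all
    x >= 1, with little room at x = 1. *)
Lemma optimal_shift (b s : R) : 171 / 20 <= b -> 7 / 10 <= s ->
  (2 * pi ^+ 2 * s - b + s ^- 2) / s ^+ 2 * ((s + 3 / 10) ^+ 2 + s ^+ 2) <=
  4 * pi ^+ 2 * (s + 3 / 10) - 2 * b.
Proof.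
move=> b1 s1; have q1 : pi ^+ 2 <= 256 / 25 :> R.
  have := @pi_lt32 R; have := pi_ge0 R; move: (pi : R) => p; nra.
move: (pi ^+ 2) q1 => q q1.
have s0 : 0 < s by lra.
have s4 : 0 < s ^+ 4 by rewrite exprn_gt0.
rewrite -(ler_pM2r s4).
have -> : (2 * q * s - b + s ^- 2) / s ^+ 2 * ((s + 3 / 10) ^+ 2 + s ^+ 2) * s ^+ 4 =
    (2 * q * s ^+ 3 - b * s ^+ 2 + 1) * (2 * s ^+ 2 + 3 / 5 * s + 9 / 100).
  by field; rewrite gt_eqF.
rewrite -subr_ge0.
have -> : (4 * q * (s + 3 / 10) - 2 * b) * s ^+ 4 -
  (2 * q * s ^+ 3 - b * s ^+ 2 + 1) * (2 * s ^+ 2 + 3 / 5 * s + 9 / 100) =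
  (3 / 5 * b - 9 / 50 * q) * s ^+ 3 + (9 / 100 * b - 2) * s ^+ 2 - 3 / 5 * s - 9 / 100.
  by field.
have c3 : 82 / 25 * s ^+ 3 <= (3 / 5 * b - 9 / 50 * q) * s ^+ 3.
  by rewrite ler_pM2r ?exprn_gt0//; lra.
have c2 : - (5 / 4) * s ^+ 2 <= (9 / 100 * b - 2) * s ^+ 2.
  by rewrite ler_pM2r ?exprn_gt0//; lra.
suff : 0 <= ((82 / 25 * s - 5 / 4) * s - 3 / 5) * s - 9 / 100.
  by rewrite !mulrBl -!mulrA -!expr2 -!exprS; lra.
(* Horner evaluation from s = 7/10 upwards. *)
have e1 : 209 / 200 <= 82 / 25 * s - 5 / 4 by lra.
have e2 : 13 / 100 <= (82 / 25 * s - 5 / 4) * s - 3 / 5 by nra.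
nra.
Qed.

End Coefficients_of_the_gradient.

(** * The inequality *)

Section Sharp_bound.
Context {R : realType}.
Local Notation tm := (@torus_measure R).
Local Notation X := (R * R * R)%type.
Local Notation lat := (int * int * int)%type.
Implicit Types (u f : X -> R[i]) (F : seq lat) (k : lat).

(** If the gradient vanishes all coefficients do. Otherwise the parameter is the
    quotient of the norms of the Laplacian and of the gradient, which is at
    least 1, less 3/10. *)
Lemma sum_coef_sharp u F : sobolev 2 u -> Cintegral u = 0 -> uniq F ->
  (\sum_(k <- F) cmod (coef u k / vol%:C%C)) ^+ 2 <=
  1 / (2 * pi) * Num.sqrt (grad2 u) * Num.sqrt (nrm2 (laplacian u))
  - (- beta3 R / (4 * pi ^+ 3)) * grad2 u.
Proof.
move=> Hu u0 uF; have A0 := grad2_ge0 u; have AB := grad2_le_laplacian Hu.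
have [Az|An] := eqVneq (grad2 u) 0.
  rewrite Az sqrtr0 !mulr0 mul0r subr0 big1 ?expr0n// => k _.
  have [->|k0] := eqVneq k 0; first by rewrite coef_mean0// mul0r /cmod/= expr0n addr0 sqrtr0.
  have := @Bessel_grad _ u [:: k] Hu isT; rewrite big_seq1 Az mulr0 => H.
  have c0 : mod2 (coef u k) = 0.
    apply/eqP; rewrite eq_le mod2_ge0 andbT; apply: le_trans H.
    by rewrite ler_peMl ?mod2_ge0// norm2_ge1.
  by rewrite cmodM {1}/cmod -/(mod2 _) c0 sqrtr0 mul0r.
have Ap : 0 < grad2 u by rewrite lt0r An.
set A := grad2 u in A0 AB An Ap *; set B := nrm2 (laplacian u) in AB *.
have rA : 0 < Num.sqrt A by rewrite sqrtr_gt0.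
pose x := Num.sqrt B / Num.sqrt A.
have x1 : 1 <= x by rewrite ler_pdivlMr// mul1r ler_wsqrtr.
have EB : Num.sqrt B = x * Num.sqrt A by rewrite /x divfK// gt_eqF.
have A2 : Num.sqrt A ^+ 2 = A by rewrite sqr_sqrtr.
have B2 : B = x ^+ 2 * A.
  by rewrite -A2 -exprMn -EB sqr_sqrtr// (le_trans _ AB).
pose s := x - 3 / 10.
have s1 : 7 / 10 <= s by rewrite /s; lra.
have s0 : 0 < s by lra.
have b1 : 171 / 20 <= - beta3 R by have := @beta3_le R; lra.
apply: le_trans (sum_coef_le s0 Hu u0 uF) _; rewrite -/A -/B.
have := optimal_shift b1 s1; rewrite opprK (_ : s + 3 / 10 = x); last by rewrite /s subrK.
have v0 := @vol_gt0 R.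
move=> /(ler_wpM2r (divr_ge0 A0 (ltW v0))) H.
have -> : 1 / (2 * pi) * Num.sqrt A * Num.sqrt B - - beta3 R / (4 * pi ^+ 3) * A =
    (4 * pi ^+ 2 * x - 2 * - beta3 R) * (A / vol).
  have E (p a b : R) : 0 < p -> 1 / (2 * p) * a * (x * a) - - b / (4 * p ^+ 3) * a ^+ 2 =
      (4 * p ^+ 2 * x - 2 * - b) * (a ^+ 2 / (2 * p) ^+ 3).
    by move=> p0; field; rewrite gt_eqF.
  by rewrite EB; have := E pi (Num.sqrt A) (beta3 R) (pi_gt0 R); rewrite A2.
apply: le_trans H; rewrite B2 le_eqVlt; apply/orP; left; apply/eqP.
by rewrite -mulrDl !mulrA.
Qed.

Lemma norm_L2E f : CL2 f -> norm_L2 f = (Num.sqrt (nrm2 f))%:E.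
Proof.
move=> Lf; rewrite /norm_L2 unlock /Lnorm.
have i := integrable_mod2 Lf.
rewrite (_ : (\int[tm]_x _)%E = (nrm2 f)%:E).
  by rewrite poweR_EFin -powR12_sqrt ?nrm2_ge0.
rewrite /nrm2 /Rintegral fineK; last exact: integrable_fin_num i.
apply: eq_integral => x _; rewrite abse_EFin poweR_EFin ger0_norm ?cmod_ge0//.
by rewrite powR_mulrn ?cmod_ge0// cmod2.
Qed.

Lemma norm_grad_L2E u : (forall i, CL2 (weak_partial i u)) ->
  norm_grad_L2 u = (Num.sqrt (grad2 u))%:E.
Proof.
move=> LD; rewrite /norm_grad_L2 unlock /Lnorm.
have i j := integrable_mod2 (LD j).
rewrite (_ : (\int[tm]_x _)%E = (grad2 u)%:E).
  by rewrite poweR_EFin -powR12_sqrt ?grad2_ge0.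
have -> : (grad2 u)%:E = (\sum_(j < 3) \int[tm]_x (mod2 (weak_partial j u x))%:E)%E.
  rewrite /grad2 -sumEFin; apply: eq_bigr => j _.
  by rewrite /nrm2 /Rintegral fineK//; exact: integrable_fin_num (i j).
rewrite -ge0_integral_sum//; last 2 first.
- by move=> j; have /integrableP[] := i j.
- by move=> j x _; rewrite lee_fin mod2_ge0.
apply: eq_integral => x _; rewrite abse_EFin poweR_EFin ger0_norm ?sqrtr_ge0//.
rewrite powR_mulrn ?sqrtr_ge0// sqr_sqrtr; last first.
  by apply: sumr_ge0 => j _; exact: sqr_ge0.
by rewrite sumEFin; congr EFin; apply: eq_bigr => j _; exact: cmod2.
Qed.

Lemma norm_Linfty_le f M : CL2 f -> 0 <= M ->
  {ae tm, forall x, cmod (f x) <= M} -> (norm_Linfty f <= M%:E)%E.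
Proof.
move=> Lf M0 fM; rewrite /norm_Linfty unlock /Lnorm; case: ifPn => // _.
apply/ess_supP; case: fM => N [mN N0 fN]; exists N; split=> // x fx; apply: fN => /= fM.
by apply: fx; rewrite /= lee_fin ger0_norm ?cmod_ge0.
Qed.

End Sharp_bound.

Theorem lemma3p10 (R : realType) (u : R * R * R -> R[i])
    (u_H2 : sobolev 2 u) (u_mean0 : Cintegral u = 0) :
  (norm_Linfty u ^+ 2 <=
   (1 / (2 * pi))%:E * norm_grad_L2 u * norm_L2 (laplacian u)
   - (- beta3 R / (4 * pi ^+ 3))%:E * norm_grad_L2 u ^+ 2)%E.
Proof.
have [Lu LD _ LL _] := sobolev_coef u_H2.
rewrite norm_grad_L2E// norm_L2E// -EFin_expe -!EFinM -EFinB sqr_sqrtr ?grad2_ge0//.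
set T := (X in (_ <= X%:E)%E).
have FT F : uniq F -> (\sum_(k <- F) cmod (coef u k / vol%:C%C)) ^+ 2 <= T.
  exact: sum_coef_sharp.
have T0 : 0 <= T by apply: le_trans (FT [::] isT); exact: sqr_ge0.
have NT : (norm_Linfty u <= (Num.sqrt T)%:E)%E.
  apply: (norm_Linfty_le Lu (sqrtr_ge0 T)).
  apply: ae_le_of_psum => // F uF.
  have S0 : 0 <= \sum_(k <- F) cmod (coef u k / vol%:C%C).
    by apply: sumr_ge0 => k _; exact: cmod_ge0.
  by rewrite -(ger0_norm S0) -sqrtr_sqr ler_wsqrtr// FT.
have N0 : (0 <= norm_Linfty u)%E by exact: Lnorm_ge0.
apply: (@le_trans _ _ ((Num.sqrt T)%:E ^+ 2)%E).
  by rewrite !expe2 lee_pmul.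
by rewrite -EFin_expe sqr_sqrtr.
Qed.
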